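(* Let $\mathcal{G}(m,\Delta)$ be the class of uniform hypergraphs with minimum edge size $m\geq 3$ and maximum degree $\Delta$. Computing the number of independent sets of hypergraphs in $\mathcal{G}(m,\Delta)$ is #P-complete if $\Delta\geq 2$. If $\Delta\leq 1$, it is in P (that is, computable in polynomial time).
   Context: A hypergraph $\mathcal{H}=(\mathcal{V},\mathcal{E})$ has a finite vertex set $\mathcal{V}$ and edges that are subsets of $\mathcal{V}$; it is uniform if all its edges have the same size. The degree of a vertex is the number of edges containing it. A set $S\subseteq\mathcal{V}$ is independent if no edge is a subset of $S$. Here $m$ and $\Delta$ are fixed and the input is a hypergraph in $\mathcal{G}(m,\Delta)$. #P-completeness is with respect to polynomial-time Turing reductions. *)

(* Defs.v *)
From HB Require Import structures.
From mathcomp Require Import all_boot all_order all_algebra.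

Set Implicit Arguments.
Unset Strict Implicit.
Unset Printing Implicit Defensive.

(** * Hypergraphs *)

Record hypergraph := Hypergraph {
  vertices : finType;
  edges : {set {set vertices}}
}.

Definition degree (H : hypergraph) (v : vertices H) : nat :=
  #|[set e in edges H | v \in e]|.

Definition max_degree (H : hypergraph) : nat := \max_(v : vertices H) degree v.

(* For a uniform hypergraph the minimum edge size is the common size of its
   edges. The condition on edges is vacuous for an edgeless hypergraph, so the
   class with Delta = 0 consists of the edgeless hypergraphs. *)
Definition in_class (m Delta : nat) (H : hypergraph) : bool :=
  [forall e in edges H, #|e| == m] && (max_degree H == Delta).

Definition independent (H : hypergraph) (S : {set vertices H}) : bool :=
  [forall e in edges H, ~~ (e \subset S)].

Definition num_independent (H : hypergraph) : nat :=
  #|[set S : {set vertices H} | independent S]|.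

(** * Words *)

Definition word := seq bool.

(* Binary notation, least significant bit first, no leading zero; 0 is the
   empty word. *)
Definition binary (n : nat) : word :=
  mkseq (fun i => odd (n %/ 2 ^ i)) (up_log 2 n.+1).

Definition pair_word (x y : word) : word :=
  flatten [seq [:: true; b] | b <- x] ++ false :: y.

(* A hypergraph on 'I_n is presented by the word 1^n 0 r_1 ... r_k where
   r_1, ..., r_k are the characteristic vectors (of length n) of its edges, each
   edge being listed once, in any order. *)
Definition encode (n : nat) (s : seq {set 'I_n}) : word :=
  nseq n true ++ false ::
  flatten [seq [seq i \in e | i <- enum 'I_n] | e : {set 'I_n} <- s].

Definition decode (w : word) : option hypergraph :=
  let n := index false w in
  let u := drop n.+1 w in
  let s := [seq [set i : 'I_n | nth false r i]
           | r <- reshape (nseq (size u %/ n) n) u] in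
  if [&& false \in w, n %| size u & uniq s]
  then Some (@Hypergraph 'I_n [set e in s]) else None.

Lemma encodeK (n : nat) (s : seq {set 'I_n}) :
  uniq s -> set0 \notin s ->
  decode (encode s) = Some (@Hypergraph 'I_n [set e in s]).
Proof.
move=> s_uniq s0; rewrite /decode /encode.
set rs := [seq _ | e : {set 'I_n} <- s].
have -> : index false (nseq n true ++ false :: flatten rs) = n.
  by elim: (n) => //= k ->.
have -> : drop n.+1 (nseq n true ++ false :: flatten rs) = flatten rs.
  by rewrite -cat_rcons drop_size_cat // size_rcons size_nseq.
have sh : shape rs = nseq (size s) n.
  rewrite /shape /rs -map_comp; elim: (s) => //= e s' ->.
  by rewrite size_map -cardE card_ord.
have sz : size (flatten rs) = size s * n.
  by rewrite size_flatten sh sumn_nseq mulnC.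
have q : nseq (size (flatten rs) %/ n) n = shape rs.
  rewrite sh sz; case: (posnP n) => [n0|n_gt0]; last by rewrite mulnK.
  case: (s) s0 => [|e s'] //=; first by rewrite div0n.
  have -> : e = set0 by apply/setP => i; have := ltn_ord i; rewrite {2}n0.
  by rewrite inE eqxx.
rewrite q flattenK -map_comp (_ : map _ s = s) ?sz ?dvdn_mull ?s_uniq //.
  by rewrite mem_cat inE eqxx orbT.
rewrite -[RHS]map_id; apply: eq_map => e; apply/setP => i /=.
by rewrite inE (nth_map i) ?nth_ord_enum // -cardE card_ord.
Qed.

(* The counting problem as a function on words: words that do not present a
   hypergraph of the class are sent to 0. *)
Definition count_independent (m Delta : nat) (w : word) : nat :=
  if decode w is Some H then
    if in_class m Delta H then num_independent H else 0
  else 0.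

(** * Multitape oracle Turing machines *)

Definition symbol := option bool. (* None is the blank *)

(* A two-way infinite tape: the head scans the first cell of [ahead], [behind]
   lists the cells on its left, nearest first; all other cells are blank. *)
Record tape := Tape { behind : seq symbol; ahead : seq symbol }.

Definition tape_of_word (w : word) : tape := Tape [::] (map Some w).

(* The bits from the scanned cell up to the first blank. *)
Definition word_of_tape (t : tape) : word :=
  pmap id (take (index None (ahead t)) (ahead t)).

Inductive move := MoveLeft | Stay | MoveRight.

Definition read_tape (t : tape) : symbol := head None (ahead t).

Definition write_tape (a : symbol) (t : tape) : tape :=
  Tape (behind t) (a :: behead (ahead t)).

Definition move_tape (d : move) (t : tape) : tape :=
  match d with
  | MoveLeft => Tape (behead (behind t)) (head None (behind t) :: ahead t)
  | Stay => t
  | MoveRight => Tape (read_tape t :: behind t) (behead (ahead t))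
  end.

(* [Ask q] submits the word on the oracle tape to the oracle, replaces the
   contents of that tape by the answer, and enters state [q]. *)
Inductive action (Q : Type) (k : nat) :=
  | Halt
  | Act of Q & {ffun 'I_k -> symbol * move}
  | Ask of Q.

(* Tape [ord0] holds the input and, at the end, the output; tape [ord_max] is
   the oracle tape. *)
Record machine := Machine {
  work_tapes : nat;
  state : finType;
  start : state;
  next : state -> {ffun 'I_work_tapes.+2 -> symbol} ->
         action state work_tapes.+2
}.

Definition oracle_free (M : machine) : Prop :=
  forall (q : state M) r (q' : state M), next q r <> Ask _ q'.

Record config (M : machine) := Config {
  cstate : state M;
  tapes : {ffun 'I_(work_tapes M).+2 -> tape}
}.

Definition init (M : machine) (x : word) : config M :=
  Config (start M) [ffun i => tape_of_word (if i == ord0 then x else [::])].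

Definition next_action (M : machine) (c : config M) :=
  next (cstate c) [ffun i => read_tape (tapes c i)].

Definition step (M : machine) (O : word -> word) (c : config M) : config M :=
  match next_action c with
  | Halt => c
  | Act q f =>
      Config q [ffun i => move_tape (f i).2 (write_tape (f i).1 (tapes c i))]
  | Ask q =>
      Config q [ffun i => if i == ord_max
                          then tape_of_word (O (word_of_tape (tapes c ord_max)))
                          else tapes c i]
  end.

Definition halted (M : machine) (c : config M) : bool :=
  if next_action c is Halt then true else false.

(* [step] is the identity on halted configurations, so this says that [M] with
   oracle [O] halts on [x] within [t] steps with output [y]. *)
Definition computes_within (M : machine) (O : word -> word) (x y : word)
    (t : nat) : Prop :=
  let c := iter t (step O) (init M x) in
  halted c /\ word_of_tape (tapes c ord0) = y.

(** * Complexity classes *)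

Definition poly_time (f : word -> word) : Prop :=
  exists (M : machine) (p : {poly nat}), oracle_free M /\
    forall x, computes_within M (fun=> [::]) x (f x) p.[size x]%R.

Definition poly_time_language (L : pred word) : Prop :=
  poly_time (fun w => [:: L w]).

Definition poly_time_computable (f : word -> nat) : Prop :=
  poly_time (fun x => binary (f x)).

Definition sharpP (f : word -> nat) : Prop :=
  exists (V : pred word) (p : {poly nat}), poly_time_language V /\
    forall x, f x = #|[set y : p.[size x]%R.-tuple bool | V (pair_word x y)]|.

Definition turing_reducible (g f : word -> nat) : Prop :=
  exists (M : machine) (p : {poly nat}), forall x,
    computes_within M (fun q => binary (f q)) x (binary (g x)) p.[size x]%R.

Definition sharpP_complete (f : word -> nat) : Prop :=
  sharpP f /\ forall g : word -> nat, sharpP g -> turing_reducible g f.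

(* Main.v *)
(* Membership in #P is guess and check, and for [Delta <= 1] the edges are disjoint.

   For the hardness, the accepting computations of a verifier are first written as
   transversals: choices of one tile per cell of the space-time diagram that are
   compatible pairwise. Let [S] range over the sets of pairs (cell, tile), let [g S] be
   the number of members of [S] that are compatible with themselves, and [e S] the
   number of incompatible pairs in [S]. In [Z = \sum_S 2 ^ (L * g S + t * e S)], with
   [L] and [t] large, the number of transversals stands at the binary digits
   [L * N, ..., t - 1], where [N] is the number of cells.

   Next, [Z] is the number of independent sets of a hypergraph of maximum degree two,
   up to a known power of two and modulo a large odd number. By inclusion-exclusion the
   independent sets of such a hypergraph are counted by a partition function of
   two-state spins sitting on the edges, in which a vertex of degree two couples two
   spins by the matrix [[2, 1], [1, 1]] and each spin carries the weights
   [a = 2 ^ (m - 2)] and [-1]. The transfer matrix [X] has trace [2 a - 1] and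
   determinant [- a], so [X ^ (2 l) = V_l X ^ l - (- a) ^ l], where [V] is the companion
   Lucas sequence. Hence for odd [l] a chain of [2 l - 1] spins forces its two ends to be
   equal modulo [V_l]. A cycle of such chains is one spin with arbitrarily many ports,
   and identifying the free vertices at two ports costs a factor depending on whether
   both spins are set. A disjoint sunflower brings the maximum degree to [Delta] and
   multiplies the count by a constant. *)
Require Import Defs.
From mathcomp Require Import all_boot all_order all_algebra zify ring.
From Stdlib Require Import FunctionalExtensionality.

Set Implicit Arguments.
Unset Strict Implicit.
Unset Printing Implicit Defensive.

Import GRing.Theory.

(** * Stack programs *)

(** Two obstacles shape the proof. The machine model is concrete, so each polynomial-time claim
    needs an actual program. A class [fp] of functions closed under composition, bounded iteration
    and binary arithmetic is therefore compiled to machines once, with the oracle as a parameter;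
    the reduction is then a function assembled from closure rules, and it asks a single query. On
    the counting side, degree two leaves only one coupling matrix. The transfer matrix has real
    eigenvalues of opposite sign and different absolute value, so no power of it is scalar and no
    chain forces equality exactly; it can do so only modulo something. The modulus [V_l] is
    exponential in [l], so a chain of polynomial length lifts it above [Z], and it is odd, so powers
    of two can be divided out. Moreover matched ports contribute only factors at least 1, hence a
    conflict cannot be forbidden. It is rewarded instead: the factor [2 ^ t] lifts every conflicting
    set above the digits that are read, and the reward [2 ^ L] for compatible members makes the
    transversals the leading term among the remaining sets. *)

Definition regs := nat -> word.

Definition upd (s : regs) (r : nat) (w : word) : regs :=
  fun r' => if r' == r then w else s r'.

Lemma updE s r w : upd s r w r = w.
Proof. by rewrite /upd eqxx. Qed.

Lemma upd_neq s r w r' : r' != r -> upd s r w r' = s r'.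
Proof. by rewrite /upd => /negbTE ->. Qed.

Inductive instr (Q : Type) :=
  | Done
  | Push of nat & bool & Q
  | Pop of nat & Q & (bool -> Q)
  | Query of Q.

Arguments Done {Q}.

Definition map_instr Q Q' (h : Q -> Q') (i : instr Q) : instr Q' :=
  match i with
  | Done => Done
  | Push r b q => Push r b (h q)
  | Pop r q qb => Pop r (h q) (fun b => h (qb b))
  | Query q => Query (h q)
  end.

Definition instr_reg Q (i : instr Q) : nat :=
  match i with Push r _ _ | Pop r _ _ => r | _ => 0 end.

Record prog := Prog {
  pstate : finType;
  pstart : pstate;
  pcode : pstate -> instr pstate
}.

(** With [allowed] false a query has no execution rule and the compiled machine is oracle-free, so
    one development serves both polynomial time and Turing reductions. *)
Record oracle := Oracle { answer : word -> word; allowed : bool }.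

Inductive exec (O : oracle) (P : prog) :
    pstate P -> regs -> nat -> regs -> Prop :=
  | ExecDone q s : pcode q = Done -> exec O q s 0 s
  | ExecPush q s r b q' n s' : pcode q = Push r b q' ->
      exec O q' (upd s r (b :: s r)) n s' -> exec O q s n.+1 s'
  | ExecPop0 q s r q' qb n s' : pcode q = Pop r q' qb -> s r = [::] ->
      exec O q' s n s' -> exec O q s n.+1 s'
  | ExecPop q s r q' qb b w n s' : pcode q = Pop r q' qb -> s r = b :: w ->
      exec O (qb b) (upd s r w) n s' -> exec O q s n.+1 s'
  | ExecQuery q s q' n s' : pcode q = Query q' -> allowed O ->
      exec O q' (upd s 1 (answer O (s 1))) n s' -> exec O q s n.+1 s'.

Definition runs (O : oracle) (P : prog) (s : regs) (n : nat) (s' : regs) :=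
  exec O (pstart P) s n s'.

Arguments exec O P q s n s' : clear implicits.

(** * Simulation of stack programs by multitape machines, one tape per register *)

Section Simulation.

Variables (O : oracle) (P : prog).

Let k := \max_(q : pstate P) instr_reg (pcode q).

Let reg_tape (r : nat) : 'I_k.+2 :=
  if r == 0 then ord0 else if r == 1 then ord_max else inord r.-1.

Let reg_tapeI r r' : r < k.+2 -> r' < k.+2 ->
  (reg_tape r == reg_tape r') = (r == r').
Proof.
rewrite -val_eqE /reg_tape /=.
case: r => [|[|r]]; case: r' => [|[|r']] //= hr hr';
  rewrite ?inordK ?eqSS; try lia.
all: apply/eqP; lia.
Qed.

(** A head writes before it moves, so a push takes two steps: [inl q] moves left onto a fresh cell
    and [inr q] writes the bit there. This is the factor 2 in the time bounds. *)
Definition sim_next (q : pstate P + pstate P) (rd : {ffun 'I_k.+2 -> symbol}) :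
    action (pstate P + pstate P)%type k.+2 :=
  match q with
  | inl q => match pcode q with
    | Done => Halt _ _
    | Push r b q' =>
        Act (inr q) [ffun i => (rd i, if i == reg_tape r then MoveLeft else Stay)]
    | Pop r q' qb =>
        if rd (reg_tape r) is Some b
        then Act (inl (qb b)) [ffun i => if i == reg_tape r
                                         then (None, MoveRight) else (rd i, Stay)]
        else Act (inl q') [ffun i => (rd i, Stay)]
    | Query q' => if allowed O then Ask _ (inl q') else Halt _ _
    end
  | inr q =>
    if pcode q is Push r b q'
    then Act (inl q') [ffun i => (if i == reg_tape r then Some b else rd i, Stay)]
    else Halt _ _
  end.

Definition sim_machine : machine :=
  @Machine k (pstate P + pstate P)%type (inl (pstart P)) sim_next.

Lemma sim_oracle_free : ~~ allowed O -> oracle_free sim_machine.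
Proof.
move=> /negbTE nO [q|q] rd q' /=; case: (pcode q) => //=; rewrite ?nO //.
by move=> r q1 qb; case: (rd _).
Qed.

(** The top of the stack is under the head. Popped cells are blanked and left behind on the left;
    reading past the end of the list leaves explicit blanks on the right. Both amounts are therefore
    left open. *)
Definition stores (t : tape) (w : word) :=
  exists i j, t = Tape (nseq i None) (map Some w ++ nseq j None).

Let holds (ts : {ffun 'I_k.+2 -> tape}) (s : regs) :=
  forall r, r < k.+2 -> stores (ts (reg_tape r)) (s r).

Lemma stores_word t w : stores t w -> word_of_tape t = w.
Proof.
case=> i [j] -> {t}; rewrite /word_of_tape /=.
have -> : index None (map Some w ++ nseq j None) = size w.
  by elim: w => [|b w /= ->] //; case: j.
rewrite take_size_cat ?size_map //.
by elim: w => //= b w ->.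
Qed.

Lemma stores_tape_of_word w : stores (tape_of_word w) w.
Proof. by exists 0, 0; rewrite cats0. Qed.

Lemma stores_read t w : stores t w -> read_tape t = ohead w.
Proof. by case=> i [j] ->; case: w => //=; case: j. Qed.

Lemma stores_stay t w : stores t w ->
  stores (move_tape Stay (write_tape (read_tape t) t)) w.
Proof.
case=> i [j] ->; exists i; case: w => [|b w]; last by exists j.
by case: j => [|j]; [exists 1 | exists j.+1].
Qed.

Lemma stores_pop t b w : stores t (b :: w) ->
  stores (move_tape MoveRight (write_tape None t)) w.
Proof. by case=> i [j] ->; exists i.+1, j. Qed.

Lemma stores_push t b w : stores t w ->
  stores (move_tape Stay (write_tape (Some b)
           (move_tape MoveLeft (write_tape (read_tape t) t)))) (b :: w).
Proof.
case=> i [j] ->; exists i.-1; rewrite /move_tape /write_tape /read_tape /=.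
have -> : behead (nseq i (None : symbol)) = nseq i.-1 None by case: i.
case: w => [|c w]; last by exists j.
by case: j => [|j]; [exists 1 | exists j.+1].
Qed.

Let reg_lt (q : pstate P) : instr_reg (pcode q) < k.+2.
Proof. by rewrite ltnW // !ltnS (leq_bigmax q). Qed.

Notation stepO := (@step sim_machine (answer O)).

Lemma halted_iter (M : machine) A (c : config M) n :
  halted c -> iter n (step A) c = c.
Proof.
move=> hc; elim: n => //= n ->; move: hc.
by rewrite /halted /step; case: (next_action c).
Qed.

Lemma sim_exec q s n s' : exec O P q s n s' -> forall ts, holds ts s ->
  exists2 t, t <= n.*2 &
  let c := iter t stepO (@Config sim_machine (inl q) ts) in
  halted c /\ holds (tapes c) s'.
Proof.
have stay ts s0 : holds ts s0 ->
    holds [ffun i => move_tape ([ffun i0 => ([ffun i1 => read_tape (ts i1)] i0, Stay)] i).2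
      (write_tape ([ffun i0 => ([ffun i1 => read_tape (ts i1)] i0, Stay)] i).1 (ts i))] s0.
  by move=> h r hr; rewrite !ffunE /=; apply: stores_stay; apply: h.
elim=> {q s n s'}.
- move=> q s e ts h; exists 0 => //=; split=> //.
  by rewrite /halted /next_action /= e.
- move=> q s r b q' n s' e _ IH ts h.
  have hr : r < k.+2 by have := reg_lt q; rewrite e.
  have [|t tn ht] := IH [ffun i => if i == reg_tape r then
      move_tape Stay (write_tape (Some b)
           (move_tape MoveLeft (write_tape (read_tape (ts i)) (ts i))))
      else move_tape Stay (write_tape (read_tape (move_tape Stay (write_tape (read_tape (ts i)) (ts i)))) (move_tape Stay (write_tape (read_tape (ts i)) (ts i))))].
    move=> r' hr'; rewrite ffunE reg_tapeI // /upd; case: eqVneq => [->|_].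
      by apply: stores_push; apply: h.
    by do 2!apply: stores_stay; apply: h.
  exists t.+2; first by rewrite doubleS.
  rewrite !iterSr /step /next_action /= e /= e /=.
  set c := Config _ _; set c' := Config _ _ in ht; suff -> : c = c' by [].
  rewrite /c /c'; congr (@Config sim_machine); apply/ffunP => i.
  by rewrite !ffunE; case: eqVneq.
- move=> q s r q' qb n s' e s0 _ IH ts h.
  have hr : r < k.+2 by have := reg_lt q; rewrite e.
  have [t tn ht] := IH _ (stay _ _ h).
  exists t.+1; first by rewrite doubleS ltnW.
  rewrite iterSr {2}/step /next_action /= e ffunE (stores_read (h _ hr)) s0 /=.
  by apply: ht.
- move=> q s r q' qb b w n s' e sr _ IH ts h.
  have hr : r < k.+2 by have := reg_lt q; rewrite e.
  set ts' : {ffun 'I_k.+2 -> tape} := [ffun i => if i == reg_tape r then move_tape MoveRight (write_tape None (ts i))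
      else move_tape Stay (write_tape (read_tape (ts i)) (ts i))].
  have [|t tn ht] := IH ts'.
    move=> r' hr'; rewrite ffunE reg_tapeI // /upd; case: eqVneq => [->|_].
      by apply: (@stores_pop _ b); rewrite -sr; apply: h.
    by apply: stores_stay; apply: h.
  exists t.+1; first by rewrite doubleS ltnW.
  rewrite iterSr {2}/step /next_action /= e ffunE (stores_read (h _ hr)) sr /=.
  set c := Config _ _; suff -> : c = @Config sim_machine (inl (qb b)) ts' by [].
  congr (@Config sim_machine); apply/ffunP => i.
  by rewrite !ffunE; case: eqVneq.
- move=> q s q' n s' e hO _ IH ts h.
  set ts' : {ffun 'I_k.+2 -> tape} := [ffun i => if i == ord_max
    then tape_of_word (answer O (word_of_tape (ts ord_max))) else ts i].
  have [|t tn ht] := IH ts'.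
    move=> r' hr'; rewrite ffunE -(_ : reg_tape 1 = ord_max) // reg_tapeI //.
    rewrite /upd; case: eqVneq => [_|_]; last exact: h.
    by rewrite (stores_word (h 1 isT)); apply: stores_tape_of_word.
  exists t.+1; first by rewrite doubleS ltnW.
  by rewrite iterSr {2}/step /next_action /= e hO.
Qed.

Lemma sim_computes x s' n N :
  runs O P (fun r => if r == 0 then x else [::]) n s' -> n.*2 <= N ->
  computes_within sim_machine (answer O) x (s' 0) N.
Proof.
move=> /sim_exec H nN.
have [|t tn [hc hs]] := H [ffun i => tape_of_word (if i == ord0 then x else [::])].
  move=> r hr; rewrite ffunE -(_ : reg_tape 0 = ord0) // reg_tapeI //.
  exact: stores_tape_of_word.
rewrite /computes_within -(subnK (leq_trans tn nN)) iterD halted_iter //; split=> //.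
exact: stores_word (hs 0 _).
Qed.

End Simulation.

(** * Program combinators *)

Section Combinators.

Variable O : oracle.

Notation runs := (runs O).

Definition skipp : prog := @Prog unit tt (fun=> Done).

Definition pushp r b : prog :=
  @Prog bool true (fun q => if q then Push r b false else Done).

Definition queryp : prog :=
  @Prog bool true (fun q => if q then Query false else Done).

Definition seqp (P1 P2 : prog) : prog :=
  @Prog (pstate P1 + pstate P2)%type
    (inl (pstart P1))
    (fun q => match q with
      | inl q => if pcode q is Done then map_instr inr (pcode (pstart P2))
                 else map_instr inl (pcode q)
      | inr q => map_instr inr (pcode q)
      end).

(* [casep] branches on the top of [r] and pops it; in [loopp] the branches
   return to the test until [r] is empty. *)
Definition casep r (P P0 P1 : prog) : prog :=
  @Prog (option (pstate P + (pstate P0 + pstate P1))%type)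
    None
    (fun q => match q with
      | None => Pop r (Some (inl (pstart P)))
          (fun b => if b then Some (inr (inr (pstart P1)))
                    else Some (inr (inl (pstart P0))))
      | Some (inl q) => map_instr (fun q => Some (inl q)) (pcode q)
      | Some (inr (inl q)) => map_instr (fun q => Some (inr (inl q))) (pcode q)
      | Some (inr (inr q)) => map_instr (fun q => Some (inr (inr q))) (pcode q)
      end).

Definition loopp r (P0 P1 : prog) : prog :=
  let head := Pop r (inl false)
          (fun b => if b then inr (inr (pstart P1)) else inr (inl (pstart P0))) in
  @Prog (bool + (pstate P0 + pstate P1))%type
    (inl true)
    (fun q => match q with
      | inl true => head
      | inl false => Done
      | inr (inl q) => if pcode q is Done then head
                       else map_instr (fun q => inr (inl q)) (pcode q)
      | inr (inr q) => if pcode q is Done then head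
                       else map_instr (fun q => inr (inr q)) (pcode q)
      end).

(** Only the instruction at a state matters for what follows. Hence a combinator may put the first
    instruction of the continuation in place of a final [Done], at no cost in steps. *)
Lemma exec_code P q q' s n s' :
  pcode q = pcode q' -> exec O P q s n s' -> exec O P q' s n s'.
Proof.
move=> e H; case: q s n s' / H e.
- by move=> q s e e'; apply: ExecDone; rewrite -e' e.
- by move=> q s r b q1 n s' e H e'; apply: (ExecPush _ H); rewrite -e' e.
- by move=> q s r q1 qb n s' e s0 H e'; apply: (ExecPop0 _ s0 H); rewrite -e' e.
- by move=> q s r q1 qb b w n s' e s0 H e'; apply: (ExecPop _ s0 H); rewrite -e' e.
- by move=> q s q1 n s' e ok H e'; apply: (ExecQuery _ ok H); rewrite -e' e.
Qed.

(* The last hypothesis says what the host does where the guest stops. *)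
Lemma exec_embed (P P' : prog) (h : pstate P -> pstate P') q s n s' m s'' :
  (forall q, pcode q <> Done -> pcode (h q) = map_instr h (pcode q)) ->
  exec O P q s n s' ->
  (forall q, pcode q = Done -> exec O P' (h q) s' m s'') ->
  exec O P' (h q) s (n + m) s''.
Proof.
move=> hc; elim=> {q s n s'}.
- by move=> q s e; apply.
- move=> q s r b q' n s' e _ IH /IH H; apply: (ExecPush _ H).
  by rewrite hc e.
- move=> q s r q' qb n s' e s0 _ IH /IH H; apply: (ExecPop0 _ s0 H).
  by rewrite hc e.
- move=> q s r q' qb b w n s' e s0 _ IH /IH H; apply: (ExecPop _ s0 H).
  by rewrite hc e.
- move=> q s q' n s' e ok _ IH /IH H; apply: (ExecQuery _ ok H).
  by rewrite hc e.
Qed.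

Lemma runs_skip s : runs skipp s 0 s.
Proof. exact: ExecDone. Qed.

Lemma runs_push r b s : runs (pushp r b) s 1 (upd s r (b :: s r)).
Proof. by apply: (@ExecPush _ (pushp r b) true _ r b false) => //; apply: ExecDone. Qed.

Lemma runs_query s : allowed O -> runs queryp s 1 (upd s 1 (answer O (s 1))).
Proof. by move=> ok; apply: (@ExecQuery _ queryp true _ false) => //; apply: ExecDone. Qed.

Lemma runs_seq P1 P2 s n1 s1 n2 s2 :
  runs P1 s n1 s1 -> runs P2 s1 n2 s2 -> runs (seqp P1 P2) s (n1 + n2) s2.
Proof.
move=> H1 H2; apply: (@exec_embed P1 (seqp P1 P2) inl _ _ _ _ _ _ _ H1).
  by move=> q /=; case: (pcode q).
move=> q e; apply: (@exec_code (seqp P1 P2) (inr (pstart P2))); first by rewrite /= e.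
rewrite -[n2]addn0; apply: (@exec_embed P2 (seqp P1 P2) inr _ _ _ _ _ _ _ H2) => // q' e'.
by apply: ExecDone; rewrite /= e'.
Qed.

Lemma runs_case0 r P P0 P1 s n s' : s r = [::] ->
  runs P s n s' -> runs (casep r P P0 P1) s n.+1 s'.
Proof.
move=> s0 H; apply: (@ExecPop0 _ (casep r P P0 P1) None _ _ _ _ _ _ erefl s0).
rewrite -[n]addn0; apply: (@exec_embed P (casep r P P0 P1) (fun q => Some (inl q)) _ _ _ _ _ _ _ H) => // q' e'.
by apply: ExecDone; rewrite /= e'.
Qed.

Lemma runs_case r P P0 P1 s b w n s' : s r = b :: w ->
  runs (if b then P1 else P0) (upd s r w) n s' ->
  runs (casep r P P0 P1) s n.+1 s'.
Proof.
move=> s0 H; apply: (@ExecPop _ (casep r P P0 P1) None _ _ _ _ _ _ _ _ erefl s0).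
case: b H {s0} => H; rewrite -[n]addn0.
  apply: (@exec_embed P1 (casep r P P0 P1) (fun q => Some (inr (inr q))) _ _ _ _ _ _ _ H) => // q' e'.
  by apply: ExecDone; rewrite /= e'.
apply: (@exec_embed P0 (casep r P P0 P1) (fun q => Some (inr (inl q))) _ _ _ _ _ _ _ H) => // q' e'.
by apply: ExecDone; rewrite /= e'.
Qed.

Lemma runs_loop0 r P0 P1 s : s r = [::] -> runs (loopp r P0 P1) s 1 s.
Proof.
by move=> s0; apply: (@ExecPop0 _ (loopp r P0 P1) (inl true) _ _ _ _ _ _ erefl s0); apply: ExecDone.
Qed.

Lemma runs_loop r P0 P1 s b w n s1 n' s2 : s r = b :: w ->
  runs (if b then P1 else P0) (upd s r w) n s1 ->
  runs (loopp r P0 P1) s1 n' s2 ->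
  runs (loopp r P0 P1) s (n + n').+1 s2.
Proof.
move=> s0 H H2; apply: (@ExecPop _ (loopp r P0 P1) (inl true) _ _ _ _ _ _ _ _ erefl s0).
case: b H {s0} => H.
  apply: (@exec_embed P1 (loopp r P0 P1) (fun q => inr (inr q)) _ _ _ _ _ _ _ H) => [q /=|q e].
    by case: (pcode q).
  by apply: exec_code H2; rewrite /= e.
apply: (@exec_embed P0 (loopp r P0 P1) (fun q => inr (inl q)) _ _ _ _ _ _ _ H) => [q /=|q e].
  by case: (pcode q).
by apply: exec_code H2; rewrite /= e.
Qed.

End Combinators.

(** * Register frames *)

(** The stack discipline for registers: those below [o] are kept, and all those past the list are
    empty. A subprogram can thus take [o + size L] as its own base and find clean scratch space
    there. *)
Definition lay (o : nat) (s : regs) (L : seq word) : regs :=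
  fun r => if r < o then s r else @nth word [::] L (r - o).

Lemma lay_below o s L r : r < o -> lay o s L r = s r.
Proof. by rewrite /lay => ->. Qed.

Lemma lay_at o s L i : lay o s L (o + i) = @nth word [::] L i.
Proof. by rewrite /lay ltnNge leq_addr addKn. Qed.

Lemma lay_cat o s L L' : lay (o + size L) (lay o s L) L' = lay o s (L ++ L').
Proof.
apply: functional_extensionality => r; rewrite /lay nth_cat.
case: (ltnP r (o + size L)) => h; case: (ltnP r o) => h' //; try lia.
  by rewrite ifT //; lia.
by rewrite ifF ?subnDA //; lia.
Qed.

Lemma lay_cat0 o s L : lay (o + size L) (lay o s L) [::] = lay o s L.
Proof. by rewrite lay_cat cats0. Qed.

Ltac ifs :=
  repeat match goal with
  | |- context [if ?b then _ else _] => case: (boolP b) => ? /=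
  end; try done; try lia; try (congr (_ _); lia).

Section Macros.

Variable O : oracle.

Definition runsb (P : prog) s n s' := exists2 n', n' <= n & runs O P s n' s'.

Lemma runsb_weak P s n n' s' : n <= n' -> runsb P s n s' -> runsb P s n' s'.
Proof. by move=> h [m mn H]; exists m => //; apply: leq_trans h. Qed.

Lemma runsb_seq P1 P2 s n1 s1 n2 s2 :
  runsb P1 s n1 s1 -> runsb P2 s1 n2 s2 -> runsb (seqp P1 P2) s (n1 + n2) s2.
Proof.
by move=> [m mn H] [m' mn' H']; exists (m + m'); [lia | apply: runs_seq H H'].
Qed.

Lemma runs_eq P s n s1 s2 : s1 =1 s2 -> runs O P s n s1 -> runs O P s n s2.
Proof. by move=> /functional_extensionality ->. Qed.

Lemma runsb_eq P s n s1 s2 : s1 =1 s2 -> runsb P s n s1 -> runsb P s n s2.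
Proof. by move=> /functional_extensionality ->. Qed.

Definition revp a b := loopp a (pushp b false) (pushp b true).

Lemma runs_rev a b s : a != b ->
  runsb (revp a b) s (2 * size (s a)).+1
    (upd (upd s b (rev (s a) ++ s b)) a [::]).
Proof.
move=> ab; move e: (s a) => w; elim: w s e => [|c w IH] s e /=.
  exists 1 => //; have -> : upd (upd s b (s b)) a [::] = s.
    apply: functional_extensionality => r; rewrite /upd.
    by case: (eqVneq r a) => [-> //|_]; case: (eqVneq r b) => [->|].
  exact: runs_loop0.
have [|n hn H] := IH (upd (upd s a w) b (c :: s b)).
  by rewrite upd_neq // updE.
exists (1 + n).+1; first by lia.
apply: (runs_loop e (s1 := upd (upd s a w) b (c :: s b))).
  have := runs_push O b c (upd s a w); rewrite upd_neq 1?eq_sym //.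
  by case: (c).
apply: runs_eq H => r; rewrite rev_cons -cats1 -catA /= /upd eqxx.
by case: (eqVneq r a) => // _; case: (eqVneq r b).
Qed.

Definition clearp a := loopp a skipp skipp.

Lemma runs_clear a s : runsb (clearp a) s (size (s a)).+1 (upd s a [::]).
Proof.
move e: (s a) => w; elim: w s e => [|c w IH] s e /=.
  exists 1 => //; have -> : upd s a [::] = s.
    by apply: functional_extensionality => r; rewrite /upd; case: (eqVneq r a) => [->|].
  exact: runs_loop0.
have [|n hn H] := IH (upd s a w); first by rewrite updE.
exists (0 + n).+1; first by lia.
apply: (runs_loop e (s1 := upd s a w)).
  by case: (c); apply: runs_skip.
by apply: runs_eq H => r; rewrite /upd; ifs.
Qed.

Fixpoint clearsp a n :=
  if n is n'.+1 then seqp (clearp a) (clearsp a.+1 n') else skipp.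

Lemma runs_clears a n s :
  runsb (clearsp a n) s (\sum_(i < n) (size (s (a + i))).+1)
    (fun r => if a <= r < a + n then [::] else s r).
Proof.
elim: n a s => [|n IH] a s /=.
  exists 0 => //; apply: runs_eq (runs_skip O s) => r.
  by case: ifP => //; lia.
rewrite big_ord_recl addn0; apply: runsb_seq; first exact: runs_clear.
have := IH a.+1 (upd s a [::]).
set t := \sum_(_ < _) _; set t' := \sum_(_ < _) _; have -> : t = t'.
  by apply: eq_bigr => i _; rewrite upd_neq ?addSnnS //; lia.
by apply: runsb_eq => r; rewrite /upd; ifs.
Qed.

(* The block [src, src + n) moves down to [dst, dst + n); each word is reversed
   twice, through the scratch register [z]. *)
Fixpoint movesp src dst z n :=
  if n is n'.+1
  then seqp (seqp (revp src z) (seqp (clearp dst) (revp z dst)))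
            (movesp src.+1 dst.+1 z n')
  else skipp.

Lemma runs_moves src dst z n s : dst <= src -> src + n <= z -> s z = [::] ->
  runsb (movesp src dst z n) s
    (\sum_(i < n) (4 * size (s (src + i)) + size (s (dst + i)) + 3))
    (fun r => if dst <= r < dst + n then s (src + (r - dst))
              else if src <= r < src + n then [::] else s r).
Proof.
elim: n src dst s => [|n IH] src dst s ds sz z0 /=.
  exists 0 => //; apply: runs_eq (runs_skip O s) => r.
  by ifs.
set s1 := upd (upd s z (rev (s src))) src [::].
have H1 : runsb (revp src z) s (2 * size (s src)).+1 s1.
  by have := @runs_rev src z s; rewrite z0 cats0; apply; lia.
set s2 := upd s1 dst [::].
have H2 : runsb (clearp dst) s1 (size (s dst)).+1 s2.
  apply: runsb_weak (runs_clear _ _); rewrite /s1 /upd.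
  by ifs.
set s3 := upd (upd s2 z [::]) dst (s src).
have H3 : runsb (revp z dst) s2 (2 * size (s src)).+1 s3.
  have := @runs_rev z dst s2.
  have -> : s2 z = rev (s src).
    by rewrite /s2 /s1 /upd; ifs.
  have -> : s2 dst = [::] by rewrite /s2 updE.
  rewrite revK cats0 size_rev => H; apply: runsb_eq (H _); last by lia.
  by move=> r; rewrite /s3 /upd; ifs.
have [|||t ht H4] := IH src.+1 dst.+1 s3; try lia.
  by rewrite /s3 /upd; ifs.
rewrite big_ord_recl !addn0.
apply: (@runsb_weak _ _ ((2 * size (s src)).+1 + ((size (s dst)).+1 + (2 * size (s src)).+1) + t)).
  have : t <= \sum_(i < n) (4 * size (s (src + bump 0 i)) + size (s (dst + bump 0 i)) + 3).
    apply: leq_trans ht _; apply: leq_sum => i _.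
    have -> : s3 (src.+1 + i) = s (src + bump 0 i).
      by have := ltn_ord i; rewrite /bump /s3 /s2 /s1 /upd => ?; ifs.
    rewrite leq_add2r leq_add2l /s3 /s2 /s1 /upd addSnnS.
    by have := ltn_ord i => ?; ifs.
  by rewrite /= => h; lia.
apply: runsb_seq; first by apply: runsb_seq H1 _; apply: runsb_seq H2 H3.
exists t => //; apply: runs_eq H4 => r; rewrite /s3 /s2 /s1 /upd.
by ifs; rewrite -z0; congr (s _); lia.
Qed.

(** Garbage collection: [k] intermediate words are erased and the [n] results above them slide down
    to the base of the frame. *)
Definition collapsep o k n := seqp (clearsp o k) (movesp (o + k) o (o + k + n) n).

Lemma runs_collapse o s J L :
  runsb (collapsep o (size J) (size L)) (lay o s (J ++ L))
    (\sum_(w <- J) (size w).+1 +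
     size L * (5 * (\sum_(w <- L) size w) + 3)) (lay o s L).
Proof.
pose s1 : regs := fun r => if o <= r < o + size J then [::] else lay o s (J ++ L) r.
apply: (@runsb_seq _ _ _ _ s1).
  apply: runsb_weak (runs_clears _ _ _).
  rewrite (big_nth [::]) big_mkord leq_sum // => i _.
  by rewrite lay_at nth_cat ltn_ord.
have s1L i : i < size L -> s1 (o + size J + i) = @nth word [::] L i.
  move=> hi; rewrite /s1 ifF; last by lia.
  by rewrite -addnA lay_at nth_cat ifF ?addKn //; lia.
have leL i : size (@nth word [::] L i) <= \sum_(w <- L) size w.
  case: (ltnP i (size L)) => hi; last by rewrite nth_default.
  by rewrite (big_nth [::]) big_mkord (bigD1 (Ordinal hi)) //= leq_addr.
have := @runs_moves (o + size J) o (o + size J + size L) (size L) s1.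
case=> //.
- by lia.
- rewrite /s1 ifF; last by lia.
  by rewrite -addnA lay_at nth_default // size_cat.
move=> n hn H; exists n; last first.
  apply: runs_eq H => r; rewrite /lay.
  case: ifP => h; first by rewrite ifF ?s1L //; lia.
  case: (ltnP r o) => h1.
    by rewrite ifF; [rewrite /s1 ifF ?lay_below //; lia | lia].
  rewrite [RHS]nth_default; last by lia.
  case: ifP => // h2; rewrite /s1; case: ifP => // h3.
  by rewrite /lay ifF ?nth_default // ?size_cat; lia.
apply: leq_trans hn _.
apply: (@leq_trans (\sum_(i < size L) (5 * \sum_(w <- L) size w + 3))); last first.
  by rewrite sum_nat_const card_ord.
apply: leq_sum => i _; rewrite s1L //.
have : size (s1 (o + i)) <= \sum_(w <- L) size w.
  rewrite /s1; case: ifP => // h.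
  by rewrite lay_at nth_cat ifF ?leL //; lia.
by have := leL i; lia.
Qed.

(** Reading a stack destroys it, so the word is first poured into a scratch register and then poured
    back onto the source and the target together; the two reversals cancel. *)
Definition copyp a o :=
  seqp (revp a o.+1)
    (loopp o.+1 (seqp (pushp a false) (pushp o false))
                (seqp (pushp a true) (pushp o true))).

Lemma runs_copy a o s : a < o ->
  runsb (copyp a o) (lay o s [::]) (5 * size (s a) + 2) (lay o s [:: s a]).
Proof.
move=> ao; pose st w v u := upd (lay o s [:: v; u]) a w.
have -> : lay o s [::] = st (s a) [::] [::].
  apply: functional_extensionality => r; rewrite /st /lay /upd.
  case: eqVneq => [->|_]; first by rewrite ao.
  by case: ifP => // _; case: (r - o) => [|[|[]]].
have -> : lay o s [:: s a] = st (s a) (s a) [::].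
  apply: functional_extensionality => r; rewrite /st /lay /upd.
  case: eqVneq => [->|_]; first by rewrite ao.
  by case: ifP => // _; case: (r - o) => [|[|[]]].
have -> : 5 * size (s a) + 2 = (2 * size (s a)).+1 + (3 * size (s a)).+1 by lia.
apply: (@runsb_seq _ _ _ _ (st [::] [::] (rev (s a)))).
  have := @runs_rev a o.+1 (st (s a) [::] [::]).
  have -> : st (s a) [::] [::] o.+1 = [::].
    by rewrite /st /lay /upd; ifs; rewrite subSn ?subnn.
  rewrite cats0 {1 2}/st !updE => H; apply: runsb_eq (H _); last by lia.
  by move=> r; rewrite /st /lay /upd; case e : (r - o) => [|[|[|k]]] /=; ifs.
suff H w v : runsb (loopp o.+1 (seqp (pushp a false) (pushp o false))
    (seqp (pushp a true) (pushp o true))) (st v v w) (3 * size w).+1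
    (st (rev w ++ v) (rev w ++ v) [::]).
  by have := H (rev (s a)) [::]; rewrite size_rev revK cats0.
elim: w v => [|b w IH] v /=.
  exists 1 => //; apply: runs_loop0.
  by rewrite /st /lay /upd; ifs; rewrite subSn ?subnn.
have [n hn H] := IH (b :: v).
exists (2 + n).+1; first by lia.
apply: (@runs_loop _ _ _ _ _ b w _ (st (b :: v) (b :: v) w)).
- by rewrite /st /lay /upd; ifs; rewrite subSn ?subnn.
- have -> : upd (st v v (b :: w)) o.+1 w = st v v w.
    apply: functional_extensionality => r.
    by rewrite /st /lay /upd; case e : (r - o) => [|[|[|k]]] /=; ifs.
  have H0 c : runs O (seqp (pushp a c) (pushp o c)) (st v v w) (1 + 1)
      (st (c :: v) (c :: v) w).
    apply: runs_eq (runs_seq (runs_push _ _ _ _) (runs_push _ _ _ _)) => r.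
    rewrite /st /lay /upd subnn.
    by case e : (r - o) => [|[|[|k]]] /=; ifs.
  by case: (b).
- by rewrite rev_cons cat_rcons; apply: H.
Qed.

End Macros.

(** * Polynomial-time functions between coded types *)

(** The number of words depends on the type only, never on the value, so registers can be allocated
    statically. *)
Structure code := Code {
  carrier :> Type;
  width : nat;
  enc : carrier -> seq word;
  size_enc : forall x, size (enc x) = width
}.

Definition sz (A : code) (a : A) : nat := \sum_(w <- enc a) size w.

(** The base is at least 2 even for empty data, so constants and sums are absorbed by raising the
    exponent. *)
Definition pb (A : code) (T : A -> nat) : Prop :=
  exists d, forall a, T a <= (sz a).+2 ^ d.

Section PolynomialBounds.

Variable A : code.
Implicit Types T : A -> nat.

Lemma pb_le T T' : (forall a, T a <= T' a) -> pb T' -> pb T.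
Proof. by move=> h [d hd]; exists d => a; apply: leq_trans (h a) (hd a). Qed.

Lemma pb_const c : pb (fun _ : A => c).
Proof.
exists c => a; apply: leq_trans (ltnW (ltn_expl c (isT : 1 < 2))) _.
by case: c => // c; rewrite leq_exp2r.
Qed.

Lemma pb_sz : pb (fun a : A => sz a).
Proof. by exists 1 => a; rewrite expn1 ltnW. Qed.

Lemma pb_add T T' : pb T -> pb T' -> pb (fun a => T a + T' a).
Proof.
move=> [d hd] [e he]; exists (d + e).+1 => a; rewrite expnS.
apply: (@leq_trans (2 * (sz a).+2 ^ (d + e))); last by rewrite leq_mul2r orbT.
rewrite mul2n -addnn leq_add //.
  by apply: leq_trans (hd a) _; rewrite leq_exp2l // leq_addr.
by apply: leq_trans (he a) _; rewrite leq_exp2l // leq_addl.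
Qed.

Lemma pb_mul T T' : pb T -> pb T' -> pb (fun a => T a * T' a).
Proof.
by move=> [d hd] [e he]; exists (d + e) => a; rewrite expnD leq_mul.
Qed.

Lemma pb_expc T k : pb T -> pb (fun a => T a ^ k).
Proof.
by move=> [d hd]; exists (d * k) => a; rewrite expnM; case: k => // k; rewrite leq_exp2r.
Qed.

Lemma pb_sum n (T : nat -> A -> nat) :
  (forall i, i < n -> pb (T i)) -> pb (fun a => \sum_(i < n) T i a).
Proof.
elim: n => [|n IH] h; first by exists 0 => a; rewrite big_ord0.
apply: (@pb_le _ (fun a => \sum_(i < n) T i a + T n a)).
  by move=> a; rewrite big_ord_recr.
by apply: pb_add; [apply: IH => i hi; apply: h; apply: ltnW | apply: h].
Qed.

Lemma pb_comp (B : code) (g : A -> B) (T : B -> nat) :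
  pb (fun a => sz (g a)) -> pb T -> pb (fun a => T (g a)).
Proof.
move=> pg [d hd]; apply: (@pb_le _ (fun a => (sz (g a) + 2) ^ d)).
  by move=> a; rewrite addn2.
by apply: pb_expc; apply: pb_add => //; apply: pb_const.
Qed.

End PolynomialBounds.

Canonical code_word :=
  @Code (seq bool) 1 (fun w => [:: w]) (fun=> erefl).

Canonical code_bool :=
  @Code bool 1 (fun b => [:: [:: b]]) (fun=> erefl).

(** Numbers of this type are unary: they serve as lengths, indices and loop counters, and a
    computable one is automatically polynomially bounded ([fp_pb]). *)
Canonical code_nat :=
  @Code nat 1 (fun n => [:: nseq n true]) (fun=> erefl).

Fact size_enc_pair (A B : code) (x : A * B) :
  size (enc x.1 ++ enc x.2) = width A + width B.
Proof. by rewrite size_cat !size_enc. Qed.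

Canonical code_prod (A B : code) := Code (@size_enc_pair A B).

Lemma sz_pair (A B : code) (x : A * B) :
  sz x = sz x.1 + sz x.2.
Proof. by rewrite /sz big_cat. Qed.

Lemma sz_word (w : word) : sz w = size w.
Proof. by rewrite /sz big_seq1. Qed.

Lemma sz_nat (n : nat) : sz n = n.
Proof. by rewrite /sz big_seq1 size_nseq. Qed.

Lemma sz_bool (b : bool) : sz b = 1.
Proof. by rewrite /sz big_seq1. Qed.

Section Closure.

Variable O : oracle.

Notation runsb := (runsb O).

(** The location map [rho] is arbitrary, so pieces of several values, scattered over the frame, can
    serve as one argument without being moved. *)
Definition reads (A : code) (rho : nat -> nat) (s : regs) (a : A) :=
  forall i, i < width A -> s (rho i) = nth [::] (enc a) i.

(* [P] leaves [f a] in register [o], using the registers from [o] on as scratch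
   space. *)
Definition fp1 (A : code) (f : A -> word) : Prop :=
  exists T : A -> nat, [/\ pb T, forall a, size (f a) <= T a &
  forall rho o, 1 < o -> (forall i, i < width A -> rho i < o) ->
  exists P, forall a s, s 1 = [::] -> reads rho s a ->
    runsb P (lay o s [::]) (T a) (lay o s [:: f a])].

Definition component (A : Type) (B : code) (f : A -> B) (i : nat) : A -> word :=
  fun a => nth [::] (enc (f a)) i.

(** Working one output word at a time makes pairing and projection immediate; [fp_tuple] recovers
    the whole output by running the programs one after the other. *)
Definition fp (A B : code) (f : A -> B) : Prop :=
  forall i, i < width B -> fp1 (component f i).

Section Tuple.

Variables (A B : code) (f : A -> B).
Hypothesis fpf : fp f.

Lemma fp_sz : pb (fun a => sz (f a)).
Proof.
apply: (@pb_le _ _ (fun a => \sum_(i < width B) size (component f i a))).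
  by move=> a; rewrite /sz (big_nth [::]) big_mkord size_enc.
apply: (@pb_sum _ _ (fun i a => size (component f i a))) => i /fpf [T [pT hT _]].
exact: pb_le pT.
Qed.

Lemma fp_tuple : exists2 T : A -> nat, pb T &
  forall rho o, 1 < o -> (forall i, i < width A -> rho i < o) ->
  exists P, forall a s, s 1 = [::] -> reads rho s a ->
    runsb P (lay o s [::]) (T a) (lay o s (enc (f a))).
Proof.
have H k : k <= width B -> exists2 T : A -> nat, pb T &
    forall rho o, 1 < o -> (forall i, i < width A -> rho i < o) ->
    exists P, forall a s, s 1 = [::] -> reads rho s a ->
    runsb P (lay o s [::]) (T a) (lay o s (take k (enc (f a)))).
  elim: k => [_|k IH hk].
    exists (fun=> 0); first exact: pb_const.
    move=> rho o o1 hrho; exists skipp => a s _ _.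
    by rewrite take0; exists 0 => //; apply: runs_skip.
  have [T pT H] := IH (ltnW hk); have [T' [pT' _ H']] := fpf hk.
  exists (fun a => T a + T' a); first exact: pb_add.
  move=> rho o o1 hrho; have [P HP] := H rho o o1 hrho.
  have [||P' HP'] := H' rho (o + k); first by lia.
    by move=> i /hrho; lia.
  exists (seqp P P') => a s s1 hs; apply: runsb_seq (HP a s s1 hs) _.
  have szk : size (take k (enc (f a))) = k by rewrite size_takel // size_enc ltnW.
  have := HP' a (lay o s (take k (enc (f a)))).
  have e0 := lay_cat0 o s (take k (enc (f a))).
  have e1 := lay_cat o s (take k (enc (f a))) [:: component f k a].
  rewrite szk in e0 e1; rewrite e0 e1 cats1 -take_nth ?size_enc //; apply.
    by rewrite lay_below.
  by move=> i hi; rewrite lay_below ?hs ?hrho.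
have [T pT H'] := H _ (leqnn _); exists T => // rho o o1 hrho.
have [P HP] := H' rho o o1 hrho; exists P => a s s1 hs.
by have := HP a s s1 hs; rewrite -(size_enc (f a)) take_size.
Qed.

End Tuple.

Lemma lay_nil o s : lay o s [:: [::]] = lay o s [::].
Proof.
apply: functional_extensionality => r; rewrite /lay; case: ifP => // _.
by case: (r - o) => //= n; rewrite nth_nil.
Qed.

Lemma fp1_ext (A : code) (f g : A -> word) : f =1 g -> fp1 f -> fp1 g.
Proof. by move=> /functional_extensionality ->. Qed.

Lemma fp_ext (A B : code) (f g : A -> B) :
  f =1 g -> fp f -> fp g.
Proof. by move=> /functional_extensionality ->. Qed.

Section Basic.

Variable A : code.

Lemma fp1_proj i : i < width A -> fp1 (fun a : A => nth [::] (enc a) i).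
Proof.
move=> hi; exists (fun a => 5 * sz a + 2); split.
- by do ?[apply: pb_add | apply: pb_mul | apply: pb_const | apply: pb_sz].
- move=> a; apply: (@leq_trans (sz a)); last by lia.
  rewrite -(size_enc a) in hi.
  by rewrite /sz (big_nth [::]) big_mkord (bigD1 (Ordinal hi)) //= leq_addr.
move=> rho o o1 hrho; exists (copyp (rho i) o) => a s s1 hs.
have [n hn H] := @runs_copy O (rho i) o s (hrho i hi).
exists n; last by rewrite -hs.
apply: leq_trans hn _; rewrite hs // leq_add2r leq_mul2l /=.
rewrite -(size_enc a) in hi.
by rewrite /sz (big_nth [::]) big_mkord (bigD1 (Ordinal hi)) //= leq_addr.
Qed.

Lemma fp1_nil : fp1 (fun _ : A => [::]).
Proof.
exists (fun=> 0); split=> // [|rho o _ _]; first exact: pb_const.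
by exists skipp => a s _ _; rewrite lay_nil; exists 0 => //; apply: runs_skip.
Qed.

Lemma fp1_cons b (f : A -> word) : fp1 f -> fp1 (fun a => b :: f a).
Proof.
move=> [T [pT sT H]]; exists (fun a => T a + 1); split.
- by apply: pb_add => //; apply: pb_const.
- by move=> a /=; rewrite addn1 ltnS.
move=> rho o o1 hrho; have [P HP] := H rho o o1 hrho.
exists (seqp P (pushp o b)) => a s s1 hs; apply: runsb_seq (HP a s s1 hs) _.
exists 1 => //; apply: runs_eq (runs_push _ _ _ _) => r.
by rewrite /lay /upd ltnn subnn; case e : (r - o) => [|[|k]] /=; ifs.
Qed.

Lemma fp1_behead (f : A -> word) : fp1 f -> fp1 (fun a => behead (f a)).
Proof.
move=> [T [pT sT H]]; exists (fun a => T a + 1); split.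
- by apply: pb_add => //; apply: pb_const.
- by move=> a /=; rewrite size_behead; have := sT a; lia.
move=> rho o o1 hrho; have [P HP] := H rho o o1 hrho.
exists (seqp P (casep o skipp skipp skipp)) => a s s1 hs.
apply: runsb_seq (HP a s s1 hs) _; exists 1 => //.
have := lay_at o s [:: f a] 0; rewrite addn0 /=.
case: (f a) => [|b w] e /=.
  by apply: runs_case0 => //; rewrite lay_nil; apply: runs_skip.
apply: (@runs_case _ _ _ _ _ _ b w _ _ e); case: (b); apply: runs_eq (runs_skip _ _) => r.
  all: by rewrite /lay /upd; case e' : (r - o) => [|[|k]] /=; ifs.
Qed.

Lemma fp1_case (c f f0 f1 : A -> word) :
  fp1 c -> fp1 f -> fp1 f0 -> fp1 f1 ->
  fp1 (fun a => match c a with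
                | [::] => f a | b :: _ => if b then f1 a else f0 a end).
Proof.
move=> [Tc [pTc sTc Hc]] [T [pT sT H]] [T0 [pT0 sT0 H0]] [T1 [pT1 sT1 H1]].
exists (fun a => Tc a + (Tc a + T a + T0 a + T1 a + 2)); split.
- by do ?[apply: pb_add | apply: pb_const].
- move=> a; case: (c a) => [|[] _]; [have := sT a|have := sT1 a|have := sT0 a]; lia.
move=> rho o o1 hrho.
have [Pc HPc] := Hc rho o o1 hrho; have [P HP] := H rho o o1 hrho.
have [P0 HP0] := H0 rho o o1 hrho; have [P1 HP1] := H1 rho o o1 hrho.
exists (seqp Pc (casep o P (seqp (clearp o) P0) (seqp (clearp o) P1))) => a s s1 hs.
apply: runsb_seq (HPc a s s1 hs) _.
have := sTc a; have := lay_at o s [:: c a] 0; rewrite addn0 /=.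
case: (c a) => [|b w] e sc /=.
  have [n hn HR] := HP a s s1 hs; exists n.+1; first by lia.
  by apply: runs_case0 => //; rewrite lay_nil.
set R := lay o s [:: b :: w].
have clr : runsb (clearp o) (upd R o w) (size w).+1 (lay o s [::]).
  have := runs_clear O o (upd R o w); rewrite updE; apply: runsb_eq => r.
  by rewrite /R /lay /upd; case e' : (r - o) => [|[|k]] /=; ifs.
rewrite /= in sc.
have [n hn HR] : runsb (if b then seqp (clearp o) P1 else seqp (clearp o) P0) (upd R o w)
    ((size w).+1 + (T0 a + T1 a)) (lay o s [:: if b then f1 a else f0 a]).
  case: (b); apply: runsb_seq clr _.
    by apply: runsb_weak (HP1 a s s1 hs); lia.
  by apply: runsb_weak (HP0 a s s1 hs); lia.
by exists n.+1; [lia | apply: runs_case e HR].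
Qed.

Lemma runs_rev_to a b s s' : a != b -> s' a = [::] ->
  s' b = catrev (s a) (s b) ->
  (forall r, r != a -> r != b -> s' r = s r) ->
  runsb (revp a b) s (2 * size (s a)).+1 s'.
Proof.
move=> ab ea eb er; apply: runsb_eq (runs_rev O s ab) => r; rewrite /upd.
case: eqVneq => [->|ra]; first by rewrite ea.
by case: eqVneq => [->|rb]; rewrite ?eb ?catrevE ?er.
Qed.

(** Queries go through register 1, which all programs expect to be empty. The question is carried
    there and the answer carried back, each by a double reversal, which leaves register 1 empty
    again. *)
Lemma fp1_query (f : A -> word) c : allowed O ->
  (forall q, size (answer O q) <= size q + c) -> fp1 f ->
  fp1 (fun a => answer O (f a)).
Proof.
move=> ok hO [T [pT sT H]]; exists (fun a => T a + (10 * T a + 5 * c + 10)); split.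
- by do ?[apply: pb_add | apply: pb_mul | apply: pb_const].
- by move=> a; have := hO (f a); have := sT a; lia.
move=> rho o o1 hrho; have [P HP] := H rho o o1 hrho.
exists (seqp P (seqp (revp o o.+1) (seqp (revp o.+1 1)
   (seqp queryp (seqp (revp 1 o.+1) (revp o.+1 o)))))) => a s s1 hs.
apply: runsb_seq (HP a s s1 hs) _.
set v := f a; set u := answer O v.
have at0 w : lay o s [:: w] o = w by have := lay_at o s [:: w] 0; rewrite addn0.
have at00 w w' : lay o s [:: w'; w] o = w'.
  by have := lay_at o s [:: w'; w] 0; rewrite addn0.
have at1 w w' : lay o s [:: w'; w] o.+1 = w.
  by have := lay_at o s [:: w'; w] 1; rewrite addn1.
have at10 w : lay o s [:: w] o.+1 = [::].
  by have := lay_at o s [:: w] 1; rewrite addn1.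
have at01 L : lay o s L 1 = [::] by rewrite lay_below.
have far L L' r : r != o -> r != o.+1 -> size L <= 2 -> size L' <= 2 ->
    lay o s L r = lay o s L' r.
  move=> h h' hL hL'; rewrite /lay; case: ifP => // h2.
  by rewrite !nth_default //; lia.
pose s2 w := upd (lay o s [:: [::]; [::]]) 1 w.
apply: (@runsb_weak _ _ _ ((2 * size v).+1 + ((2 * size v).+1 +
   (1 + ((2 * size u).+1 + (2 * size u).+1))))).
  by have := hO v; have := sT a; rewrite -/v -/u; lia.
apply: (@runsb_seq _ _ _ _ _ (lay o s [:: [::]; rev v])).
  rewrite -{2}(at0 v); apply: runs_rev_to; rewrite ?at0 ?at00 ?at1 ?at10 //; try lia.
  by move=> r h h'; apply: far.
apply: (@runsb_seq _ _ _ _ _ (s2 v)).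
  rewrite -(size_rev v) -{2}(at1 (rev v) [::]).
  apply: runs_rev_to; first by lia.
  - by rewrite /s2 upd_neq ?at1 //; lia.
  - by rewrite /s2 updE at1 at01 catrevE revK cats0.
  move=> r h h'; rewrite /s2 upd_neq //; case: (eqVneq r o) => [->|h2].
    by rewrite !at00.
  exact: far.
apply: (@runsb_seq _ _ _ _ _ (s2 u)).
  exists 1 => //; apply: runs_eq (runs_query _ ok) => r.
  by rewrite /s2 /upd eqxx; ifs.
apply: (@runsb_seq _ _ _ _ _ (lay o s [:: [::]; rev u])).
  have e1 : s2 u 1 = u by rewrite /s2 updE.
  rewrite -{2}e1; apply: runs_rev_to; first by lia.
  - by rewrite at01.
  - by rewrite e1 /s2 upd_neq ?at1 ?catrevE ?cats0 //; lia.
  move=> r h h'; rewrite /s2 upd_neq //; case: (eqVneq r o) => [->|h2].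
    by rewrite !at00.
  exact: far.
rewrite -(size_rev u) -{2}(at1 (rev u) [::]).
apply: runs_rev_to; rewrite ?at1 ?at00 ?at0 ?at10 ?catrevE ?revK ?cats0 //; try lia.
by move=> r h h'; apply: far.
Qed.

End Basic.

Section Fold.

Variables (A B : code) (l : A -> word) (base : A -> B) (S : A * (B * bool) -> B).
Variable Tb : A -> nat.

Let acc a w := foldl (fun x b => S (a, (x, b))) (base a) w.

Hypotheses (fpl : fp1 l) (fpb : fp base) (fpS : fp S) (pTb : pb Tb).
Hypothesis Tb_acc : forall a l1 l2, l a = l1 ++ l2 -> sz (acc a l1) <= Tb a.

(** Bounded recursion along a word. Iterating a polynomial-time step may blow up exponentially, so
    the bound [Tb] on every intermediate accumulator has to be supplied. *)
Lemma fp1_fold j : j < width B -> fp1 (component (fun a => acc a (l a)) j).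
Proof.
move=> hj; have [Tl [pTl sTl Hl]] := fpl; have [T0 pT0 H0] := fp_tuple fpb.
have [TS [d hTS] HS] := fp_tuple fpS; pose w := width B.
(* The 3 is one for the bit fed to the step and two for the offset in [pb]. *)
pose M a := sz a + Tb a + 3.
pose It a := M a ^ d + (M a + w + 2 + w * (5 * M a + 3)) + 2.
have pM : pb M by rewrite /M; do ?[apply: pb_add | apply: pb_sz | apply: pb_const].
have pIt : pb It.
  by rewrite /It; do ?[exact: pM | apply: pb_add | apply: pb_mul | apply: pb_expc | apply: pb_const].
have szj a : size (component (fun a => acc a (l a)) j a) <= Tb a.
  apply: leq_trans (@Tb_acc a (l a) [::] _); last by rewrite cats0.
  rewrite -(size_enc (acc a (l a))) in hj.
  by rewrite /sz (big_nth [::]) big_mkord (bigD1 (Ordinal hj)) //= leq_addr.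
exists (fun a => Tl a + (T0 a + ((Tl a * It a + 1) +
  ((5 * Tb a + 2) + (Tb a + w + 1 + (5 * Tb a + 3)))))); split.
- by do ?[exact: pIt | apply: pb_add | apply: pb_mul | apply: pb_const].
- by move=> a; have := szj a; lia.
move=> rho o o1 hrho; have [Pl HPl] := Hl rho o o1 hrho.
have [||P0 HP0] := H0 rho o.+1; first by lia.
  by move=> i /hrho; lia.
(* The step reads the parameter where it already lies, and the accumulator and current bit above
   register [o], which holds the rest of the word. *)
pose rho' i := if i < width A then rho i else o.+1 + (i - width A).
have [||PS HPS] := HS rho' (o.+1 + w.+1); first by lia.
  move=> i /= hi; rewrite /rho'; case: ifP => h; first by have := hrho i h; lia.
  by rewrite /w; lia.
pose body b := seqp (pushp (o.+1 + w) b) (seqp PS (collapsep o.+1 w.+1 w)).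
exists (seqp Pl (seqp P0 (seqp (loopp o (body false) (body true))
  (seqp (copyp (o.+1 + j) (o.+1 + w)) (collapsep o w.+1 1))))) => a s s1 hs.
have lay1 L v : lay o.+1 (lay o s [:: v]) L = lay o s (v :: L).
  by have := lay_cat o s [:: v] L; rewrite addn1.
have below L i : i < width A -> lay o s L (rho i) = nth [::] (enc a) i.
  by move=> hi; rewrite lay_below ?hs ?hrho.
have bodyP l1 l2 b : l a = l1 ++ b :: l2 ->
    runsb (body b) (lay o s (l2 :: enc (acc a l1))) (It a).-1
      (lay o s (l2 :: enc (acc a (rcons l1 b)))).
  move=> el; set x := acc a l1.
  have szx : sz x <= Tb a by apply: (Tb_acc el).
  have ey : acc a (rcons l1 b) = S (a, (x, b)) by rewrite /acc foldl_rcons.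
  have szy : sz (S (a, (x, b))) <= Tb a.
    by rewrite -ey; apply: (@Tb_acc _ _ l2); rewrite cat_rcons.
  have szL (z : B) : size (enc z) = w by apply: size_enc.
  have hTx : TS (a, (x, b)) <= M a ^ d.
    apply: leq_trans (hTS _) _; rewrite !sz_pair sz_bool.
    by case: (d) => // d'; rewrite leq_exp2r //= /M; lia.
  apply: (@runsb_weak _ _ _ (1 + (TS (a, (x, b)) + (\sum_(v <- enc x ++ [:: [:: b]]) (size v).+1 +
     size (enc (S (a, (x, b)))) * (5 * sz (S (a, (x, b))) + 3))))).
    rewrite big_cat big_seq1 /= szL.
    have -> : \sum_(v <- enc x) (size v).+1 = sz x + w.
      rewrite -(szL x) /sz -sum1_size -big_split /=.
      by apply: eq_bigr => v _; rewrite addn1.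
    have : w * (5 * sz (S (a, (x, b))) + 3) <= w * (5 * M a + 3).
      by rewrite leq_mul2l; apply/orP; right; rewrite /M; lia.
    have : sz x <= M a by rewrite /M; lia.
    by rewrite /It; lia.
  apply: (@runsb_seq _ _ _ _ _ (lay o s (l2 :: enc x ++ [:: [:: b]]))).
    exists 1 => //; apply: runs_eq (runs_push _ _ _ _) => r.
    rewrite /upd /lay -(szL x); case: (eqVneq r) => [->|h].
      rewrite ifF ?ifF; try lia.
      have -> : o.+1 + size (enc x) - o = (size (enc x)).+1 by lia.
      by rewrite /= nth_cat ltnn subnn nth_default.
    case: ifP => // h'; case e : (r - o) => [|i] //=; rewrite nth_cat; case: ifP => // h2.
    rewrite !nth_default //=; lia.
  apply: (@runsb_seq _ _ _ _ _ (lay o s (l2 :: (enc x ++ [:: [:: b]]) ++ enc (S (a, (x, b)))))).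
    have := HPS (a, (x, b)) (lay o s (l2 :: enc x ++ [:: [:: b]])).
    have e1 := lay_cat0 o s (l2 :: enc x ++ [:: [:: b]]).
    have e2 := lay_cat o s (l2 :: enc x ++ [:: [:: b]]) (enc (S (a, (x, b)))).
    rewrite /= size_cat /= addn1 szL -addSnnS in e1 e2; rewrite e1 e2; apply.
      by rewrite lay_below.
    move=> i /= hi; rewrite /rho'; case: ifP => h.
      by rewrite nth_cat size_enc h below.
    have := lay_at o s (l2 :: enc x ++ [:: [:: b]]) (i - width A).+1.
    by rewrite -addSnnS /= => ->; rewrite [RHS]nth_cat size_enc h.
  rewrite ey -(lay1 (enc (S (a, (x, b)))) l2).
  rewrite -(lay1 ((enc x ++ [:: [:: b]]) ++ enc (S (a, (x, b)))) l2).
  have := runs_collapse O o.+1 (lay o s [:: l2]) (enc x ++ [:: [:: b]]) (enc (S (a, (x, b)))).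
  by rewrite size_cat /= addn1 !szL.
have loopP l2 : forall l1, l a = l1 ++ l2 ->
    runsb (loopp o (body false) (body true)) (lay o s (l2 :: enc (acc a l1)))
      (size l2 * It a + 1) (lay o s ([::] :: enc (acc a (l1 ++ l2)))).
  elim: l2 => [|b l2 IH] l1 el.
    rewrite cats0; exists 1 => //; apply: runs_loop0.
    by have := lay_at o s ([::] :: enc (acc a l1)) 0; rewrite addn0.
  have [n hn Hn] := bodyP _ _ _ el.
  rewrite -cat_rcons in el *; have [n' hn' Hn'] := IH _ el.
  exists (n + n').+1; first by rewrite /= /It in hn hn' *; lia.
  apply: (@runs_loop _ _ _ _ _ b l2 _ _ _ _ _ _ Hn').
    by have := lay_at o s ((b :: l2) :: enc (acc a l1)) 0; rewrite addn0.
  have -> : upd (lay o s ((b :: l2) :: enc (acc a l1))) o l2 = lay o s (l2 :: enc (acc a l1)).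
    apply: functional_extensionality => r; rewrite /upd /lay.
    by case: eqVneq => [->|h]; [rewrite ltnn subnn | case e : (r - o) => [|i] //; ifs].
  by move: Hn; case: (b).
apply: runsb_seq (HPl a s s1 hs) _.
apply: (@runsb_seq _ _ _ _ _ (lay o s (l a :: enc (base a)))).
  have := HP0 a (lay o s [:: l a]); rewrite !lay1; apply; first by rewrite lay_below.
  by move=> i hi; rewrite below.
apply: (@runsb_seq _ _ _ _ _ (lay o s ([::] :: enc (acc a (l a))))).
  apply: runsb_weak (loopP (l a) [::] erefl).
  by rewrite leq_add2r leq_mul2r sTl orbT.
set v := component _ j a; have szE : size (enc (acc a (l a))) = w by apply: size_enc.
apply: (@runsb_seq _ _ _ _ _ (lay o s (([::] :: enc (acc a (l a))) ++ [:: v]))).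
  have hjo : o.+1 + j < o.+1 + w by rewrite ltn_add2l.
  have := runs_copy O (lay o s ([::] :: enc (acc a (l a)))) hjo.
  have e1 := lay_cat0 o s ([::] :: enc (acc a (l a))).
  have e2 := lay_cat o s ([::] :: enc (acc a (l a))) [:: v].
  rewrite /= szE -addSnnS in e1 e2.
  have -> : lay o s ([::] :: enc (acc a (l a))) (o.+1 + j) = v.
    by rewrite addSnnS lay_at.
  by rewrite e1 e2; apply: runsb_weak; have := szj a; rewrite -/v; lia.
have := runs_collapse O o s ([::] :: enc (acc a (l a))) [:: v].
rewrite /= szE; apply: runsb_weak.
rewrite !big_cons !big_nil /= mul1n.
have -> : \sum_(v <- enc (acc a (l a))) (size v).+1 = sz (acc a (l a)) + w.
  rewrite -szE /sz -sum1_size -big_split /=.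
  by apply: eq_bigr => u _; rewrite addn1.
have := szj a; rewrite -/v; have := @Tb_acc a (l a) [::]; rewrite cats0 => /(_ erefl).
lia.
Qed.

End Fold.

Lemma fp1_comp (A B : code) (f : A -> B) (g : B -> word) :
  fp f -> fp1 g -> fp1 (fun a => g (f a)).
Proof.
move=> fpf [Tg [pTg sTg Hg]]; have [T pT H] := fp_tuple fpf.
have pf := fp_sz fpf; have pTgf := pb_comp pf pTg.
exists (fun a => T a + (Tg (f a) + (sz (f a) + width B + (5 * Tg (f a) + 3)))); split.
- by do ?[apply: pb_add | apply: pb_mul | apply: pb_const].
- by move=> a; have := sTg (f a); lia.
move=> rho o o1 hrho; have [P HP] := H rho o o1 hrho.
have [||Pg HPg] := Hg (fun i => o + i) (o + width B); first by lia.
  by move=> i hi; rewrite ltn_add2l.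
exists (seqp P (seqp Pg (collapsep o (width B) 1))) => a s s1 hs.
apply: runsb_seq (HP a s s1 hs) _.
apply: (@runsb_seq _ _ _ _ _ (lay o s (enc (f a) ++ [:: g (f a)]))).
  have := HPg (f a) (lay o s (enc (f a))).
  have e1 := lay_cat0 o s (enc (f a)); have e2 := lay_cat o s (enc (f a)) [:: g (f a)].
  rewrite size_enc in e1 e2; rewrite e1 e2; apply; first by rewrite lay_below.
  by move=> i hi; rewrite lay_at.
have := runs_collapse O o s (enc (f a)) [:: g (f a)]; rewrite size_enc.
apply: runsb_weak; rewrite !big_cons !big_nil /= mul1n.
have -> : \sum_(v <- enc (f a)) (size v).+1 = sz (f a) + width B.
  rewrite -(size_enc (f a)) /sz -sum1_size -big_split /=.
  by apply: eq_bigr => u _; rewrite addn1.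
by have := sTg (f a); lia.
Qed.

End Closure.

Section Rules.

Variable O : oracle.

Notation fp := (fp O).
Notation fp1 := (fp1 O).

Lemma fp_of1 (A : code) (f : A -> word) : fp1 f -> fp f.
Proof. by move=> H [|//] _; apply: fp1_ext H. Qed.

Lemma fp_to1 (A : code) (f : A -> word) : fp f -> fp1 f.
Proof. by move=> /(_ 0 isT); apply: fp1_ext. Qed.

Lemma fp_nat1 (A : code) (f : A -> nat) : fp f <-> fp1 (fun a => nseq (f a) true).
Proof.
split=> [/(_ 0 isT)|H [|//] _]; first exact: fp1_ext.
by apply: fp1_ext H.
Qed.

Lemma fp_bool1 (A : code) (f : A -> bool) : fp f <-> fp1 (fun a => [:: f a]).
Proof.
split=> [/(_ 0 isT)|H [|//] _]; first exact: fp1_ext.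
by apply: fp1_ext H.
Qed.

Lemma fp_id (A : code) : fp (fun a : A => a).
Proof. by move=> i hi; apply: fp1_proj. Qed.

Lemma fp_comp (A B C : code) (g : B -> C) (f : A -> B) :
  fp g -> fp f -> fp (fun a => g (f a)).
Proof. by move=> Hg Hf i hi; apply: (fp1_comp Hf (Hg i hi)). Qed.

Lemma fp_pair (A B C : code) (f : A -> B) (g : A -> C) :
  fp f -> fp g -> fp (fun a => (f a, g a)).
Proof.
move=> Hf Hg i /= hi; case: (ltnP i (width B)) => h.
  by apply: (fp1_ext _ (Hf i h)) => a; rewrite /component /= nth_cat size_enc h.
have h' : i - width B < width C by lia.
by apply: (fp1_ext _ (Hg _ h')) => a; rewrite /component /= nth_cat size_enc ltnNge h.
Qed.

Lemma fp_fst (A B C : code) (f : A -> B * C) : fp f -> fp (fun a => (f a).1).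
Proof.
move=> H i hi; have := H i; rewrite /= (leq_trans hi (leq_addr _ _)) => /(_ isT).
by apply: fp1_ext => a; rewrite /component /= nth_cat size_enc hi.
Qed.

Lemma fp_snd (A B C : code) (f : A -> B * C) : fp f -> fp (fun a => (f a).2).
Proof.
move=> H i hi; have := H (width B + i); rewrite /= ltn_add2l => /(_ hi).
by apply: fp1_ext => a; rewrite /component /= nth_cat size_enc ifF ?addKn //; lia.
Qed.

Lemma fp1_const (A : code) (w : word) : fp1 (fun _ : A => w).
Proof. by elim: w => [|b w IH]; [apply: fp1_nil | apply: fp1_cons]. Qed.

Lemma fp_const (A B : code) (x : B) : fp (fun _ : A => x).
Proof. by move=> i hi; apply: fp1_const. Qed.

Lemma fp_if (A B : code) (c : A -> bool) (f g : A -> B) :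
  fp c -> fp f -> fp g -> fp (fun a => if c a then f a else g a).
Proof.
move=> /fp_bool1 Hc Hf Hg i hi.
apply: (fp1_ext _ (fp1_case Hc (Hg i hi) (Hg i hi) (Hf i hi))) => a.
by rewrite /component; case: (c a).
Qed.

Lemma fp_fold (A B : code) (l : A -> word) (b : A -> B)
    (F : A -> B -> bool -> B) (T : A -> nat) :
  fp l -> fp b -> fp (fun p => F p.1 p.2.1 p.2.2) -> pb T ->
  (forall a l1 l2, l a = l1 ++ l2 -> sz (foldl (F a) (b a) l1) <= T a) ->
  fp (fun a => foldl (F a) (b a) (l a)).
Proof.
move=> Hl Hb HF pT hT i hi.
by apply: (fp1_fold (S := fun p => F p.1 p.2.1 p.2.2) (fp_to1 Hl) Hb HF pT _ hi).
Qed.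

(** Growth by a polynomial amount per letter adds up to a polynomial, so the bound on the
    accumulators comes for free. *)
Lemma fp_fold_grow (A B : code) (l : A -> word) (b : A -> B)
    (F : A -> B -> bool -> B) (T : A -> nat) :
  fp l -> fp b -> fp (fun p => F p.1 p.2.1 p.2.2) -> pb T ->
  (forall a x c, sz (F a x c) <= sz x + T a) ->
  fp (fun a => foldl (F a) (b a) (l a)).
Proof.
move=> Hl Hb HF pT hT.
apply: (fp_fold (T := fun a => sz (b a) + sz (l a) * T a)) => //.
  by do ?[apply: pb_add | apply: pb_mul | exact: (fp_sz Hb) | exact: (fp_sz Hl)].
move=> a l1 l2 e.
have : size l1 <= sz (l a) by rewrite /sz big_seq1 e size_cat leq_addr.
have: sz (foldl (F a) (b a) l1) <= sz (b a) + size l1 * T a.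
  elim/last_ind: (l1) => [|l3 d IH]; first exact: leq_addr.
  by rewrite size_rcons foldl_rcons; apply: leq_trans (hT _ _ _) _; lia.
by nia.
Qed.

Lemma fp_cons (A : code) (b : A -> bool) (w : A -> word) :
  fp b -> fp w -> fp (fun a => b a :: w a).
Proof.
move=> Hb /fp_to1 Hw.
apply: (@fp_ext _ _ _ (fun a => if b a then true :: w a else false :: w a)).
  by move=> a; case: (b a).
by apply: fp_if => //; apply: fp_of1; apply: fp1_cons.
Qed.

Lemma fp_behead (A : code) (w : A -> word) : fp w -> fp (fun a => behead (w a)).
Proof. by move=> /fp_to1 Hw; apply: fp_of1; apply: fp1_behead. Qed.

Lemma fp_head (A : code) b (w : A -> word) : fp w -> fp (fun a => head b (w a)).
Proof.
move=> /fp_to1 Hw; apply/fp_bool1.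
apply: (fp1_ext _ (fp1_case Hw (fp1_const _ [:: b]) (fp1_const _ [:: false])
  (fp1_const _ [:: true]))) => a.
by case: (w a) => [|[]].
Qed.

Lemma fp_nilp (A : code) (w : A -> word) : fp w -> fp (fun a => nilp (w a)).
Proof.
move=> /fp_to1 Hw; apply/fp_bool1.
apply: (fp1_ext _ (fp1_case Hw (fp1_const _ [:: true]) (fp1_const _ [:: false])
  (fp1_const _ [:: false]))) => a.
by case: (w a) => [|[]].
Qed.

Lemma fp_size (A : code) (w : A -> word) : fp w -> fp (fun a => size (w a)).
Proof.
move=> Hw; apply: (@fp_ext _ _ _ (fun a => foldl (fun x _ => x.+1) 0 (w a))).
  by move=> a; elim/last_ind: (w a) => // l c IH; rewrite foldl_rcons size_rcons IH.
apply: (fp_fold_grow (F := fun _ x _ => x.+1) (T := fun=> 1)) => //.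
- exact: fp_const.
- apply/fp_nat1; apply: (fp1_cons true); apply/fp_nat1.
  by apply: fp_fst; apply: fp_snd; apply: fp_id.
- exact: pb_const.
- by move=> a x c; rewrite !sz_nat addn1.
Qed.

(** ** Unary arithmetic *)

Lemma fp_succ (A : code) (n : A -> nat) : fp n -> fp (fun a => (n a).+1).
Proof. by move=> /fp_nat1 H; apply/fp_nat1; apply: (fp1_cons true). Qed.

Lemma fp_pred (A : code) (n : A -> nat) : fp n -> fp (fun a => (n a).-1).
Proof.
move=> /fp_nat1 H; apply/fp_nat1; apply: (fp1_ext _ (fp1_behead H)) => a.
by case: (n a).
Qed.

Lemma fp_eq0 (A : code) (n : A -> nat) : fp n -> fp (fun a => n a == 0).
Proof.
move=> /fp_nat1/fp_of1/fp_nilp; apply: fp_ext => a.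
by rewrite /nilp size_nseq.
Qed.

Lemma fp_iteri (A B : code) (n : A -> nat) (b : A -> B)
    (F : A -> nat -> B -> B) (T : A -> nat) :
  fp n -> fp b -> fp (fun p => F p.1 p.2.1 p.2.2) -> pb T ->
  (forall a k, k <= n a -> sz (iteri k (F a) (b a)) <= T a) ->
  fp (fun a => iteri (n a) (F a) (b a)).
Proof.
move=> Hn Hb HF pT hT.
pose G a (x : nat * B) (_ : bool) := (x.1.+1, F a x.1 x.2).
have GE a k : foldl (G a) (0, b a) (nseq k true) = (k, iteri k (F a) (b a)).
  by elim: k => // k IH; rewrite -[in nseq _ _]addn1 nseqD cats1 foldl_rcons IH.
apply: (@fp_ext _ _ _ (fun a => (foldl (G a) (0, b a) (nseq (n a) true)).2)).
  by move=> a; rewrite GE.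
apply: fp_snd; apply: (fp_fold (F := G) (T := fun a => sz (n a) + T a)).
- by move/fp_nat1: Hn; apply: fp_of1.
- by apply: fp_pair => //; apply: fp_const.
- apply: fp_pair.
    by apply: fp_succ; apply: fp_fst; apply: fp_fst; apply: fp_snd; apply: fp_id.
  apply: (fp_comp HF (f := fun p => (p.1, p.2.1))).
  by apply: fp_pair; apply: fp_fst; [|apply: fp_snd]; apply: fp_id.
- by apply: pb_add => //; apply: fp_sz Hn.
move=> a l1 l2 e; have hk : size l1 <= n a.
  by rewrite -(size_nseq (n a) true) e size_cat leq_addr.
have -> : l1 = nseq (size l1) true.
  by apply/all_pred1P; have := all_pred1_nseq true (n a); rewrite e all_cat => /andP[].
by rewrite GE sz_pair sz_nat leq_add ?hT // sz_nat.
Qed.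

Lemma fp_iter (A B : code) (n : A -> nat) (b : A -> B) (F : A -> B -> B) (T : A -> nat) :
  fp n -> fp b -> fp (fun p => F p.1 p.2) -> pb T ->
  (forall a k, k <= n a -> sz (iter k (F a) (b a)) <= T a) ->
  fp (fun a => iter (n a) (F a) (b a)).
Proof.
move=> Hn Hb HF pT hT.
have E a k : iteri k (fun _ => F a) (b a) = iter k (F a) (b a) by elim: k => //= k ->.
apply: (fp_ext (f := fun a => iteri (n a) (fun _ => F a) (b a))) => [a|]; first exact: E.
apply: (fp_iteri (F := fun a _ => F a) Hn Hb _ pT) => [|a k hk]; last by rewrite E hT.
apply: (fp_comp HF (f := fun p => (p.1, p.2.2))).
by apply: fp_pair; [apply: fp_fst | apply: fp_snd; apply: fp_snd]; apply: fp_id.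
Qed.

Lemma fp_pb (A : code) (n : A -> nat) : fp n -> pb n.
Proof. by move/fp_sz; apply: pb_le => a; rewrite sz_nat. Qed.

Section Arithmetic.

Variables (A : code) (n m : A -> nat).
Hypotheses (Hn : fp n) (Hm : fp m).

Let pn : pb n := fp_pb Hn.
Let pm : pb m := fp_pb Hm.

Lemma fp_add : fp (fun a => n a + m a).
Proof.
apply: (fp_ext (f := fun a => iter (n a) S (m a))) => [a|]; first by rewrite iter_succn addnC.
apply: (fp_iter (F := fun _ => S) (T := fun a => n a + m a)) => //.
- by apply: fp_succ; apply: fp_snd; apply: fp_id.
- exact: pb_add.
by move=> a k hk; rewrite iter_succn sz_nat; lia.
Qed.

Lemma fp_sub : fp (fun a => n a - m a).
Proof.
apply: (fp_ext (f := fun a => iter (m a) predn (n a))) => [a|]; first by rewrite iter_predn.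
apply: (fp_iter (F := fun _ => predn) (T := n)) => //.
- by apply: fp_pred; apply: fp_snd; apply: fp_id.
by move=> a k hk; rewrite iter_predn sz_nat; lia.
Qed.

Lemma fp_leq : fp (fun a => n a <= m a).
Proof. exact: fp_eq0 fp_sub. Qed.

End Arithmetic.

Lemma fp_mul (A : code) (n m : A -> nat) : fp n -> fp m -> fp (fun a => n a * m a).
Proof.
move=> Hn Hm; have pn := fp_pb Hn; have pm := fp_pb Hm.
apply: (fp_ext (f := fun a => iter (n a) (addn (m a)) 0)) => [a|].
  by rewrite iter_addn_0 mulnC.
apply: (fp_iter (F := fun a => addn (m a)) (T := fun a => n a * m a)) => //.
- exact: fp_const.
- apply: fp_add; last by apply: fp_snd; apply: fp_id.
  by apply: (fp_comp Hm); apply: fp_fst; apply: fp_id.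
- exact: pb_mul.
by move=> a k hk; rewrite iter_addn_0 sz_nat mulnC leq_mul2r hk orbT.
Qed.

Lemma fp_negb (A : code) (p : A -> bool) : fp p -> fp (fun a => ~~ p a).
Proof.
move=> Hp; apply: (fp_ext (f := fun a => if p a then false else true)).
  by move=> a; case: (p a).
by apply: fp_if => //; apply: fp_const.
Qed.

Lemma fp_andb (A : code) (p q : A -> bool) : fp p -> fp q -> fp (fun a => p a && q a).
Proof.
move=> Hp Hq; apply: (fp_ext (f := fun a => if p a then q a else false)) => //.
by apply: fp_if => //; apply: fp_const.
Qed.

Lemma fp_orb (A : code) (p q : A -> bool) : fp p -> fp q -> fp (fun a => p a || q a).
Proof.
move=> Hp Hq; apply: (fp_ext (f := fun a => if p a then true else q a)) => //.
by apply: fp_if => //; apply: fp_const.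
Qed.

Lemma fp_implyb (A : code) (p q : A -> bool) : fp p -> fp q -> fp (fun a => p a ==> q a).
Proof.
move=> Hp Hq; apply: (fp_ext (f := fun a => if p a then q a else true)) => //.
by apply: fp_if => //; apply: fp_const.
Qed.

Lemma fp_eqb (A : code) (p q : A -> bool) : fp p -> fp q -> fp (fun a => p a == q a).
Proof.
move=> Hp Hq; apply: (fp_ext (f := fun a => if p a then q a else ~~ q a)).
  by move=> a; case: (p a); case: (q a).
by apply: fp_if => //; apply: fp_negb.
Qed.

Lemma fp_b2n (A : code) (p : A -> bool) : fp p -> fp (fun a => nat_of_bool (p a)).
Proof.
move=> Hp; apply: (fp_ext (f := fun a => if p a then 1 else 0)).
  by move=> a; case: (p a).
by apply: fp_if => //; apply: fp_const.
Qed.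

Lemma fp_eqn (A : code) (n m : A -> nat) : fp n -> fp m -> fp (fun a => n a == m a).
Proof.
move=> Hn Hm; apply: (fp_ext (f := fun a => (n a <= m a) && (m a <= n a))).
  by move=> a; rewrite eqn_leq.
by apply: fp_andb; apply: fp_leq.
Qed.

(** A bound on a loop body becomes uniform in the loop index, because the index is unary and at most
    [n a]. *)
Lemma pb_range (A : code) (n : A -> nat) (T : A * nat -> nat) :
  pb n -> pb T -> exists2 T' : A -> nat, pb T' &
    forall a i, i <= n a -> T (a, i) <= T' a.
Proof.
move=> pn [d hd]; exists (fun a => (sz a + n a + 2) ^ d).
  by apply: pb_expc; do ?[apply: pb_add | apply: pb_sz | apply: pb_const].
move=> a i hi; apply: leq_trans (hd _) _; rewrite sz_pair sz_nat /=.
by case: (d) => // d'; rewrite leq_exp2r //; lia.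
Qed.

Lemma fp_sum (A : code) (n : A -> nat) (F : A -> nat -> nat) :
  fp n -> fp (fun p => F p.1 p.2) -> fp (fun a => \sum_(i < n a) F a i).
Proof.
move=> Hn HF; have pn := fp_pb Hn.
have E a k : iteri k (fun i x => x + F a i) 0 = \sum_(i < k) F a i.
  by elim: k => [|k IH]; rewrite ?big_ord0 // big_ord_recr /= IH.
apply: (fp_ext (f := fun a => iteri (n a) (fun i x => x + F a i) 0)) => [a|]; first exact: E.
have [T pT hT] := pb_range pn (fp_pb HF).
apply: (fp_iteri (F := fun a i x => x + F a i) (T := fun a => n a * T a)) => //.
- exact: fp_const.
- apply: fp_add; first by do 2!apply: fp_snd; apply: fp_id.
  apply: (fp_comp HF (f := fun p => (p.1, p.2.1))).
  by apply: fp_pair; apply: fp_fst; [|apply: fp_snd]; apply: fp_id.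
- exact: pb_mul.
move=> a k hk; rewrite E sz_nat; apply: (@leq_trans (\sum_(i < k) T a)).
  by apply: leq_sum => i _; apply: hT; apply: leq_trans (ltnW (ltn_ord i)) hk.
by rewrite sum_nat_const card_ord leq_mul2r hk orbT.
Qed.

Lemma fp_sum_range (A : code) (n : A -> nat) (F : A -> nat -> nat) :
  fp n -> fp (fun p => F p.1 p.2) -> fp (fun a => \sum_(0 <= i < n a) F a i).
Proof.
by move=> Hn HF; apply: fp_ext (fp_sum Hn HF) => a; rewrite big_mkord.
Qed.

Lemma fp_all (A : code) (n : A -> nat) (P : A -> nat -> bool) :
  fp n -> fp (fun p => P p.1 p.2) -> fp (fun a => all (P a) (iota 0 (n a))).
Proof.
move=> Hn HP.
apply: (fp_ext (f := fun a => \sum_(i < n a) (~~ P a i) == 0)).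
  move=> a; rewrite sum_nat_eq0; apply/forallP/allP => /= h i; last first.
    by rewrite eqb0 negbK h // mem_iota ltn_ord.
  by rewrite mem_iota => /= hi; have := h (Ordinal hi); rewrite eqb0 negbK.
apply: fp_eq0; apply: (fp_sum (F := fun a i => nat_of_bool (~~ P a i))) => //.
by apply: fp_b2n; apply: fp_negb.
Qed.

Lemma fp_has (A : code) (n : A -> nat) (P : A -> nat -> bool) :
  fp n -> fp (fun p => P p.1 p.2) -> fp (fun a => has (P a) (iota 0 (n a))).
Proof.
move=> Hn HP.
apply: (fp_ext (f := fun a => ~~ all (fun i => ~~ P a i) (iota 0 (n a)))).
  by move=> a; rewrite -[has _ _]negbK -all_predC.
by apply: fp_negb; apply: (fp_all (P := fun a i => ~~ P a i)) => //; apply: fp_negb.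
Qed.

Lemma fp_divn (A : code) (n m : A -> nat) : fp n -> fp m -> fp (fun a => n a %/ m a).
Proof.
move=> Hn Hm.
(* The quotient is the number of positive multiples of [m a] up to [n a]; for [m a = 0] it is 0 by
   convention. *)
apply: (fp_ext (f := fun a => if m a == 0 then 0
   else \sum_(i < n a) (i.+1 * m a <= n a))).
  move=> a; case: eqP => [->|/eqP]; first by rewrite divn0.
  rewrite -lt0n => m0; rewrite -(big_mkord xpredT (fun i => nat_of_bool (i.+1 * m a <= n a))).
  have h : n a %/ m a <= n a by apply: leq_div.
  rewrite (big_cat_nat (n := n a %/ m a)) //= [X in _ + X]big1_seq ?addn0.
    rewrite (eq_big_nat _ _ (F2 := fun=> 1)) ?sum_nat_const_nat ?subn0 ?muln1 // => i /andP[_ hi].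
    by rewrite -leq_divRL // hi.
  move=> i /andP[_]; rewrite mem_index_iota => /andP[hi _].
  by rewrite -leq_divRL // ltnNge hi.
apply: fp_if; [exact: fp_eq0 | exact: fp_const |].
apply: (fp_sum (F := fun a i => nat_of_bool (i.+1 * m a <= n a))) => //.
apply: fp_b2n; apply: fp_leq; last by apply: (fp_comp Hn); apply: fp_fst; apply: fp_id.
apply: fp_mul; last by apply: (fp_comp Hm); apply: fp_fst; apply: fp_id.
by apply: fp_succ; apply: fp_snd; apply: fp_id.
Qed.

Lemma fp_modn (A : code) (n m : A -> nat) : fp n -> fp m -> fp (fun a => n a %% m a).
Proof.
move=> Hn Hm; apply: (fp_ext (f := fun a => n a - n a %/ m a * m a)).
  by move=> a; rewrite {1}(divn_eq (n a) (m a)) addKn.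
by apply: fp_sub => //; apply: fp_mul => //; apply: fp_divn.
Qed.

End Rules.

Lemma fp_comp2 O (A B C D : code) (F : B -> C -> D) (f : A -> B) (g : A -> C) :
  fp O (fun p => F p.1 p.2) -> fp O f -> fp O g -> fp O (fun a => F (f a) (g a)).
Proof. by move=> HF Hf Hg; apply: (fp_comp HF (f := fun a => (f a, g a))); apply: fp_pair. Qed.

Ltac fp_user := fail.

Ltac fp_step := lazymatch goal with
  | |- fp _ (fun _ => ?x) => apply: fp_const
  | |- fp _ (fun a => a) => apply: fp_id
  | |- fp _ fst => apply: (fp_fst (f := fun a => a)); apply: fp_id
  | |- fp _ snd => apply: (fp_snd (f := fun a => a)); apply: fp_id
  | |- fp _ (fun a => (_, _)) => apply: fp_pair
  | |- fp _ (fun a => fst _) => apply: fp_fst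
  | |- fp _ (fun a => snd _) => apply: fp_snd
  | |- fp _ (fun a => _ + _) => apply: fp_add
  | |- fp _ (fun a => _ - _) => apply: fp_sub
  | |- fp _ (fun a => _ * _) => apply: fp_mul
  | |- fp _ (fun a => _ %/ _) => apply: fp_divn
  | |- fp _ (fun a => _ %% _) => apply: fp_modn
  | |- fp _ (fun a => S _) => apply: fp_succ
  | |- fp _ (fun a => predn _) => apply: fp_pred
  | |- fp _ (fun a => _ <= _) => apply: fp_leq
  | |- fp _ (fun a => @eq_op Datatypes_nat__canonical__eqtype_Equality _ _) => apply: fp_eqn
  | |- fp _ (fun a => @eq_op Datatypes_bool__canonical__eqtype_Equality _ _) => apply: fp_eqb
  | |- fp _ (fun a => ~~ _) => apply: fp_negb
  | |- fp _ (fun a => _ && _) => apply: fp_andb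
  | |- fp _ (fun a => _ || _) => apply: fp_orb
  | |- fp _ (fun a => _ ==> _) => apply: fp_implyb
  | |- fp _ (fun a => nat_of_bool _) => apply: fp_b2n
  | |- fp _ (fun a => if _ then _ else _) => apply: fp_if
  | |- fp _ (fun a => size _) => apply: fp_size
  | |- fp _ (fun a => nilp _) => apply: fp_nilp
  | |- fp _ (fun a => head _ _) => apply: fp_head
  | |- fp _ (fun a => behead _) => apply: fp_behead
  | |- fp _ (fun a => _ :: _) => apply: fp_cons
  | |- fp _ (fun a => @bigop.body _ _ _ (index_iota 0 _) _) => apply: fp_sum_range
  | |- fp _ (fun a => all _ (iota 0 _)) => apply: fp_all
  | |- fp _ (fun a => has _ (iota 0 _)) => apply: fp_has
  | H : fp _ ?f |- fp _ (fun a => ?f _) => apply: (fp_comp H)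
  | |- _ => fp_user
  end.

Ltac fp_eta := lazymatch goal with
  | |- fp _ fst => idtac
  | |- fp _ snd => idtac
  | |- fp _ (fun _ => _) => idtac
  | |- @fp ?O ?A ?B ?f => change (@fp O A B (fun a => f a))
  end.

Ltac fp_auto := repeat (cbv beta; try assumption; fp_eta; fp_step).

Section Words.

Variable O : oracle.

Notation fp := (fp O).

Lemma fp_catrev (A : code) (v w : A -> word) :
  fp v -> fp w -> fp (fun a => catrev (v a) (w a)).
Proof.
move=> Hv Hw; apply: (fp_ext (f := fun a => foldl (fun x b => b :: x) (w a) (v a))).
  by move=> a; elim: (v a) (w a) => //= b v' IH w'; rewrite IH.
apply: (fp_fold_grow (F := fun _ x b => b :: x) (T := fun=> 1)) => //.
- by fp_auto.
- exact: pb_const.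
by move=> a x c; rewrite !sz_word addn1.
Qed.

Lemma fp_rev (A : code) (w : A -> word) : fp w -> fp (fun a => rev (w a)).
Proof. by move=> Hw; apply: fp_catrev => //; apply: fp_const. Qed.

Lemma fp_cat (A : code) (v w : A -> word) :
  fp v -> fp w -> fp (fun a => v a ++ w a).
Proof.
move=> Hv Hw; apply: (fp_ext (f := fun a => catrev (rev (v a)) (w a))).
  by move=> a; rewrite catrevE revK.
by apply: fp_catrev => //; apply: fp_rev.
Qed.

Lemma fp_drop (A : code) (n : A -> nat) (w : A -> word) :
  fp n -> fp w -> fp (fun a => drop (n a) (w a)).
Proof.
move=> Hn Hw.
have E k (v : word) : iter k behead v = drop k v.
  by elim: k v => [|k IH] v; rewrite ?drop0 // iterSr IH -drop1 drop_drop addn1.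
apply: (fp_ext (f := fun a => iter (n a) behead (w a))) => [a|]; first exact: E.
apply: (fp_iter (F := fun _ => behead) (T := fun a => sz (w a))) => //.
- by fp_auto.
- exact: fp_sz Hw.
by move=> a k _; rewrite E !sz_word size_drop leq_subr.
Qed.

Lemma fp_nth (A : code) (n : A -> nat) (w : A -> word) :
  fp n -> fp w -> fp (fun a => nth false (w a) (n a)).
Proof.
move=> Hn Hw; apply: (fp_ext (f := fun a => head false (drop (n a) (w a)))).
  by move=> a; rewrite -nth0 nth_drop addn0.
by apply: fp_head; apply: fp_drop.
Qed.

Lemma fp_mkseq (A : code) (n : A -> nat) (P : A -> nat -> bool) :
  fp n -> fp (fun p => P p.1 p.2) -> fp (fun a => mkseq (P a) (n a)).
Proof.
move=> Hn HP.
have E a k : iteri k (fun i w => P a i :: w) [::] = rev (mkseq (P a) k).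
  by elim: k => //= k ->; rewrite mkseqS rev_rcons.
apply: (fp_ext (f := fun a => rev (iteri (n a) (fun i w => P a i :: w) [::]))).
  by move=> a; rewrite E revK.
apply: fp_rev.
apply: (fp_iteri (F := fun a i w => P a i :: w) (T := n)) => //.
- exact: fp_const.
- by apply: fp_cons; [apply: (fp_comp2 HP)|]; fp_auto.
- exact: fp_pb Hn.
by move=> a k hk; rewrite E sz_word size_rev size_mkseq.
Qed.

Lemma fp_nseq (A : code) (n : A -> nat) : fp n -> fp (fun a => nseq (n a) true).
Proof. by move/fp_nat1; apply: fp_of1. Qed.

Lemma fp_index (A : code) (w : A -> word) : fp w -> fp (fun a => index false (w a)).
Proof.
move=> Hw.
apply: (fp_ext (f := fun a => \sum_(i < size (w a))
   (all (fun j => nth false (w a) j) (iota 0 i.+1)))).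
  move=> a; elim: (w a) => [|b v IH]; first by rewrite big_ord0.
  rewrite /= big_ord_recl /= andbT; case: b => /=.
    rewrite add1n -IH; congr S; apply: eq_bigr => i _.
    by rewrite /= add0n -[2]/(1 + 1) iotaDl all_map.
  by rewrite big1.
apply: (fp_sum (F := fun a i => nat_of_bool (all (fun j => nth false (w a) j) (iota 0 i.+1)))).
  by fp_auto.
apply: fp_b2n; apply: (fp_all (n := fun p : A * nat => p.2.+1)
  (P := fun p j => nth false (w p.1) j)); first by fp_auto.
by apply: fp_nth; fp_auto.
Qed.

Lemma fp_index_mem (A : code) (w : A -> word) : fp w -> fp (fun a => false \in w a).
Proof.
move=> Hw; apply: (fp_ext (f := fun a => (index false (w a)).+1 <= size (w a))).
  by move=> a; rewrite index_mem.
by fp_auto; apply: fp_index.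
Qed.

(** However complicated [f] is, finitely many of its values can be hard-wired as a cascade of tests.
    This is how the transition function of an arbitrary machine enters the reduction. *)
Lemma fp_table (A B : code) K (x0 : B) (f : nat -> B) (n : A -> nat) :
  fp n -> fp (fun a => if n a < K then f (n a) else x0).
Proof.
move=> Hn; elim: K => [|K IH].
  by apply: (fp_ext (f := fun=> x0)) => [a|]; [rewrite ltn0 | apply: fp_const].
apply: (fp_ext (f := fun a => if n a == K then f K else
   if n a < K then f (n a) else x0)).
  move=> a; rewrite [in RHS]ltnS [in RHS]leq_eqVlt.
  by case: eqP => [->|_] //=.
by fp_auto.
Qed.

Lemma fp_horner (A : code) (p : {poly nat}) (n : A -> nat) :
  fp n -> fp (fun a => p.[n a]%R).
Proof.
move=> Hn; rewrite /horner; elim: (polyseq p) => [|c s IH] /=.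
  exact: fp_const.
by rewrite -[GRing.add]/addn -[GRing.mul]/muln; fp_auto.
Qed.

End Words.

Ltac fp_user ::= lazymatch goal with
  | |- fp _ (fun a => catrev _ _) => apply: fp_catrev
  | |- fp _ (fun a => rev _) => apply: fp_rev
  | |- fp _ (fun a => cat _ _) => apply: fp_cat
  | |- fp _ (fun a => drop _ _) => apply: fp_drop
  | |- fp _ (fun a => nth false _ _) => apply: fp_nth
  | |- fp _ (fun a => mkseq _ _) => apply: fp_mkseq
  | |- fp _ (fun a => nseq _ true) => apply: fp_nseq
  | |- fp _ (fun a => index false _) => apply: fp_index
  | |- fp _ (fun a => false \in _) => apply: fp_index_mem
  end.

(** * Binary arithmetic *)

Lemma size_binary_le v k : (size (binary v) <= k) = (v < 2 ^ k).
Proof.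
rewrite size_mkseq; apply/idP/idP => [h|]; last exact: up_log_min.
by apply: leq_trans (up_logP v.+1 (isT : 1 < 2)) _; rewrite leq_exp2l.
Qed.

Lemma binary_step v : binary v = if v == 0 then [::] else odd v :: binary v./2.
Proof.
case: eqP => [->|/eqP v0]; first by rewrite /binary up_log1.
rewrite /binary up_log2S ?lt0n // /mkseq /= expn0 divn1; congr (_ :: _).
rewrite (iotaDl 1 0) -map_comp; apply: eq_map => i /=.
by rewrite add1n expnS divnMA divn2.
Qed.

Lemma binary_eq0 v : nilp (binary v) = (v == 0).
Proof. by rewrite binary_step; case: eqP. Qed.

Lemma size_binary_mono v w : v <= w -> size (binary v) <= size (binary w).
Proof.
by move=> h; rewrite size_binary_le (leq_ltn_trans h) // -size_binary_le.
Qed.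

Lemma ltn_size_binary v : v < 2 ^ size (binary v).
Proof. by rewrite -size_binary_le. Qed.

(* [horner2 w] is the number with binary digits [w], most significant first. *)
Definition horner2 (w : word) : nat := foldl (fun x (b : bool) => b + x.*2) 0 w.

Lemma horner2_rcons w b : horner2 (rcons w b) = b + (horner2 w).*2.
Proof. exact: foldl_rcons. Qed.

Lemma horner2_lt w : horner2 w < 2 ^ size w.
Proof.
elim/last_ind: w => // w b IH; rewrite horner2_rcons size_rcons expnS.
by case: b; lia.
Qed.

Lemma horner2_cons b w : horner2 (b :: w) = b * 2 ^ size w + horner2 w.
Proof.
elim/last_ind: w => [|w c IH]; first by case: b.
rewrite -rcons_cons !horner2_rcons IH size_rcons expnS; lia.
Qed.

Lemma horner2_cat v w : horner2 (v ++ w) = horner2 v * 2 ^ size w + horner2 w.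
Proof.
elim/last_ind: w => [|w c IH]; first by rewrite cats0 muln1 addn0.
rewrite -rcons_cat !horner2_rcons IH size_rcons expnS; lia.
Qed.

Lemma horner2_binary v : horner2 (rev (binary v)) = v.
Proof.
have [n] := ubnP v; elim: n v => // n IH v hv; rewrite binary_step.
case: eqP => [->//|/eqP v0]; rewrite rev_cons horner2_rcons IH.
  by rewrite odd_double_half.
by have := odd_double_half v; case: (v) v0 hv => // v' _; lia.
Qed.

(** The wrapper selects the binary code, since [nat] itself is coded in unary. *)
Record bnat := Bnat { bval : nat }.

Canonical code_bnat := @Code bnat 1 (fun x => [:: binary (bval x)]) (fun=> erefl).

Lemma sz_bnat x : sz (Bnat x) = size (binary x).
Proof. by rewrite /sz big_seq1. Qed.

Section Binary.

Variable O : oracle.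

Notation fp := (fp O).

Lemma fp_bnat1 (A : code) (x : A -> nat) : fp (fun a => binary (x a)) <-> fp (fun a => Bnat (x a)).
Proof.
split=> [/fp_to1 H [|//] _|/(_ 0 isT) H]; first by apply: fp1_ext H.
by apply: fp_of1; apply: fp1_ext H.
Qed.

Section Unary.

Variables (A : code) (x : A -> nat).

Hypothesis Hx : fp (fun a => Bnat (x a)).

Lemma fp_bhalf : fp (fun a => Bnat (x a)./2).
Proof.
apply/fp_bnat1; apply: (fp_ext (f := fun a => behead (binary (x a)))).
  by move=> a; rewrite (binary_step (x a)); case: eqP => // ->; rewrite binary_step.
by apply: fp_behead; apply/fp_bnat1.
Qed.

Lemma fp_bodd : fp (fun a => odd (x a)).
Proof.
apply: (fp_ext (f := fun a => head false (binary (x a)))).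
  by move=> a; rewrite (binary_step (x a)); case: eqP => // ->.
by apply: fp_head; apply/fp_bnat1.
Qed.

Lemma fp_bdouble (b : A -> bool) : fp b -> fp (fun a => Bnat (b a + (x a).*2)).
Proof.
move=> Hb; apply/fp_bnat1.
apply: (fp_ext (f := fun a => if ~~ b a && nilp (binary (x a)) then [::]
                             else b a :: binary (x a))).
  move=> a; rewrite binary_eq0 [RHS]binary_step addn_eq0 eqb0 double_eq0.
  by case: ifP => // _; rewrite oddD odd_double addbF oddb half_bit_double.
by have /fp_bnat1 H := Hx; fp_auto.
Qed.

End Unary.

Lemma fp_bval (A : code) (x : A -> bnat) : fp x -> fp (fun a => Bnat (bval (x a))).
Proof. by apply: fp_ext => a; case: (x a). Qed.

Ltac fp_user ::= lazymatch goal with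
  | |- fp (fun a => catrev _ _) => apply: fp_catrev
  | |- fp (fun a => rev _) => apply: fp_rev
  | |- fp (fun a => cat _ _) => apply: fp_cat
  | |- fp (fun a => drop _ _) => apply: fp_drop
  | |- fp (fun a => nth false _ _) => apply: fp_nth
  | |- fp (fun a => mkseq _ _) => apply: fp_mkseq
  | |- fp (fun a => nseq _ true) => apply: fp_nseq
  | |- fp (fun a => index false _) => apply: fp_index
  | |- fp (fun a => false \in _) => apply: fp_index_mem
  | |- fp (fun a => binary _) => apply/fp_bnat1
  | |- fp (fun a => odd _) => apply: fp_bodd
  | |- fp (fun a => Bnat (bval _)) => apply: fp_bval
  | |- fp (fun a => Bnat _./2) => apply: fp_bhalf
  | |- fp (fun a => Bnat (nat_of_bool _ + _.*2)) => apply: fp_bdouble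
  end.

Lemma fp_horner2 (A : code) (w : A -> word) : fp w -> fp (fun a => Bnat (horner2 (w a))).
Proof.
move=> Hw; apply: (fp_ext (f := fun a => foldl (fun x (b : bool) => Bnat (b + (bval x).*2)) (Bnat 0) (w a))).
  move=> a; elim/last_ind: (w a) => // w' b IH.
  by rewrite foldl_rcons IH horner2_rcons.
apply: (fp_fold_grow (F := fun _ x (b : bool) => Bnat (b + (bval x).*2)) (T := fun=> 1)) => //.
- by fp_auto.
- by fp_auto.
- exact: pb_const.
move=> a [x] c /=; rewrite !sz_bnat size_binary_le expnD expn1.
by have := ltn_size_binary x; case: c; lia.
Qed.

(** Schoolbook subtraction, one digit per step, with the borrow in the state. Output digits pile up
    with the most significant on top, as [horner2] expects; the final borrow decides the
    comparison. *)
Definition sub_step (s : (bnat * bnat) * (bool * word)) : (bnat * bnat) * (bool * word) :=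
  let ox := odd (bval s.1.1) in let oy := odd (bval s.1.2) in
  ((Bnat (bval s.1.1)./2, Bnat (bval s.1.2)./2),
   (nat_of_bool ox < oy + s.2.1, (ox != (oy != s.2.1)) :: s.2.2)).

Lemma sub_stepP x y i :
  let s := iter i sub_step ((Bnat x, Bnat y), (false, [::])) in
  [/\ s.1 = (Bnat (x %/ 2 ^ i), Bnat (y %/ 2 ^ i)), size s.2.2 = i &
      x %% 2 ^ i + s.2.1 * 2 ^ i = y %% 2 ^ i + horner2 s.2.2].
Proof.
have modS z j : z %% 2 ^ j.+1 = odd (z %/ 2 ^ j) * 2 ^ j + z %% 2 ^ j.
  have := divn_eq z (2 ^ j.+1); have := divn_eq z (2 ^ j).
  have := odd_double_half (z %/ 2 ^ j).
  rewrite -divn2 -divnMA -expnSr expnS.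
  by move: (z %/ _) (odd _) => q []; move: (z %/ _) => q'; nia.
elim: i => [|i /=]; first by rewrite !expn0 !divn1 !modn1.
case: (iter i _ _) => [[[x'] [y']] [br out]] /= [[-> ->] <- e].
rewrite /sub_step /= expnSr !divnMA !divn2 -expnSr; split=> //.
rewrite horner2_cons !modS expnS; move: e.
by case: (odd _); case: (odd _); case: br => /=; lia.
Qed.

Definition sub_loop (x y : bnat) :=
  iter (size (binary (bval x)) + size (binary (bval y))) sub_step
    ((x, y), (false, [::])).

Lemma sub_loopP x y :
  let s := (sub_loop (Bnat x) (Bnat y)).2 in
  s.1 = (x < y) /\ (~~ s.1 -> horner2 s.2 = x - y).
Proof.
rewrite /sub_loop; set k := _ + _; have := sub_stepP x y k.
case: (iter _ _ _) => [_ [br out]] /= [_ so].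
have hx : x < 2 ^ k.
  by apply: leq_trans (ltn_size_binary x) _; rewrite leq_exp2l // leq_addr.
have hy : y < 2 ^ k.
  by apply: leq_trans (ltn_size_binary y) _; rewrite leq_exp2l // leq_addl.
have := horner2_lt out; rewrite so !modn_small // => hout.
by case: br => /= e; split=> //; lia.
Qed.

Lemma fp_sub_loop (A : code) (x y : A -> bnat) :
  fp x -> fp y -> fp (fun a => sub_loop (x a) (y a)).
Proof.
move=> Hx Hy.
apply: (fp_iter (F := fun _ => sub_step)
  (T := fun a => sz (x a) + sz (y a) + 1 + (sz (x a) + sz (y a)))).
- by fp_auto.
- by fp_auto.
- by rewrite /sub_step; fp_auto.
- by do ?[apply: pb_add | apply: pb_const | exact: (fp_sz Hx) | exact: (fp_sz Hy)].
move=> a k; case: (x a) => x'; case: (y a) => y'; rewrite !sz_bnat /= => hk.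
have := sub_stepP x' y' k; case: (iter _ _ _) => [[u v] [br out]] /= [[-> ->] so _].
rewrite !sz_pair /= !sz_bnat sz_bool sz_word so.
have := size_binary_mono (leq_div x' (2 ^ k)).
by have := size_binary_mono (leq_div y' (2 ^ k)); lia.
Qed.

Ltac fp_sub_user := lazymatch goal with
  | |- fp (fun a => sub_loop _ _) => apply: fp_sub_loop
  | |- fp (fun a => Bnat (horner2 _)) => apply: fp_horner2
  | |- _ => fp_step
  end.

Definition bleq (x y : bnat) := bval x <= bval y.

Section Operations.

Variables (A : code) (x y : A -> nat).
Hypotheses (Hx : fp (fun a => Bnat (x a))) (Hy : fp (fun a => Bnat (y a))).

Lemma fp_bleq : fp (fun a => bleq (Bnat (x a)) (Bnat (y a))).
Proof.
apply: (fp_ext (f := fun a => ~~ (sub_loop (Bnat (y a)) (Bnat (x a))).2.1)).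
  by move=> a; case: (sub_loopP (y a) (x a)) => ->; rewrite -leqNgt.
by repeat (cbv beta zeta; try assumption; fp_sub_user).
Qed.

Lemma fp_bsub : fp (fun a => Bnat (x a - y a)).
Proof.
apply: (fp_ext (f := fun a => let s := (sub_loop (Bnat (x a)) (Bnat (y a))).2 in
   if s.1 then Bnat 0 else Bnat (horner2 s.2))).
  move=> a /=; have [/= e h] := sub_loopP (x a) (y a).
  rewrite e; case: ltnP => c; first by congr Bnat; lia.
  by rewrite h // e -leqNgt.
by repeat (cbv beta zeta; try assumption; fp_sub_user).
Qed.

End Operations.

Lemma fp_bexp2 (A : code) (n : A -> nat) : fp n -> fp (fun a => Bnat (2 ^ n a)).
Proof.
move=> Hn.
apply: (fp_ext (f := fun a => iter (n a) (fun x => Bnat (false + (bval x).*2)) (Bnat 1))).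
  by move=> a; elim: (n a) => //= k ->; rewrite add0n expnS mul2n.
apply: (fp_iter (F := fun _ x => Bnat (false + (bval x).*2)) (T := fun a => (n a).+1)) => //.
- by fp_auto.
- by fp_auto.
- by apply: (@fp_pb O); fp_auto.
move=> a k hk; have -> : iter k (fun x => Bnat (false + (bval x).*2)) (Bnat 1) = Bnat (2 ^ k).
  by elim: (k) => //= i ->; rewrite add0n expnS mul2n.
by rewrite sz_bnat size_binary_le ltn_exp2l.
Qed.

Lemma fp_badd (A : code) (x y : A -> nat) :
  fp (fun a => Bnat (x a)) -> fp (fun a => Bnat (y a)) -> fp (fun a => Bnat (x a + y a)).
Proof.
(* Addition is reduced to subtraction: with a power of two [B] above the sum,
   [x + y = B - (B - x - y)] involves no truncation. *)
move=> Hx Hy; pose k a := (size (binary (x a)) + size (binary (y a))).+1.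
apply: (fp_ext (f := fun a => Bnat (2 ^ k a - (2 ^ k a - x a - y a)))).
  move=> a; congr Bnat; rewrite /k; have := ltn_size_binary (x a).
  have := ltn_size_binary (y a); set i := size _; set j := size _ => hi hj.
  have h1 : 2 ^ i <= 2 ^ (j + i) by rewrite leq_exp2l // leq_addl.
  have h2 : 2 ^ j <= 2 ^ (j + i) by rewrite leq_exp2l // leq_addr.
  by rewrite expnS; lia.
have Hk : fp k by rewrite /k; fp_auto.
by do ?[apply: fp_bsub | apply: fp_bexp2].
Qed.

Lemma fp_bmul (A : code) (x y : A -> nat) :
  fp (fun a => Bnat (x a)) -> fp (fun a => Bnat (y a)) -> fp (fun a => Bnat (x a * y a)).
Proof.
move=> Hx Hy.
pose F a (z : bnat) (b : bool) := Bnat ((if b then y a else 0) + (false + (bval z).*2)).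
have FE a w : foldl (F a) (Bnat 0) w = Bnat (horner2 w * y a).
  elim/last_ind: w => // w b IH; rewrite foldl_rcons IH horner2_rcons /F /=.
  by congr Bnat; case: b; lia.
apply: (fp_ext (f := fun a => foldl (F a) (Bnat 0) (rev (binary (x a))))).
  by move=> a; rewrite FE horner2_binary.
apply: (fp_fold (F := F) (T := fun a => sz (Bnat (x a)) + sz (Bnat (y a)))).
- by fp_auto.
- by fp_auto.
- apply: fp_badd; last by fp_auto.
  apply: (fp_ext (f := fun p => if p.2.2 then Bnat (y p.1) else Bnat 0)).
    by move=> p; case: ifP.
  by fp_step; [fp_auto | apply: (fp_comp Hy); fp_auto | fp_auto].
- by apply: pb_add; [exact: (fp_sz Hx) | exact: (fp_sz Hy)].
move=> a l1 l2 e; rewrite FE !sz_bnat size_binary_le expnD.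
apply: (@leq_ltn_trans (x a * y a)).
  rewrite leq_mul2r; apply/orP; right.
  rewrite -[x a]horner2_binary e horner2_cat.
  by apply: leq_trans (leq_addr _ _); rewrite leq_pmulr // expn_gt0.
have := ltn_size_binary (x a); have := ltn_size_binary (y a).
by move: (2 ^ _) (2 ^ _) => q p; nia.
Qed.

(** Long division from the most significant digit. Since the remainder [r] is below the divisor,
    [b + 2 r] is below twice the divisor, so each digit needs at most one subtraction. *)
Lemma fp_bdivmod (A : code) (x y : A -> nat) :
  fp (fun a => Bnat (x a)) -> fp (fun a => Bnat (y a)) -> (forall a, 0 < y a) ->
  fp (fun a => (Bnat (x a %/ y a), Bnat (x a %% y a))).
Proof.
move=> Hx Hy y0.
pose F a (s : bnat * bnat) (b : bool) := let r := Bnat (b + (bval s.2).*2) in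
  if bleq (Bnat (y a)) r then (Bnat (true + (bval s.1).*2), Bnat (bval r - y a))
  else (Bnat (false + (bval s.1).*2), r).
have FE a w : foldl (F a) (Bnat 0, Bnat 0) w =
    (Bnat (horner2 w %/ y a), Bnat (horner2 w %% y a)).
  elim/last_ind: w => [|w b IH]; first by rewrite div0n mod0n.
  rewrite foldl_rcons IH horner2_rcons /F /bleq /=.
  set h := horner2 w; have eh := divn_eq h (y a); have rh := ltn_pmod h (y0 a).
  case: leqP => c.
    have -> : b + h.*2 = (true + (h %/ y a).*2) * y a + (b + (h %% y a).*2 - y a).
      by rewrite {1}eh; move: (h %/ _) (h %% _) c => q r c; nia.
    have small : b + (h %% y a).*2 - y a < y a by case: b {c}; lia.
    by rewrite divnMDl // modnMDl (divn_small small) (modn_small small) addn0.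
  have -> : b + h.*2 = (h %/ y a).*2 * y a + (b + (h %% y a).*2).
    by rewrite {1}eh; move: (h %/ _) (h %% _) => q r; nia.
  by rewrite divnMDl // modnMDl (divn_small c) (modn_small c) addn0.
apply: (fp_ext (f := fun a => foldl (F a) (Bnat 0, Bnat 0) (rev (binary (x a))))).
  by move=> a; rewrite FE horner2_binary.
apply: (fp_fold (F := F) (T := fun a => sz (Bnat (x a)) + sz (Bnat (x a)))).
- by fp_auto.
- by fp_auto.
- have Hy' : fp (fun p : A * ((bnat * bnat) * bool) => Bnat (y p.1)).
    by apply: (fp_comp Hy); fp_auto.
  by rewrite /F; repeat (cbv beta zeta; try assumption; lazymatch goal with
     | |- fp (fun a => bleq (Bnat _) (Bnat _)) => apply: fp_bleq
     | |- fp (fun a => Bnat (_ - _)) => apply: fp_bsub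
     | |- _ => fp_step end).
- by apply: pb_add; exact: (fp_sz Hx).
move=> a l1 l2 e; rewrite FE sz_pair !sz_bnat /=.
have h : horner2 l1 <= x a.
  rewrite -[x a]horner2_binary e horner2_cat.
  by apply: leq_trans (leq_addr _ _); rewrite leq_pmulr // expn_gt0.
by apply: leq_add; apply: size_binary_mono; apply: leq_trans h;
  [apply: leq_div | apply: leq_mod].
Qed.

Lemma fp_bdiv (A : code) (x y : A -> nat) :
  fp (fun a => Bnat (x a)) -> fp (fun a => Bnat (y a)) -> (forall a, 0 < y a) ->
  fp (fun a => Bnat (x a %/ y a)).
Proof. by move=> Hx Hy y0; exact: fp_fst (fp_bdivmod Hx Hy y0). Qed.

Lemma fp_bmod (A : code) (x y : A -> nat) :
  fp (fun a => Bnat (x a)) -> fp (fun a => Bnat (y a)) -> (forall a, 0 < y a) ->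
  fp (fun a => Bnat (x a %% y a)).
Proof. by move=> Hx Hy y0; exact: fp_snd (fp_bdivmod Hx Hy y0). Qed.

End Binary.

Ltac fp_user ::= lazymatch goal with
  | |- fp _ (fun a => catrev _ _) => apply: fp_catrev
  | |- fp _ (fun a => rev _) => apply: fp_rev
  | |- fp _ (fun a => cat _ _) => apply: fp_cat
  | |- fp _ (fun a => drop _ _) => apply: fp_drop
  | |- fp _ (fun a => nth false _ _) => apply: fp_nth
  | |- fp _ (fun a => mkseq _ _) => apply: fp_mkseq
  | |- fp _ (fun a => nseq _ true) => apply: fp_nseq
  | |- fp _ (fun a => index false _) => apply: fp_index
  | |- fp _ (fun a => false \in _) => apply: fp_index_mem
  | |- fp _ (fun a => binary _) => apply/fp_bnat1
  | |- fp _ (fun a => odd _) => apply: fp_bodd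
  | |- fp _ (fun a => Bnat (bval _)) => apply: fp_bval
  | |- fp _ (fun a => Bnat _./2) => apply: fp_bhalf
  | |- fp _ (fun a => Bnat (_ + _)) => apply: fp_badd
  | |- fp _ (fun a => Bnat (_ - _)) => apply: fp_bsub
  | |- fp _ (fun a => Bnat (_ * _)) => apply: fp_bmul
  | |- fp _ (fun a => Bnat (_ %/ _)) => apply: fp_bdiv
  | |- fp _ (fun a => Bnat (_ %% _)) => apply: fp_bmod
  | |- fp _ (fun a => Bnat (2 ^ _)) => apply: fp_bexp2
  end.

Lemma fp_machine O (f : word -> word) : fp O f ->
  exists (M : machine) (p : {poly nat}),
    (~~ allowed O -> oracle_free M) /\
    forall x, computes_within M (answer O) x (f x) p.[size x]%R.
Proof.
move=> /fp_to1 [T [[d hT] sT H]].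
have [||P HP] := H (fun=> 2) 3; [by []|by []|].
(* Register 0 is both input and output. The argument is parked in register 2, via 3, and the result
   returns from 3 to 0 via 4. *)
pose Q := seqp (revp 0 3) (seqp (revp 3 2) (seqp P (seqp (revp 3 4) (revp 4 0)))).
(* The program runs for at most [4 * size x + 5 * T x + 4] steps and the simulation doubles this. *)
exists (sim_machine O Q), (20%:R%:P * ('X + 2%:R%:P) ^+ d.+1)%R; split.
  exact: sim_oracle_free.
move=> x; pose s0 : regs := fun r => if r == 0 then x else [::].
pose s1 : regs := fun r => if r == 2 then x else [::].
have Tx : T x <= (size x).+2 ^ d by rewrite -sz_word.
have [n hn Hn] : runsb O Q s0 ((2 * size x).+1 + ((2 * size x).+1 + (T x +
    ((2 * size (f x)).+1 + (2 * size (f x)).+1)))) (upd s1 0 (f x)).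
  apply: (@runsb_seq _ _ _ _ _ (upd s1 3 (rev x) \o (fun r => if r == 2 then 1 else r))).
    apply: (@runsb_eq O _ _ _ _ _ _ (@runs_rev O 0 3 s0 isT)) => r /=.
    by rewrite /s0 /s1 /upd cats0; do 4?[case: r => [|r] //=].
  apply: (@runsb_seq _ _ _ _ _ s1).
    rewrite -(size_rev x).
    apply: (@runsb_eq O _ _ _ _ _ _ (@runs_rev O 3 2 (upd s1 3 (rev x) \o (fun r => if r == 2 then 1 else r)) isT)) => r.
    by rewrite /= /s0 /s1 /upd /= revK cats0; do 4?[case: r => [|r] //=].
  have e1 : lay 3 s1 [::] = s1.
    by apply: functional_extensionality => r; rewrite /lay /s1; do 4?[case: r => [|r] //=].
  have := HP x s1 erefl; rewrite e1 => HP'.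
  apply: runsb_seq; first by apply: HP' => -[].
  apply: (@runsb_seq _ _ _ _ _ (lay 3 s1 [:: [::]; rev (f x)])).
    apply: (@runsb_eq O _ _ _ _ _ _ (@runs_rev O 3 4 (lay 3 s1 [:: f x]) isT)) => r.
    by rewrite /upd /lay /=; do 5?[case: r => [|r] //=]; rewrite ?cats0 //= nth_nil.
  rewrite -(size_rev (f x)).
  apply: (@runsb_eq O _ _ _ _ _ _ (@runs_rev O 4 0 (lay 3 s1 [:: [::]; rev (f x)]) isT)) => r.
  by rewrite /upd /lay /= revK cats0 /s1; do 5?[case: r => [|r] //=]; rewrite nth_nil.
apply: (@sim_computes O Q x _ n _ Hn).
rewrite !(hornerE, hornerXn) /=.
rewrite !natrE !addn1; have := sT x; move: Tx hn; rewrite expnS.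
have : 0 < (size x).+2 ^ d by rewrite expn_gt0.
move: (_ ^ d) => p; nia.
Qed.

Definition no_oracle := Oracle (fun=> [::]) false.

Lemma fp_poly_time (f : word -> word) : fp no_oracle f -> poly_time f.
Proof. by case/fp_machine => M [p [/(_ isT) h H]]; exists M, p. Qed.

Lemma fp_poly_time_language (L : pred word) :
  fp no_oracle L -> poly_time_language L.
Proof. by move=> /fp_bool1/fp_of1/fp_poly_time. Qed.

Lemma fp_poly_time_computable (f : word -> nat) :
  fp no_oracle (fun x => Bnat (f x)) -> poly_time_computable f.
Proof. by move=> /fp_bnat1/fp_poly_time. Qed.

Lemma fp_turing_reducible (g f : word -> nat) :
  fp (Oracle (fun q => binary (f q)) true) (fun x => Bnat (g x)) ->
  turing_reducible g f.
Proof. by move=> /fp_bnat1/fp_machine [M [p [_ H]]]; exists M, p. Qed.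

(** * Inclusion-exclusion *)

Definition num_free (E X : finType) (inc : E -> {set X}) : nat :=
  #|[set S : {set X} | [forall e, ~~ (inc e \subset S)]]|.

Section InclusionExclusion.

Local Open Scope ring_scope.

Variables (R : comNzRingType) (E X : finType) (inc : E -> {set X}).

(** Expand the product over [e] of [1 - [inc e \subset S]] and exchange the sums: for a chosen set
    [F] of edges, the sets [S] containing their union number 2 to the number of uncovered
    vertices. *)
Lemma num_free_sum :
  (num_free inc)%:R = \sum_(F : {ffun E -> bool})
    (\prod_e (if F e then -1 else 1)) *
    \prod_x (if [exists e, F e && (x \in inc e)] then 1 else 2) :> R.
Proof.
rewrite /num_free -sum1_card natr_sum big_mkcond /=.
have -> : \sum_(S : {set X}) (if S \in [set S : {set X} | [forall e, ~~ (inc e \subset S)]]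
      then 1%:R else 0 : R) =
    \sum_(S : {set X}) \prod_e \sum_(b : bool) (if b then - (inc e \subset S)%:R else 1).
  apply: eq_bigr => S _; rewrite inE; case: forallP => [H|H].
    by rewrite big1 // => e _; rewrite big_bool /= (negbTE (H e)) oppr0 add0r.
  have [e he] : exists e, inc e \subset S.
    by apply/existsP; apply: contra_notT H; rewrite negb_exists => /forallP.
  by rewrite (bigD1 e) //= big_bool /= he addNr mul0r.
under [LHS]eq_bigr do rewrite bigA_distr_bigA.
rewrite exchange_big /=; apply: eq_bigr => F _.
have -> : \prod_x (if [exists e, F e && (x \in inc e)] then 1 else 2) =
    \prod_x \sum_(b : bool) (if [exists e, F e && (x \in inc e)] then b%:R else 1 : R).
  by apply: eq_bigr => x _; rewrite big_bool; case: ifP => //= _; rewrite ?addr0.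
rewrite bigA_distr_bigA big_distrr /=.
rewrite (reindex (fun s : {ffun X -> bool} => [set x | s x])) /=; last first.
  exists (fun S : {set X} => [ffun x => x \in S]) => [s _|S _].
    by apply/ffunP => x; rewrite ffunE inE.
  by apply/setP => x; rewrite inE ffunE.
apply: eq_bigr => s _.
have [H|H] := boolP [forall e, F e ==> (inc e \subset [set x | s x])].
  rewrite [X in _ * X]big1 ?mulr1; last first.
    move=> x _; case: existsP => // -[e /andP[Fe xe]].
    have := forallP H e; rewrite Fe => /subsetP /(_ x xe).
    by rewrite inE => ->.
  apply: eq_bigr => e _; case: ifP => // Fe.
  by have := forallP H e; rewrite Fe /= => ->.
have [e] : exists e, ~~ (F e ==> (inc e \subset [set x | s x])).
  by apply/existsP; rewrite -negb_forall.
rewrite negb_imply => /andP[Fe he]; have /subsetPn[x xe] := he.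
rewrite inE => /negbTE sx.
rewrite (bigD1 e) //= Fe (negbTE he) oppr0 mul0r.
rewrite [X in _ * X](bigD1 x) //= sx.
have -> : [exists e0, F e0 && (x \in inc e0)].
  by apply/existsP; exists e; rewrite Fe.
by rewrite mul0r mulr0.
Qed.

End InclusionExclusion.

(** * Chains of spins *)

Section Spins.

Local Open Scope ring_scope.

Variables (C : finType) (nx pi mn : C -> C) (q mu : nat).

(** Each port [c] heads a segment of [q.+1] spins, which is followed by the segment of [nx c]. *)
Definition spin : Type := (C * 'I_q.+1)%type.
Definition svar : Type := (spin * 'I_mu.+2)%type.

Definition next_spin (y : spin) : spin :=
  if insub y.2.+1 is Some k then (y.1, k) else (nx y.1, ord0).

(* Hyperedges are indexed by spins. Every spin [y] owns the variables [(y, i)]: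
   the last one is shared with the next spin of the cycle, and the first one, if
   [y] is a port [(c, 0)], is replaced by that of the representative [mn c] of
   [{c, pi c}]; the others are private. *)
Definition incident (y : spin) (x : svar) : bool :=
  if x.2 == ord_max then (x.1 == y) || (next_spin x.1 == y)
  else if (x.2 == ord0) && (x.1.2 == ord0) then (y.2 == ord0) && (mn y.1 == x.1.1)
  else x.1 == y.

Definition spin_edge (y : spin) : {set svar} := [set x | incident y x].

Variable R : comNzRingType.

(** A spin records whether its edge is chosen in the inclusion-exclusion sum. [bw] and [dw] are the
    weights of a vertex shared by two edges and of a private vertex, [sw] is the sign, and [fw]
    collects all that an interior spin carries by itself. *)
Definition bw (b b' : bool) : R := if b || b' then 1 else 2.
Definition dw (b : bool) : R := if b then 1 else 2.
Definition sw (b : bool) : R := if b then -1 else 1.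
Definition fw (b : bool) : R := sw b * dw b ^+ mu.+1.

Fixpoint chain_weight (b : bool) (u : seq bool) (b' : bool) : R :=
  if u is x :: u' then bw b x * fw x * chain_weight x u' b' else bw b b'.

Lemma chain_weightE b u b' :
  chain_weight b u b' =
  (\prod_(k < (size u).+1) bw (nth false (b :: u) k) (nth b' u k)) *
  \prod_(k < size u) fw (nth false u k).
Proof.
elim: u b => [|x u IH] b /=; first by rewrite big_ord_recl !big_ord0 !mulr1.
by rewrite IH mulrACA [in RHS]big_ord_recl [X in _ = _ * X]big_ord_recl.
Qed.

(** The weight of the port vertex of [c]. Its edges are those of the ports with representative [c]:
    two for the representative of a matched pair, one for an unmatched port, and none otherwise,
    which leaves an isolated vertex of weight 2. *)
Definition ext_weight (s : C -> bool) (c : C) : R :=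
  if [exists c', (mn c' == c) && s c'] then 1 else 2.

Definition of_rows (f : {ffun C -> q.+1.-tuple bool}) : {ffun spin -> bool} :=
  [ffun y : spin => tnth (f y.1) y.2].

Lemma of_rows_bij : bijective of_rows.
Proof.
exists (fun F : {ffun spin -> bool} => [ffun c => [tuple F (c, k) | k < q.+1]]) => f.
  apply/ffunP => c; rewrite ffunE; apply: eq_from_tnth => k.
  by rewrite tnth_mktuple ffunE.
by apply/ffunP => -[c k]; rewrite ffunE /= ffunE tnth_mktuple.
Qed.

(** Every vertex factor is charged to the spin that owns the vertex. A head is treated apart because
    its port vertex is external, so it keeps only [mu] private vertices instead of [mu.+1]. *)
Lemma spin_term (f : {ffun C -> q.+1.-tuple bool}) :
  (\prod_y sw (of_rows f y)) *
  \prod_x (if [exists y, of_rows f y && (x \in spin_edge y)] then 1 else 2) =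
  (\prod_c (sw (thead (f c)) * dw (thead (f c)) ^+ mu *
     chain_weight (thead (f c)) (behead (f c)) (thead (f (nx c))))) *
  \prod_c ext_weight (fun c => thead (f c)) c.
Proof.
set F := of_rows f; pose w x : R := if [exists y, F y && (x \in spin_edge y)] then 1 else 2.
have wE x (P : bool) : (exists y, F y && incident y x) <-> P -> w x = if P then 1 else 2.
  move=> h; rewrite /w; congr (if _ then _ else _); apply/existsP/idP.
    by case=> y hy; apply/h; exists y; rewrite inE in hy.
  by move/h => [y hy]; exists y; rewrite inE.
have w_max y : w (y, ord_max) = bw (F y) (F (next_spin y)).
  apply: wE; split=> [[y'] | /orP[h|h]].
  - by rewrite /incident /= eqxx => /andP[h /orP[]/eqP ->]; rewrite h ?orbT.
  - by exists y; rewrite h /incident /= !eqxx.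
  - by exists (next_spin y); rewrite h /incident /= !eqxx orbT.
have w_mid y i : i != ord_max -> ~~ ((i == ord0) && (y.2 == ord0)) ->
    w (y, i) = dw (F y).
  move=> /negbTE h1 /negbTE h2; apply: wE; split=> [[y']|h].
    by rewrite /incident /= h1 h2 => /andP[h /eqP ->].
  by exists y; rewrite h /incident /= h1 h2 eqxx.
have Fhead c : F (c, ord0) = thead (f c) by rewrite /F ffunE.
have w_ext c : w ((c, ord0), ord0) = ext_weight (fun c => thead (f c)) c.
  apply: wE; split=> [[[c' k]]|/existsP[c' /andP[/eqP h h']]].
    rewrite /incident /= => /and3P[h /eqP hk /eqP hc]; apply/existsP; exists c'.
    by move: h; rewrite hc eqxx /F ffunE /= hk.
  by exists (c', ord0); rewrite Fhead h' /incident /= h eqxx.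
have w_all y : \prod_i w (y, i) = bw (F y) (F (next_spin y)) * dw (F y) ^+ mu *
    (if y.2 == ord0 then ext_weight (fun c => thead (f c)) y.1 else dw (F y)).
  rewrite big_ord_recr big_ord_recl /= w_max [LHS]mulrC -mulrA; congr (_ * _).
  rewrite mulrC; congr (_ * _).
    rewrite (eq_bigr (fun=> dw (F y))) ?prodr_const ?card_ord // => i _.
    by apply: w_mid; rewrite -val_eqE /= ?bump0 // neq_ltn ltnS ltn_ord.
  case: eqP => h.
    by rewrite -w_ext; congr w; congr (_, _); [case: (y) h => c k /= -> | apply: val_inj].
  by apply: w_mid; [rewrite -val_eqE | rewrite negb_and; apply/orP; right; apply/eqP].
rewrite [X in _ * X](_ : _ = \prod_y \prod_i w (y, i)); last first.
  by rewrite pair_bigA; apply: eq_bigr => -[].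
rewrite -big_split /=.
rewrite (_ : \prod_(y : spin) _ = \prod_c \prod_k (sw (F (c, k)) *
   (bw (F (c, k)) (F (next_spin (c, k))) * dw (F (c, k)) ^+ mu *
   (if k == ord0 then ext_weight (fun c => thead (f c)) c else dw (F (c, k))))));
  last by rewrite pair_bigA; apply: eq_bigr => -[c k] _; rewrite w_all.
rewrite -big_split /=; apply: eq_bigr => c _.
rewrite chain_weightE.
have ef : f c = thead (f c) :: behead (f c) :> seq bool by case/tupleP: (f c).
have sb : size (behead (f c)) = q by rewrite size_behead size_tuple.
have e1 : \prod_(k < q.+1) bw (F (c, k)) (F (next_spin (c, k))) =
    \prod_(k < (size (behead (f c))).+1) bw (nth false (thead (f c) :: behead (f c)) k)
      (nth (thead (f (nx c))) (behead (f c)) k).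
  rewrite sb; apply: eq_bigr => k _; rewrite -ef /F !ffunE /= (tnth_nth false).
  congr bw; rewrite /next_spin /=; case: insubP => [k' _ ek'|] /=.
    rewrite (tnth_nth false) ek' nth_behead; apply: set_nth_default.
    by rewrite size_tuple -ek' ltn_ord.
  rewrite -leqNgt => hk; rewrite nth_default //.
  by rewrite sb -ltnS.
have e2 : \prod_(k < size (behead (f c))) fw (nth false (behead (f c)) k) =
    \prod_(k < q) fw (F (c, lift ord0 k)).
  rewrite sb; apply: eq_bigr => k _.
  by rewrite /F ffunE /= (tnth_nth false) nth_behead.
rewrite -e1 e2.
transitivity (\prod_k (bw (F (c, k)) (F (next_spin (c, k))) * (sw (F (c, k)) * dw (F (c, k)) ^+ mu *
    (if k == ord0 then ext_weight (fun c => thead (f c)) c else dw (F (c, k)))))).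
  by apply: eq_bigr => k _; rewrite !mulrA (mulrC (sw _)).
rewrite big_split /= [X in _ * X]big_ord_recl /= Fhead.
rewrite (eq_bigr (fun k => fw (F (c, lift ord0 k)))); last first.
  by move=> k _; rewrite /fw exprSr mulrA.
by rewrite [RHS]mulrAC mulrCA.
Qed.

Definition chain_sum (n : nat) (b b' : bool) : R :=
  \sum_(u : n.-tuple bool) chain_weight b u b'.

Lemma sum_tuple (n : nat) (P : pred bool) (G : n.+1.-tuple bool -> R) :
  \sum_(t : n.+1.-tuple bool | P (thead t)) G t =
  \sum_(x | P x) \sum_(u : n.-tuple bool) G [tuple of x :: u].
Proof.
rewrite pair_big_dep /= (reindex (fun p : bool * n.-tuple bool => [tuple of p.1 :: p.2])) /=.
  by apply: eq_bigl => -[x u]; rewrite theadE andbT.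
exists (fun t : n.+1.-tuple bool => (thead t, [tuple of behead t])) => [[x u] _|t _] /=.
  by rewrite theadE; congr (_, _); apply: val_inj.
by rewrite [RHS]tuple_eta; apply: val_inj.
Qed.

Lemma chain_sumS n b b' :
  chain_sum n.+1 b b' = \sum_x bw b x * fw x * chain_sum n x b'.
Proof.
rewrite /chain_sum (sum_tuple predT); apply: eq_bigr => x _.
by rewrite big_distrr.
Qed.

Lemma chain_sum0 b b' : chain_sum 0 b b' = bw b b'.
Proof.
rewrite /chain_sum (big_pred1 [tuple]) // => u.
by rewrite (tuple0 u) /=; apply/esym/eqP.
Qed.

Let a : nat := (2 ^ mu.+1)%N.

(** The entries of the [n]-th power of the transfer matrix, the diagonal matrix of [fw] times the
    matrix [bw]. *)
Fixpoint transfer (n : nat) (b b' : bool) : R :=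
  if n is n'.+1 then fw b * \sum_x bw b x * transfer n' x b' else (b == b')%:R.

Lemma fw0 : fw false = a%:R.
Proof. by rewrite /fw /sw /dw mul1r natrX. Qed.

Lemma fw1 : fw true = -1.
Proof. by rewrite /fw /sw /dw expr1n mulr1. Qed.

Lemma chain_sum_transfer n b b' : fw b * chain_sum n b b' = transfer n.+1 b b'.
Proof.
elim: n b => [|n IH] b; rewrite [RHS]/=; congr (_ * _).
  rewrite chain_sum0 (bigD1 b') //= eqxx mulr1 big1 ?addr0 // => x /negbTE ->.
  exact: mulr0.
by rewrite chain_sumS; apply: eq_bigr => x _; rewrite -mulrA IH.
Qed.

Lemma transfer_rec n b b' :
  transfer n.+2 b b' = (2 * a - 1)%N%:R * transfer n.+1 b b' + a%:R * transfer n b b'.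
Proof.
have e : (2 * a - 1)%N%:R = 2 * a%:R - 1 :> R.
  by rewrite natrB ?natrM // muln_gt0 expn_gt0.
rewrite e /= !big_bool /bw /= fw0 fw1.
by case: b; rewrite /= ?fw0 ?fw1; ring.
Qed.

End Spins.

(** The pair [(V_n, V_(n+1))] of consecutive companion Lucas numbers for trace [2 a - 1] and
    determinant [- a]. *)
Fixpoint lucas (a n : nat) : nat * nat :=
  if n is n'.+1 then
    let: (x, y) := lucas a n' in (y, (2 * a - 1) * y + a * x)
  else (2, 2 * a - 1).

Lemma lucasS a n : lucas a n.+1 =
  ((lucas a n).2, (2 * a - 1) * (lucas a n).2 + a * (lucas a n).1).
Proof. by rewrite /=; case: (lucas a n). Qed.

Section Spins2.

Local Open Scope ring_scope.

Variables (C : finType) (nx pi mn : C -> C) (q mu : nat) (R : comNzRingType).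

Let a : nat := (2 ^ mu.+1)%N.

(** The Cayley-Hamilton identity for the [l]-th power of the transfer matrix, which has trace [V_l]
    and determinant [(- a) ^ l], stated for any sequence with the same recurrence. Two consecutive
    values of [l] are needed to carry the induction. *)
Lemma lucas_rec (y : nat -> R) l :
  (forall n, y n.+2 = (2 * a - 1)%N%:R * y n.+1 + a%:R * y n) ->
  forall i, (y (i + l.*2)%N + (- a%:R) ^+ l * y i = (lucas a l).1%:R * y (i + l)%N) *
  (y (i + l.+1.*2)%N + (- a%:R) ^+ l.+1 * y i = (lucas a l).2%:R * y (i + l.+1)%N).
Proof.
move=> rec; elim: l => [|l IH] i.
  have e : (i + 1.*2 = i.+2)%N by lia.
  rewrite double0 !addn0 e rec addn1 expr0 expr1 /=.
  by move: (2 * a - 1)%N (a%:R : R) => v t; split; ring.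
(* The identity for [l] at [i.+2] and the one for [l.+1] at [i.+1] have the same centre [i + l.+2];
   combining them by the recurrence of [V] gives the case [l.+2] at [i]. *)
have key (w V0 V1 : R) : y (i.+2 + l.*2)%N + w * y i.+2 = V0 * y (i.+2 + l)%N ->
    y (i.+1 + l.+1.*2)%N + - a%:R * w * y i.+1 = V1 * y (i.+1 + l.+1)%N ->
    y (i + l.+2.*2)%N + - a%:R * (- a%:R * w) * y i =
      ((2 * a - 1)%N%:R * V1 + a%:R * V0) * y (i + l.+2)%N.
  have -> : (i.+2 + l)%N = (i + l.+2)%N by lia.
  have -> : (i.+1 + l.+1)%N = (i + l.+2)%N by lia.
  have -> : (i + l.+2.*2)%N = (i + l.*2).+4%N by lia.
  have -> : (i.+1 + l.+1.*2)%N = (i + l.*2).+3%N by lia.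
  have -> : (i.+2 + l.*2)%N = (i + l.*2).+2%N by lia.
  move=> h0 h1; rewrite mulrDl -!mulrA -h0 -h1 (rec (i + l.*2).+2%N) (rec i).
  by move: ((2 * a - 1)%N%:R : R) (a%:R : R) => v t; ring.
rewrite (IH i).2 lucasS; split=> //.
have := key _ _ _ (IH i.+2).1; rewrite -exprS => /(_ _ (IH i.+1).2).
by rewrite -exprS -!natrM -natrD.
Qed.

(** When [V_l] vanishes, the power [2 l] is the scalar [- (- a) ^ l]; the oddness of [l] makes it
    [a ^ l]. *)
Lemma transfer_lucas l b b' : odd l -> (lucas a l).1%:R = 0 :> R ->
  transfer mu R l.*2 b b' = (a ^ l)%:R * (b == b')%:R.
Proof.
move=> hl hV; have := (lucas_rec l (fun n => transfer_rec mu R n b b') 0).1.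
rewrite hV mul0r !add0n => /eqP; rewrite addr_eq0 => /eqP ->.
by rewrite exprNn -signr_odd hl expr1 /= natrX; ring.
Qed.

End Spins2.

(** * The partition function in a ring where a Lucas number vanishes *)

Section SpinSum.

Local Open Scope ring_scope.

Variables (C U : finType) (nx pi mn : C -> C) (cl : C -> U) (rep : U -> C).
Variables (q mu l : nat) (R : comNzRingType) (h : R).

Let a : nat := (2 ^ mu.+1)%N.

Hypotheses (piK : involutive pi) (mn_or : forall c, mn c = c \/ mn c = pi c)
  (mn_pi : forall c, mn (pi c) = mn c).
Hypotheses (cl_rep : forall u, cl (rep u) = u) (cl_nx : forall c, cl (nx c) = cl c)
  (nx_conn : forall s : C -> bool, (forall c, s c = s (nx c)) ->
     forall c, s c = s (rep (cl c))).
Hypotheses (hq : q.+1 = l.*2) (hl : odd l) (hV : (lucas a l).1%:R = 0 :> R)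
  (h2 : 2 * h = 1).

(** The correction for the private vertex that a head lacks: its weight is [fw] times [hw], with [h]
    an inverse of 2. *)
Let hw (b : bool) : R := if b then 1 else h.

(** Once the heads are fixed the segments are independent. Summing out the [q = 2 l - 1] interior
    spins of one gives an entry of the power [2 l] of the transfer matrix, which forces consecutive
    heads to agree. *)
Lemma head_sum (s : {ffun C -> bool}) :
  \sum_(f : {ffun C -> q.+1.-tuple bool} | [ffun c => thead (f c)] == s)
    (\prod_c (sw R (thead (f c)) * dw R (thead (f c)) ^+ mu *
     chain_weight mu R (thead (f c)) (behead (f c)) (thead (f (nx c))))) *
    \prod_c ext_weight mn R (fun c => thead (f c)) c =
  (\prod_c (hw (s c) * ((a ^ l)%:R * (s c == s (nx c))%:R))) *
  \prod_c ext_weight mn R s c.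
Proof.
pose g c (t : q.+1.-tuple bool) : R := sw R (s c) * dw R (s c) ^+ mu *
  chain_weight mu R (s c) (behead t) (s (nx c)).
transitivity (\sum_(f in family (fun c => [pred t : q.+1.-tuple bool | thead t == s c]))
    (\prod_c g c (f c)) * \prod_c ext_weight mn R s c).
  apply: eq_big => [f|f /eqP es].
    apply/eqP/familyP => [<- c|H]; first by rewrite inE ffunE.
    by apply/ffunP => c; rewrite ffunE; apply/eqP; have := H c; rewrite inE.
  have ef c : thead (f c) = s c by rewrite -es ffunE.
  congr (_ * _); apply: eq_bigr => c _; first by rewrite /g !ef.
  by rewrite /ext_weight; congr (if _ then _ else _); apply: eq_existsb => c' /=; rewrite ef.
rewrite -big_distrl /= -(bigA_distr_big_dep (fun c => [pred t : q.+1.-tuple bool | thead t == s c])).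
congr (_ * _); apply: eq_bigr => c _.
transitivity (\sum_(t : q.+1.-tuple bool | pred1 (s c) (thead t)) g c t); first exact: eq_bigl.
rewrite sum_tuple big_pred1_eq /g -big_distrr /=.
rewrite -(transfer_lucas (s c) (s (nx c)) hl hV) -hq -chain_sum_transfer mulrA.
congr (_ * _); rewrite /hw /fw /sw /dw; case: (s c); rewrite ?expr1n ?mulr1 ?mul1r //.
by rewrite exprS mulrA [h * _]mulrC h2 mul1r.
Qed.

(** An unmatched port contributes 1, as [hw] cancels its vertex. A matched pair contributes
    [hw * hw] times the shared vertex times 2 for the discarded one: [1/4 * 2 * 2], [1/2 * 1 * 2] or
    [1 * 1 * 2] for zero, one or two set heads. Only a pair with both heads set leaves a factor
    2. *)
Lemma ext_prod (s : C -> bool) :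
  \prod_c hw (s c) * \prod_c ext_weight mn R s c =
  2 ^+ #|[set c | [&& mn c == c, pi c != c, s c & s (pi c)]]|.
Proof.
have ext_fix c : pi c = c -> hw (s c) * ext_weight mn R s c = 1.
  move=> hc; rewrite /ext_weight (_ : [exists c', _] = s c).
    by rewrite /hw; case: (s c); rewrite ?mul1r // mulrC.
  apply/existsP/idP => [[c' /andP[/eqP e hs]]|hs].
    suff -> : c = c' by [].
    by case: (mn_or c') => e'; rewrite e' in e; rewrite -e ?piK // -{2}(piK c') e hc.
  by exists c; rewrite hs; case: (mn_or c) => ->; rewrite ?hc eqxx.
have ext_non c : mn c != c -> ext_weight mn R s c = 2.
  move=> hc; rewrite /ext_weight; case: existsP => // -[c' /andP[/eqP e _]].
  case/eqP: hc; case: (mn_or c') => e'; rewrite e' in e; first by rewrite -e e'.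
  by rewrite -e mn_pi e'.
have ext_pair c : mn c = c -> pi c != c ->
    ext_weight mn R s c = if s c || s (pi c) then 1 else 2.
  move=> hc pc; rewrite /ext_weight; congr (if _ then _ else _).
  apply/existsP/orP => [[c' /andP[/eqP e hs]]|[hs|hs]].
  - by case: (mn_or c') => e'; rewrite e' in e; rewrite -e; [left | right; rewrite piK].
  - by exists c; rewrite hc eqxx.
  - by exists (pi c); rewrite mn_pi hc eqxx.
rewrite -big_split /= (bigID (fun c => pi c == c)) /= big1 ?mul1r; last first.
  by move=> c /eqP; apply: ext_fix.
rewrite (bigID (fun c => mn c == c)) /=.
rewrite [X in _ * X](reindex_inj (inv_inj piK)) /=.
rewrite [X in _ * X](eq_bigl (fun c => (pi c != c) && (mn c == c))); last first.
  move=> c; rewrite piK mn_pi eq_sym; case: (eqVneq (pi c) c) => //= pc.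
  by case: (mn_or c) => ->; rewrite eqxx; [rewrite eq_sym pc | rewrite (negbTE pc)].
rewrite -big_split /= -sum1_card expr_sum /= big_mkcond [RHS]big_mkcond /=.
apply: eq_bigr => c _; rewrite inE; case: (eqVneq (pi c) c) => /= pc.
  by rewrite andbF.
case: (eqVneq (mn c) c) => //= hc.
rewrite ext_pair // ext_non; last by rewrite mn_pi hc eq_sym.
rewrite /hw expr1.
case: (s c) => /=; case: (s (pi c)) => /=; rewrite ?mul1r ?mulr1 // [h * 2]mulrC h2 ?mulr1 //.
Qed.

(** Only head configurations constant along [nx] survive, so each class of [cl] acts as one spin,
    and every segment contributes [a ^ l]. *)
Theorem num_free_spin :
  (num_free (@spin_edge C nx mn q mu))%:R = (a ^ (l * #|C|))%:R *
  \sum_(S : {ffun U -> bool})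
    2 ^+ #|[set c | [&& mn c == c, pi c != c, S (cl c) & S (cl (pi c))]]| :> R.
Proof.
rewrite num_free_sum (reindex (@of_rows C q)); last exact: onW_bij (of_rows_bij _ _).
under eq_bigr do rewrite spin_term.
rewrite (partition_big (fun f : {ffun C -> q.+1.-tuple bool} => [ffun c => thead (f c)]) predT) //=.
rewrite (eq_bigr _ (fun s _ => head_sum s)).
rewrite (bigID (fun s : {ffun C -> bool} => [forall c, s c == s (nx c)])) /=.
rewrite [X in _ + X]big1 ?addr0; last first.
  move=> s; rewrite negb_forall => /existsP[c hc].
  by rewrite (bigD1 c) //= (negbTE hc) !mulr0 !mul0r.
rewrite (reindex (fun S : {ffun U -> bool} => [ffun c => S (cl c)])); last first.
  exists (fun s : {ffun C -> bool} => [ffun u => s (rep u)]) => [S _|s].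
    by apply/ffunP => u; rewrite !ffunE cl_rep.
  rewrite inE => /forallP H; apply/ffunP => c; rewrite !ffunE.
  by apply/esym/nx_conn => c'; apply/eqP.
rewrite big_distrr /=; apply: eq_big => [S|S _].
  by apply/forallP => c; rewrite !ffunE cl_nx.
rewrite (eq_bigr (fun c => (a ^ l)%:R * hw (S (cl c)))); last first.
  by move=> c _; rewrite !ffunE cl_nx eqxx mulr1 mulrC.
rewrite big_split /= prodr_const -natrX -expnM -mulrA; congr (_ * _).
rewrite -(ext_prod (fun c => S (cl c))); congr (_ * _).
apply: eq_bigr => c _; rewrite /ext_weight; congr (if _ then _ else _).
by apply: eq_existsb => c' /=; rewrite ffunE.
Qed.

End SpinSum.

(** * Hypergraphs given by incidence matrices *)

Lemma num_independent_family (E X : finType) (inc : E -> {set X}) :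
  num_independent (@Hypergraph X [set inc e | e : E]) = num_free inc.
Proof.
apply: eq_card => S; rewrite !inE; apply/forall_inP/forallP => [H e|H _ /imsetP[e _ ->]] //.
exact/H/imset_f.
Qed.

(** A maximum equals [Delta] when it is a bound that is attained; the disjunct [Delta == 0] covers
    the hypergraph without vertices. *)
Lemma in_class_family m Delta (E X : finType) (inc : E -> {set X}) :
  injective inc ->
  in_class m Delta (@Hypergraph X [set inc e | e : E]) =
  [&& [forall e, #|inc e| == m], [forall x, #|[set e | x \in inc e]| <= Delta] &
      (Delta == 0) || [exists x, #|[set e | x \in inc e]| == Delta]].
Proof.
move=> inj; rewrite /in_class; congr andb.
  apply/forall_inP/forallP => [H e|H _ /imsetP[e _ ->]] //.
  exact/H/imset_f.
have deg x : degree (H := @Hypergraph X [set inc e | e : E]) x = #|[set e | x \in inc e]|.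
  rewrite /degree /= -(card_imset _ inj); apply: eq_card => S; rewrite !inE.
  apply/andP/imsetP => [[/imsetP[e _ ->] h]|[e]]; first by exists e => //; rewrite inE.
  by rewrite inE => h ->; split=> //; apply: imset_f.
rewrite /max_degree; under eq_bigr do rewrite deg.
apply/eqP/andP => [<-|[/forallP h1 h2]].
  split; first by apply/forallP => x; apply: leq_bigmax.
  case: (posnP (\max_x #|[set e | x \in inc e]|)) => [->//|h].
  have X0 : 0 < #|X|.
    by rewrite lt0n; apply: contraL h => /eqP/card0_eq h0; rewrite big1 // => x; have := h0 x.
  have [x ->] := eq_bigmax (fun x => #|[set e | x \in inc e]|) X0.
  by apply/orP; right; apply/existsP; exists x.
apply/eqP; rewrite eqn_leq; apply/andP; split; first exact/bigmax_leqP.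
case/orP: h2 => [/eqP -> //|/existsP[x /eqP <-]]; exact: leq_bigmax.
Qed.

Definition row_family (k n : nat) (I : nat -> nat -> bool) (e : 'I_k) : {set 'I_n} :=
  [set x : 'I_n | I e x].

(** The class is phrased by row sums, column sums and quantifiers over initial segments, the form
    that the closure rules accept. *)
Definition valid_rows (m Delta k n : nat) (I : nat -> nat -> bool) : bool :=
  [&& all (fun i => all (fun j => has (fun x => ~~ (I i x == I j x)) (iota 0 n)) (iota 0 i))
          (iota 0 k),
      all (fun i => \sum_(0 <= x < n) I i x == m) (iota 0 k),
      all (fun x => \sum_(0 <= i < k) I i x <= Delta) (iota 0 n) &
      (Delta == 0) || has (fun x => \sum_(0 <= i < k) I i x == Delta) (iota 0 n)].

Lemma all_iotaP n (P : nat -> bool) : reflect (forall i, i < n -> P i) (all P (iota 0 n)).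
Proof.
by apply: (iffP allP) => H i; have := H i; rewrite mem_iota add0n.
Qed.

Lemma all_iota_ord n (P : nat -> bool) : all P (iota 0 n) = [forall i : 'I_n, P i].
Proof. by apply/all_iotaP/forallP => H i; [apply: H | move=> h; apply: (H (Ordinal h))]. Qed.

Lemma has_iota_ord n (P : nat -> bool) : has P (iota 0 n) = [exists i : 'I_n, P i].
Proof.
apply/hasP/existsP => [[i]|[i h]]; last by exists (val i); rewrite ?mem_iota ?ltn_ord.
by rewrite mem_iota => /= hi h; exists (Ordinal hi).
Qed.

Lemma valid_rowsE m Delta k n I (inc := @row_family k n I) :
  valid_rows m Delta k n I = injectiveb inc &&
    in_class m Delta (@Hypergraph 'I_n [set inc e | e : 'I_k]).
Proof.
have card_row (e : 'I_k) : #|inc e| = \sum_(x < n) I e x.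
  by rewrite -sum1_card big_mkcond; apply: eq_bigr => x _; rewrite inE; case: (I e x).
have card_col (x : 'I_n) : #|[set e | x \in inc e]| = \sum_(i < k) I i x.
  by rewrite -sum1_card big_mkcond; apply: eq_bigr => e _; rewrite !inE; case: (I e x).
have neqP (e e' : 'I_k) : has (fun x => ~~ (I e x == I e' x)) (iota 0 n) = (inc e != inc e').
  rewrite has_iota_ord -negb_forall; congr negb; apply/forallP/eqP => [H|H x].
    by apply/setP => x; rewrite !inE; apply/eqP.
  by move/setP: H => /(_ x); rewrite !inE => ->.
have Einj : injectiveb inc = all (fun i => all (fun j => has (fun x => ~~ (I i x == I j x)) (iota 0 n))
    (iota 0 i)) (iota 0 k).
  apply/injectiveP/all_iotaP => [inj i hi|H e e' he].
    apply/all_iotaP => j hj; have hjk := ltn_trans hj hi.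
    rewrite (neqP (Ordinal hi) (Ordinal hjk)); apply/eqP => /inj [] e.
    by rewrite e ltnn in hj.
  apply: val_inj; wlog: e e' he / e <= e'.
    by move=> W; case/orP: (leq_total e e') => h; [|apply/esym]; apply: W.
  rewrite leq_eqVlt => /orP[/eqP //|hlt].
  have /all_iotaP/(_ _ hlt) := H e' (ltn_ord e').
  by rewrite neqP he eqxx.
rewrite /valid_rows -Einj; case: injectiveP => //= inj; rewrite in_class_family //.
congr [&& _, _ & _ || _].
- by rewrite all_iota_ord; apply: eq_forallb => e; rewrite card_row big_mkord.
- by rewrite all_iota_ord; apply: eq_forallb => x; rewrite card_col big_mkord.
- by rewrite has_iota_ord; apply: eq_existsb => x; rewrite card_col big_mkord.
Qed.

Definition num_vertices (w : word) : nat := index false w.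
Definition rows_word (w : word) : word := drop (num_vertices w).+1 w.
Definition num_edges (w : word) : nat := size (rows_word w) %/ num_vertices w.
Definition entry (w : word) (i j : nat) : bool :=
  nth false (rows_word w) (i * num_vertices w + j).

Definition valid_word (m Delta : nat) (w : word) : bool :=
  [&& false \in w, num_vertices w %| size (rows_word w) &
      valid_rows m Delta (num_edges w) (num_vertices w) (entry w)].

Lemma count_independentE m Delta w :
  count_independent m Delta w =
  if valid_word m Delta w
  then num_free (@row_family (num_edges w) (num_vertices w) (entry w)) else 0.
Proof.
rewrite /count_independent /valid_word valid_rowsE /decode.
cbv zeta; rewrite -/(num_vertices w) -/(rows_word w) -/(num_edges w).
set n := num_vertices w; set u := rows_word w; set k := num_edges w.
set inc := @row_family k n (entry w).
have -> : [seq [set i : 'I_n | nth false r i] | r <- reshape (nseq k n) u] =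
    [seq inc e | e <- enum 'I_k].
  apply: (@eq_from_nth _ set0).
    by rewrite size_map size_reshape size_nseq [RHS]size_map size_enum_ord.
  rewrite size_map size_reshape size_nseq => i hi.
  rewrite (nth_map [::]) ?size_reshape ?size_nseq //.
  rewrite (nth_map (Ordinal hi)) ?size_enum_ord //; apply/setP => x; rewrite !inE.
  rewrite nth_reshape nth_nseq hi take_nseq ?(ltnW hi) // sumn_nseq.
  by rewrite nth_take // nth_drop nth_enum_ord // /entry mulnC.
case: (false \in w) => //=; case: (_ %| _) => //=.
rewrite -[uniq _]/(injectiveb inc); case: ifP => //= _.
have -> : [set e in [seq inc e | e <- enum 'I_k]] = [set inc e | e : 'I_k].
  apply/setP => e; rewrite inE; apply/mapP/imsetP => [[x _ ->]|[x _ ->]]; first by exists x.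
  by exists x => //; rewrite mem_enum.
by case: ifP => // _; rewrite num_independent_family.
Qed.

Definition word_of_rows (k n : nat) (I : nat -> nat -> bool) : word :=
  nseq n true ++ false :: mkseq (fun z => I (z %/ n) (z %% n)) (k * n).

(** For [n = 0] the word could not show the number of rows, which is read off by dividing a length
    by [n]. *)
Lemma count_independent_rows m Delta k n I : 0 < n -> valid_rows m Delta k n I ->
  count_independent m Delta (word_of_rows k n I) = num_free (@row_family k n I).
Proof.
move=> n0 hv; have en : num_vertices (word_of_rows k n I) = n.
  by rewrite /num_vertices /word_of_rows; move: (mkseq _ _) => v; elim: (n) => //= n' ->.
have eu : rows_word (word_of_rows k n I) = mkseq (fun z => I (z %/ n) (z %% n)) (k * n).
  by rewrite /rows_word en /word_of_rows -cat_rcons drop_size_cat // size_rcons size_nseq.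
have ek : num_edges (word_of_rows k n I) = k.
  by rewrite /num_edges eu en size_mkseq mulnK.
have ee i j : i < k -> j < n -> entry (word_of_rows k n I) i j = I i j.
  move=> hi hj; rewrite /entry en eu nth_mkseq; last by nia.
  by rewrite divnMDl // modnMDl divn_small // modn_small // addn0.
have eI : row_family n (entry (word_of_rows k n I)) =1 row_family n I :> ('I_k -> {set 'I_n}).
  by move=> e; apply/setP => x; rewrite !inE ee.
rewrite count_independentE /valid_word en eu ek size_mkseq dvdn_mull //.
have -> : false \in word_of_rows k n I by rewrite mem_cat inE eqxx orbT.
rewrite /= valid_rowsE.
have /andP[h1 h2] : injectiveb (@row_family k n I) &&
    in_class m Delta (@Hypergraph 'I_n [set row_family n I e | e : 'I_k]).
  by rewrite -valid_rowsE.
have -> : injectiveb (@row_family k n (entry (word_of_rows k n I))).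
  by apply/injectiveP => e e'; rewrite !eI; apply: injectiveP h1 _ _.
have -> : [set row_family n (entry (word_of_rows k n I)) e | e : 'I_k] =
    [set row_family n I e | e : 'I_k] by apply: eq_imset.
rewrite h2 /num_free; apply: eq_card => S; rewrite !inE.
by apply: eq_forallb => e; rewrite eI.
Qed.

(** * Maximum degree at most one *)

(** Each vertex lies in at most one edge, so the inclusion-exclusion sum factors over the edges into
    [2 ^ m - 1] apiece, and each of the [r] uncovered vertices gives a factor 2. *)
Lemma num_free_disjoint (E X : finType) (inc : E -> {set X}) m :
  (forall e, #|inc e| = m) -> (forall x, #|[set e | x \in inc e]| <= 1) ->
  num_free inc = (2 ^ m - 1) ^ #|E| * 2 ^ (#|X| - m * #|E|).
Proof.
move=> hm h1; pose r := #|[set x | #|[set e | x \in inc e]| == 0]|.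
have -> : #|X| - m * #|E| = r.
  have -> : m * #|E| = \sum_x #|[set e | x \in inc e]|.
    transitivity (\sum_e #|inc e|).
      by rewrite (eq_bigr (fun=> m)) // sum_nat_const mulnC.
    rewrite (eq_bigr (fun e => \sum_x (x \in inc e : nat))).
      rewrite exchange_big; apply: eq_bigr => x _.
      by rewrite -sum1_card [RHS]big_mkcond; apply: eq_bigr => e _; rewrite inE; case: ifP.
    by move=> e _; rewrite -sum1_card big_mkcond; apply: eq_bigr => x _; case: ifP.
  suff : r + \sum_x #|[set e | x \in inc e]| = #|X| by lia.
  rewrite /r -sum1_card big_mkcond -big_split -sum1_card; apply: eq_bigr => x _.
  by rewrite inE; have := h1 x; case: #|_| => [|[]].
have uniq_e x e e' : x \in inc e -> x \in inc e' -> e = e'.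
  move=> he he'; have /card_le1P/(_ e) := h1 x; rewrite inE => /(_ he e').
  by rewrite !inE he' => /esym/eqP.
apply/eqP; rewrite -(Num.Theory.eqr_nat int) num_free_sum; apply/eqP.
have wE (F : {ffun E -> bool}) x :
    (if [exists e, F e && (x \in inc e)] then 1 else 2 : int)%R =
    ((if #|[set e | x \in inc e]| == 0 then 2 else 1) *
     \prod_e (if x \in inc e then if F e then 1 else 2 else 1))%R.
  case: eqP => [/eqP|/eqP]; rewrite cards_eq0.
    move=> /eqP h0; have hx e : x \in inc e = false.
      by move/setP: h0 => /(_ e); rewrite !inE.
    rewrite big1 ?mulr1 => [|e _]; last by rewrite hx.
    by case: existsP => // -[e]; rewrite hx andbF.
  case/set0Pn => e; rewrite inE => he; rewrite mul1r (bigD1 e) //= he.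
  rewrite big1 ?mulr1 => [|e' ne]; last first.
    by case: ifP => // he'; rewrite (uniq_e _ _ _ he he') eqxx in ne.
  congr (if _ then _ else _); apply/existsP/idP => [[e' /andP[h he']]|h]; last by exists e; rewrite h he.
  by rewrite (uniq_e _ _ _ he he').
under eq_bigr => F _.
  under [X in (_ * X)%R]eq_bigr => x _ do rewrite wE.
  rewrite big_split /= exchange_big /= mulrCA -big_split /=.
  over.
rewrite -big_distrr /= -(bigA_distr_bigA (fun e (b : bool) => ((if b then -1 else 1) *
   \prod_x (if x \in inc e then if b then 1 else 2 else 1))%R)).
rewrite natrM mulrC; congr (_ * _)%R.
  rewrite natrX -prodr_const; apply: eq_bigr => e _; rewrite big_bool /= big1 => [|x _]; last by case: ifP.
  rewrite -big_mkcond /= prodr_const hm natrB ?expn_gt0 // natrX; ring.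
rewrite natrX /r -prodr_const [RHS]big_mkcond; apply: eq_bigr => x _.
by rewrite inE.
Qed.

Section Complexity.

Variable O : oracle.

Lemma fp_valid_word m Delta (A : code) (w : A -> word) :
  fp O w -> fp O (fun a => valid_word m Delta (w a)).
Proof.
move=> Hw; rewrite /valid_word /valid_rows /num_edges /entry /rows_word /num_vertices /dvdn.
by fp_auto.
Qed.

Lemma fp_bexpc c (A : code) (n : A -> nat) :
  fp O n -> fp O (fun a => Bnat (c ^ n a)).
Proof.
move=> Hn; pose F x := Bnat (bval x * c).
have FE k : iter k F (Bnat 1) = Bnat (c ^ k).
  by elim: k => //= k ->; rewrite /F /= expnSr.
apply: (fp_ext (f := fun a => iter (n a) F (Bnat 1))) => [a|]; first exact: FE.
apply: (fp_iter (F := fun _ => F) (T := fun a => n a * size (binary c) + 1)) => //.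
- by fp_auto.
- by rewrite /F; fp_auto.
- by apply: (@fp_pb O); fp_auto.
move=> a k hk; rewrite FE sz_bnat size_binary_le.
apply: (@leq_ltn_trans (2 ^ (k * size (binary c)))).
  rewrite mulnC expnM; case: (k) => // k'; rewrite leq_exp2r //.
  exact: ltnW (ltn_size_binary c).
rewrite ltn_exp2l // addn1 ltnS leq_mul2r hk orbT //.
Qed.

Lemma fp_count_low m Delta : Delta <= 1 ->
  fp O (fun w => Bnat (count_independent m Delta w)).
Proof.
move=> hD; apply: (fp_ext (f := fun w => if valid_word m Delta w
   then Bnat ((2 ^ m - 1) ^ num_edges w * 2 ^ (num_vertices w - m * num_edges w)) else Bnat 0)).
  move=> w; rewrite count_independentE; case: ifP => // /and3P[_ _].
  rewrite valid_rowsE => /andP[/injectiveP inj].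
  rewrite in_class_family // => /and3P[/forallP h1 /forallP h2 _].
  rewrite (num_free_disjoint (m := m)) ?card_ord // => [e|x]; first exact/eqP/h1.
  exact: leq_trans (h2 x) hD.
apply: fp_if; first by apply: fp_valid_word; apply: fp_id.
  rewrite /num_edges /rows_word /num_vertices.
  by apply: fp_bmul; [apply: fp_bexpc | apply: fp_bexp2]; fp_auto.
by fp_auto.
Qed.

End Complexity.

(** * Membership in #P *)

(** The two flags say that the next bit is a letter of the first word, and that the separator has
    been passed. Both words are collected in reverse. *)
Definition unpair_step (s : (bool * bool) * (word * word)) (b : bool) :
    (bool * bool) * (word * word) :=
  if s.1.2 then (s.1, (s.2.1, b :: s.2.2))
  else if s.1.1 then ((false, false), (b :: s.2.1, s.2.2))
  else ((b, ~~ b), s.2).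

Definition unpair (w : word) : word * word :=
  let s := foldl unpair_step ((false, false), ([::], [::])) w in
  (rev s.2.1, rev s.2.2).

Lemma unpairK x y : unpair (pair_word x y) = (x, y).
Proof.
have H1 (u v : word) : foldl unpair_step ((false, false), (u, v))
    (flatten [seq [:: true; b] | b <- x]) = ((false, false), (catrev x u, v)).
  by elim: x u => //= b x IH u; rewrite -IH.
have H2 (u v : word) : foldl unpair_step ((false, true), (u, v)) y =
    ((false, true), (u, catrev y v)).
  by elim: y v => //= b y IH v; rewrite -IH.
by rewrite /unpair /pair_word foldl_cat H1 /= H2 /= -!/(rev _) !revK.
Qed.

Lemma fp_unpair O (A : code) (w : A -> word) : fp O w -> fp O (fun a => unpair (w a)).
Proof.
move=> Hw; have H : fp O (fun a => foldl unpair_step ((false, false), ([::], [::])) (w a)).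
  apply: (fp_fold_grow (F := fun _ => unpair_step) (T := fun=> 1)) => //.
  - by fp_auto.
  - by rewrite /unpair_step; fp_auto.
  - exact: pb_const.
  move=> a [[e f] [u v]] b; rewrite /unpair_step /=.
  by case: f; case: e; rewrite /= !sz_pair /= !sz_bool !sz_word /=; lia.
by rewrite /unpair; fp_auto.
Qed.

(** A certificate is as long as the whole input, which exceeds the number of vertices. Its surplus
    bits are required to be false, so that every independent set has exactly one certificate. *)
Definition accepts (m Delta : nat) (w : word) : bool :=
  let x := (unpair w).1 in let y := (unpair w).2 in
  [&& valid_word m Delta x,
      all (fun i => (num_vertices x <= i) ==> ~~ nth false y i) (iota 0 (size x)) &
      all (fun e => has (fun v => entry x e v && ~~ nth false y v)
                        (iota 0 (num_vertices x))) (iota 0 (num_edges x))].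

Lemma fp_accepts O m Delta : fp O (accepts m Delta).
Proof.
have H : fp O unpair by apply: fp_unpair; fp_auto.
have H' := fp_valid_word (O := O) m Delta (w := fun w => (unpair w).1).
rewrite /accepts; fp_auto; first by apply: H'; fp_auto.
all: by rewrite /num_edges /entry /rows_word /num_vertices; fp_auto.
Qed.

Lemma sharpP_count_independent m Delta : sharpP (count_independent m Delta).
Proof.
exists (accepts m Delta), 'X%R; split=> [|x].
  by apply: fp_poly_time_language; apply: fp_accepts.
move: ('X.[size x])%R (hornerX (size x)) => N eN.
rewrite count_independentE; set n := num_vertices x; set k := num_edges x.
case: ifPn => hv; last first.
  apply/esym/eqP; rewrite cards_eq0; apply/eqP/setP => y.
  by rewrite !inE /accepts unpairK /= (negbTE hv).
have nN : n < N.+1 by rewrite eN ltnS index_size.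
pose g (S : {set 'I_n}) : N.-tuple bool :=
  [tuple if insub (val i) is Some j then j \in S else false | i < N].
have gE S (j : 'I_n) : nth false (g S) j = (j \in S).
  have hj : j < N by apply: leq_trans (ltn_ord j) _.
  by rewrite -[nat_of_ord j]/(nat_of_ord (Ordinal hj)) -tnth_nth tnth_mktuple /= valK.
have g0 S i : n <= i -> nth false (g S) i = false.
  move=> hi; case: (ltnP i N) => hiN; last by rewrite nth_default ?size_tuple.
  rewrite -[i]/(nat_of_ord (Ordinal hiN)) -tnth_nth tnth_mktuple /=.
  by case: insubP => //= j hj _; rewrite ltnNge hi in hj.
have gI : injective g.
  by move=> S S' e; apply/setP => j; rewrite -!gE e.
rewrite /num_free -(card_imset _ gI); apply: eq_card => y; rewrite inE /accepts unpairK /= hv /=.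
rewrite -/n -/k; apply/imsetP/andP => [[S]|[/all_iotaP h1 /all_iotaP h2]].
  rewrite inE => /forallP H ->; split; apply/all_iotaP => i hi.
    by apply/implyP => hni; rewrite g0.
  have /subsetPn[v] := H (Ordinal hi); rewrite inE => hiv hS.
  by apply/hasP; exists (val v); rewrite ?mem_iota ?ltn_ord // hiv gE.
exists [set j : 'I_n | nth false y j].
  rewrite inE; apply/forallP => e; have /hasP[v] := h2 e (ltn_ord e).
  rewrite mem_iota => /= hv' /andP[hev hy].
  by apply/subsetPn; exists (Ordinal hv'); rewrite inE.
apply: eq_from_tnth => i; rewrite !(tnth_nth false).
case: (ltnP i n) => hi; first by rewrite -[nat_of_ord i]/(nat_of_ord (Ordinal hi)) gE inE.
rewrite g0 //; apply/negbTE.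
by have := h1 i; rewrite -eN ltn_ord => /(_ isT) /implyP; apply.
Qed.

(** * The class of the spin hypergraph *)

Section SpinClass.

Variables (C : finType) (nx pi mn : C -> C) (q mu : nat).
Hypotheses (q2 : 1 < q) (nxI : injective nx) (mn_or : forall c, mn c = c \/ mn c = pi c)
  (piK : involutive pi).

Notation spin := (spin C q).
Notation next := (@next_spin C nx q).
Notation edge := (@spin_edge C nx mn q mu).

Let succ_last (y : spin) : y.2 = q :> nat -> next y = (nx y.1, ord0).
Proof. by move=> e; rewrite /next_spin; case: insubP => //= k; rewrite e ltnn. Qed.

Let succ_in (y : spin) : y.2 < q -> (next y).1 = y.1 /\ (next y).2 = y.2.+1 :> nat.
Proof. by move=> h; rewrite /next_spin; case: insubP => [k _ //|]; rewrite ltnS h. Qed.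

Let spin_case (y : spin) : y.2 < q \/ y.2 = q :> nat.
Proof. by have := ltn_ord y.2; rewrite ltnS leq_eqVlt => /orP[/eqP|]; [right|left]. Qed.

Let succI : injective next.
Proof.
move=> y y'; case: (spin_case y) => h; case: (spin_case y') => h'.
- have [e1 e2] := succ_in h; have [e1' e2'] := succ_in h' => e.
  rewrite (surjective_pairing y) (surjective_pairing y') -e1 -e1' e; congr (_, _).
  by apply: val_inj; apply: succn_inj; rewrite /= -e2 -e2' e.
- have [_ e2] := succ_in h => e; move: e2; rewrite e (succ_last h') //.
- have [_ e2] := succ_in h' => e; move: e2; rewrite -e (succ_last h) //.
rewrite (succ_last h) (succ_last h') => -[/nxI e].
by rewrite (surjective_pairing y) (surjective_pairing y') e; congr (_, _); apply: val_inj; rewrite /= h h'.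
Qed.

Let succ_neq y : next y != y.
Proof.
apply/eqP => e; case: (spin_case y) => h.
  by have [_] := succ_in h; rewrite e; lia.
by move: e (h); rewrite (succ_last h) => <- /= h'; lia.
Qed.

Let succ2_neq y : next (next y) != y.
Proof.
apply/eqP => e; case: (spin_case y) => h.
  have [_ e2] := succ_in h; case: (spin_case (next y)) => h'.
    by have [_] := succ_in h'; rewrite e e2; lia.
  by move: (succ_last h'); rewrite e => ey; rewrite h' ey /= in e2; lia.
have h' : (next y).2 < q by rewrite (succ_last h) /=; lia.
by have [_] := succ_in h'; rewrite e h (succ_last h) /=; lia.
Qed.

(** If two spins had the same edge, their last variables would make each the successor of the other;
    segments of at least three spins exclude this. *)
Lemma spin_edge_inj : injective edge.
Proof.
move=> y y' e; apply/eqP/negPn/negP => ne.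
have step z z' : edge z = edge z' -> z != z' -> next z = z'.
  move=> ezz nzz; have : (z, ord_max) \in edge z' by rewrite -ezz inE /incident /= !eqxx.
  by rewrite inE /incident /= eqxx (negbTE nzz) => /eqP.
have := succ2_neq y; rewrite (step _ _ e ne) (step _ _ (esym e)) ?eqxx //.
by rewrite eq_sym.
Qed.

Lemma card_spin_edge y : #|edge y| = mu.+3.
Proof.
have [prev prevK succK] : bijective next by apply: injF_bij.
have -> : #|edge y| = \sum_(z : spin) \sum_(i < mu.+2) (incident nx mn y (z, i) : nat).
  rewrite -sum1_card big_mkcond pair_bigA; apply: eq_bigr => -[z i] _.
  by rewrite inE; case: (incident _ _ _ _).
(* The four contributions: the spin's own last variable, that of its predecessor, the first variable
   (its own, or for a port that of the representative), and [mu] private ones. *)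
rewrite (eq_bigr (fun z => ((z == y) + (next z == y)) +
   ((if z.2 == ord0 then (y.2 == ord0) && (mn y.1 == z.1) else z == y) + mu * (z == y)))); last first.
  move=> z _; rewrite big_ord_recr big_ord_recl /= addnC; congr (_ + (_ + _)).
  - rewrite /incident /= eqxx; case: eqP => [->|_]; last by case: (_ == _).
    by rewrite (negbTE (succ_neq y)).
  rewrite (eq_bigr (fun=> (z == y : nat))) ?sum_nat_const ?card_ord // => i _.
  rewrite /incident /= ifF; last by apply/negbTE; rewrite -val_eqE /= neq_ltn ltnS ltn_ord.
  by [].
rewrite !big_split /= -big_distrr /=.
have one (P : pred spin) z0 : (forall z, P z = (z == z0)) -> \sum_z (P z : nat) = 1.
  move=> H; rewrite (bigD1 z0) //= H eqxx big1 // => z /negbTE h.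
  by rewrite H h.
rewrite (one (fun z => z == y) y) // (one (fun z => next z == y) (prev y)); last first.
  by move=> z; rewrite -{1}(succK y) (inj_eq succI).
rewrite (eq_bigr (fun z => nat_of_bool (if z.2 == ord0 then (y.2 == ord0) && (mn y.1 == z.1) else z == y))).
  rewrite (one (fun z : spin => if z.2 == ord0 then (y.2 == ord0) && (mn y.1 == z.1) else z == y)
    (if y.2 == ord0 then (mn y.1, ord0) else y)) ?muln1 ?addn1 //.
  move=> z; case: (z.2 =P ord0) => hz; case: (y.2 =P ord0) => hy /=.
  - by rewrite eq_sym [in RHS](surjective_pairing z) xpair_eqE hz eqxx andbT.
  - by apply/esym/eqP => e; case: hy; rewrite -e.
  - by apply/eqP/eqP => e; case: hz; rewrite e.
  - by [].
by move=> z _; case: ifP.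
Qed.

Lemma degree_spin_edge x : #|[set y | x \in edge y]| <= 2.
Proof.
case: x => z i; apply: (@leq_trans #|[set (if i == ord_max then z else (z.1, ord0));
   (if i == ord_max then next z else if (i == ord0) && (z.2 == ord0) then (pi z.1, ord0) else z)]|);
   last by rewrite cards2; case: (_ != _).
apply/subset_leq_card/subsetP => y; rewrite !inE /incident /=.
case: eqP => // _; first by case/orP => /eqP ->; rewrite eqxx ?orbT.
case: ifP => [/andP[_ /eqP hz] /andP[/eqP hy /eqP e]|_ /eqP ->]; last by rewrite eqxx orbT.
rewrite (surjective_pairing y) hy !xpair_eqE eqxx !andbT -e.
by case: (mn_or y.1) => ->; rewrite ?piK eqxx ?orbT.
Qed.

End SpinClass.

(** * Transport and disjoint sums of families *)

Section Transport.

Variables (E X E' X' : finType) (inc : E -> {set X}) (inc' : E' -> {set X'}).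
Variables (f : E' -> E) (g : X' -> X).
Hypotheses (fB : bijective f) (gB : bijective g).
Hypothesis inc'E : forall e x, (x \in inc' e) = (g x \in inc (f e)).

Let inc'P e : inc' e = g @^-1: inc (f e).
Proof. by apply/setP => x; rewrite inE inc'E. Qed.

Let cardg (A : {set X}) : #|g @^-1: A| = #|A|.
Proof. by apply: on_card_preimset; apply: onW_bij. Qed.

Lemma card_transport m : (forall e, #|inc e| = m) -> forall e, #|inc' e| = m.
Proof. by move=> H e; rewrite inc'P cardg. Qed.

Lemma degree_transport x : #|[set e | x \in inc' e]| = #|[set e | g x \in inc e]|.
Proof.
rewrite -(@on_card_preimset _ _ f); last exact: onW_bij.
by apply: eq_card => e; rewrite !inE inc'E.
Qed.

Lemma inj_transport : injective inc -> injective inc'.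
Proof.
move=> H e e' h; apply: (bij_inj fB); apply: H.
by apply/setP => x; have [k _ kK] := gB; rewrite -(kK x) -!inc'E h.
Qed.

Lemma num_free_transport : num_free inc' = num_free inc.
Proof.
have [f' fK f'K] := fB; have [g' gK g'K] := gB.
have hB : bijective (fun A : {set X} => g @^-1: A).
  exists (fun A : {set X'} => g' @^-1: A) => A; apply/setP => x; rewrite !inE ?g'K ?gK //.
rewrite /num_free -(on_card_preimset (f := fun A : {set X} => g @^-1: A)); last exact: onW_bij.
apply: eq_card => S; rewrite !inE; apply/forallP/forallP => H e.
  have := H (f' e); rewrite inc'P f'K; apply: contra => h.
  by apply: preimsetS.
have := H (f e); rewrite inc'P; apply: contra => /subsetP h; apply/subsetP => x hx.
by have := h (g' x); rewrite !inE g'K; apply.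
Qed.

End Transport.

Section Sum.

Variables (E1 X1 E2 X2 : finType) (inc1 : E1 -> {set X1}) (inc2 : E2 -> {set X2}).

Definition sum_family (e : E1 + E2) : {set (X1 + X2)} :=
  match e with inl e => inl @: inc1 e | inr e => inr @: inc2 e end.

Lemma in_sum_family e x : (x \in sum_family e) =
  match e, x with
  | inl e, inl x => x \in inc1 e
  | inr e, inr x => x \in inc2 e
  | _, _ => false
  end.
Proof.
case: e => e; case: x => x /=; rewrite ?mem_imset //; try exact: inl_inj; try exact: inr_inj;
  by apply/imsetP => -[].
Qed.

Lemma num_free_sum_family : num_free sum_family = num_free inc1 * num_free inc2.
Proof.
rewrite /num_free -cardsX.
pose h (S : {set (X1 + X2)}) := (inl @^-1: S, inr @^-1: S).
have hB : bijective h.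
  exists (fun A : {set X1} * {set X2} => [set x | match x with inl x => x \in A.1 | inr x => x \in A.2 end]).
    by move=> S; apply/setP => -[x|x]; rewrite !inE.
  by move=> [A B]; congr (_, _); apply/setP => x; rewrite !inE.
rewrite -(on_card_preimset (f := h)); last exact: onW_bij.
apply: eq_card => S; rewrite !inE.
have sub1 e : (inl @: inc1 e \subset S) = (inc1 e \subset inl @^-1: S) by rewrite sub_imset_pre.
have sub2 e : (inr @: inc2 e \subset S) = (inc2 e \subset inr @^-1: S) by rewrite sub_imset_pre.
apply/forallP/andP => [H|[/forallP H1 /forallP H2] [e|e] /=].
- by split; apply/forallP => e /=; [rewrite -sub1; apply: (H (inl e)) | rewrite -sub2; apply: (H (inr e))].
- by rewrite sub1.
- by rewrite sub2.
Qed.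

Lemma card_sum_family m : (forall e, #|inc1 e| = m) -> (forall e, #|inc2 e| = m) ->
  forall e, #|sum_family e| = m.
Proof. by move=> H1 H2 [e|e]; rewrite /= card_imset //; [apply: inl_inj | apply: inr_inj]. Qed.

Lemma degree_sum_family x : #|[set e | x \in sum_family e]| =
  match x with
  | inl x => #|[set e | x \in inc1 e]|
  | inr x => #|[set e | x \in inc2 e]|
  end.
Proof.
case: x => x.
  rewrite -(card_imset _ (@inl_inj E1 E2)); apply: eq_card => e; rewrite inE in_sum_family.
  case: e => e; first by rewrite mem_imset ?inE //; apply: inl_inj.
  by apply/esym/imsetP => -[].
rewrite -(card_imset _ (@inr_inj E1 E2)); apply: eq_card => e; rewrite inE in_sum_family.
case: e => e; last by rewrite mem_imset ?inE //; apply: inr_inj.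
by apply/esym/imsetP => -[].
Qed.

(* Nonemptiness separates the edges of the two summands. *)
Lemma inj_sum_family : injective inc1 -> injective inc2 ->
  (forall e, inc1 e != set0) -> injective sum_family.
Proof.
move=> H1 H2 n0 [e|e] [e'|e'] h.
- congr inl; apply: H1; apply/setP => x.
  by move/setP: h => /(_ (inl x)); rewrite !in_sum_family.
- have /set0Pn[x hx] := n0 e.
  by move/setP: h => /(_ (inl x)); rewrite !in_sum_family hx.
- have /set0Pn[x hx] := n0 e'.
  by move/setP: h => /(_ (inl x)); rewrite !in_sum_family hx.
- congr inr; apply: H2; apply/setP => x.
  by move/setP: h => /(_ (inr x)); rewrite !in_sum_family.
Qed.

End Sum.

(** * A hypergraph of prescribed maximum degree *)

Section Sunflower.

Variables (m' Delta : nat).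
Hypothesis m'0 : 0 < m'.

(** The core is the single vertex numbered [Delta * m']; petal [e] consists of the [m'] numbers with
    quotient [e]. *)
Definition sunflower (e : 'I_Delta) : {set 'I_(Delta * m').+1} :=
  [set x : 'I_(Delta * m').+1 | (x == Delta * m' :> nat) || (x %/ m' == e)].

Lemma card_sunflower e : #|sunflower e| = m'.+1.
Proof.
have -> : #|sunflower e| = \sum_(x < (Delta * m').+1) ((x == Delta * m' :> nat) || (x %/ m' == e)).
  by rewrite -sum1_card big_mkcond; apply: eq_bigr => x _; rewrite inE; case: (_ || _).
rewrite -(big_mkord xpredT (fun x => nat_of_bool ((x == Delta * m') || (x %/ m' == e)))).
rewrite big_nat_recr //= eqxx addn1; congr S.
rewrite (big_cat_nat (n := e * m')) //=; last by rewrite leq_mul2r ltnW ?orbT.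
rewrite (big_cat_nat (n := e.+1 * m') (m := e * m')) //=; try by rewrite leq_mul2r ?leqnSn ?ltn_ord ?orbT.
rewrite big_nat big1 ?add0n => [|x /andP[_ hx]]; last first.
  by rewrite (ltn_eqF (ltn_trans hx _)) ?ltn_pmul2r //= ltn_eqF // ltn_divLR.
rewrite [X in _ + X]big_nat [X in _ + X]big1 ?addn0 => [|x /andP[hx hx']]; last first.
  by rewrite (ltn_eqF hx') /= gtn_eqF // leq_divRL.
rewrite big_nat (eq_bigr (fun=> 1)) => [|x /andP[hx hx']]; last first.
  have -> : x %/ m' = e by apply/eqP; rewrite eqn_leq -ltnS ltn_divLR // hx' leq_divRL.
  by rewrite eqxx orbT.
by rewrite -big_nat sum_nat_const_nat mulSn addnK muln1.
Qed.

Lemma degree_sunflower x :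
  #|[set e | x \in sunflower e]| = if x == Delta * m' :> nat then Delta else 1.
Proof.
case: ifP => hx.
  by rewrite -[RHS]card_ord; apply: eq_card => e; rewrite !inE hx.
have hD : x %/ m' < Delta by rewrite ltn_divLR //; have := ltn_ord x; lia.
rewrite -(cards1 (Ordinal hD)); apply: eq_card => e; rewrite !inE hx /=.
by rewrite -val_eqE eq_sym.
Qed.

Lemma sunflower_inj : injective sunflower.
Proof.
move=> e e' h; have he : e * m' < (Delta * m').+1 by rewrite ltnS leq_mul2r ltnW ?orbT.
move/setP: h => /(_ (Ordinal he)); rewrite !inE /= mulnK // eqxx orbT.
by rewrite (ltn_eqF (_ : _ < _)) ?ltn_pmul2r //= => /esym/eqP; apply: val_inj.
Qed.

Lemma num_free_sunflower : 0 < num_free sunflower.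
Proof.
apply/card_gt0P; exists set0; rewrite inE; apply/forallP => e.
by rewrite subset0 -card_gt0 card_sunflower.
Qed.

End Sunflower.

(** * Numbering of the spin hypergraph *)

Lemma sum_ord_mul a b (F : nat -> nat) :
  \sum_(i < a * b) F i = \sum_(i < a) \sum_(j < b) F (i * b + j).
Proof.
elim: a => [|a IH]; first by rewrite !big_ord0.
by rewrite big_ord_recr -IH mulSn addnC big_split_ord.
Qed.

Definition ordf N (f : nat -> nat) (i : 'I_N) : 'I_N := insubd i (f i).

Lemma val_ordf N (f : nat -> nat) (i : 'I_N) : f i < N -> ordf f i = f i :> nat.
Proof. by move=> h; rewrite val_insubd h. Qed.

Section OrdPair.

Variables a b : nat.

Fact ordpair_lt (i : 'I_(a * b.+1)) : i %/ b.+1 < a.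
Proof. by rewrite ltn_divLR. Qed.

Definition ordpair (i : 'I_(a * b.+1)) : 'I_a * 'I_b.+1 :=
  (Ordinal (ordpair_lt i), inord (i %% b.+1)).

Lemma ordpair2 i : (ordpair i).2 = i %% b.+1 :> nat.
Proof. by rewrite inordK // ltn_pmod. Qed.

Lemma ordpair_bij : bijective ordpair.
Proof.
apply: inj_card_bij; last by rewrite card_prod !card_ord.
move=> i j e; apply: val_inj => /=.
rewrite (divn_eq i b.+1) (divn_eq j b.+1) -!ordpair2.
by rewrite -[i %/ _]/(val (ordpair i).1) -[j %/ _]/(val (ordpair j).1) e.
Qed.

End OrdPair.

Section Ports.

Variables (n t L : nat) (ok : nat -> nat -> bool).

Definition port (u w p : nat) : nat := u * (n * t) + (w * t + p).

(* The ports of the cluster [u] are the [port u w p] with [w < n], [p < t]. Those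
   of [u] and [w] are matched if [ok u w] fails; [2 * L] ports of [u] are matched
   with one another if [ok u u] holds. *)
Definition partner (c : nat) : nat :=
  let u := c %/ (n * t) in let w := c %% (n * t) %/ t in
  if u == w then
    if ok u u then
      if c %% t < L then c + L else if c %% t < 2 * L then c - L else c
    else c
  else if ok u w then c else port w u (c %% t).

(** A cyclic shift through all [n * t] ports of one cluster, which ties the cluster into a single
    spin. *)
Definition nextport (c : nat) : nat :=
  c %/ (n * t) * (n * t) + (c %% (n * t)).+1 %% (n * t).

Definition minport (c : nat) : nat := minn c (partner c).

Lemma port_lt u w p : u < n -> w < n -> p < t -> port u w p < n * (n * t).
Proof.
move=> hu hw hp; have h1 : w * t + p < n * t by nia.
by rewrite /port; move: (n * t) h1 => R; nia.
Qed.

Lemma port_div u w p : w < n -> p < t -> port u w p %/ (n * t) = u.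
Proof.
move=> hw hp; have h1 : w * t + p < n * t by nia.
by rewrite /port divnMDl ?divn_small ?addn0 //; apply: leq_ltn_trans h1.
Qed.

Lemma port_mod u w p : w < n -> p < t -> port u w p %% (n * t) = w * t + p.
Proof. by move=> hw hp; rewrite /port modnMDl modn_small //; nia. Qed.

Lemma port_modt u w p : p < t -> port u w p %% t = p.
Proof. by move=> hp; rewrite /port mulnA modnMDl modnMDl modn_small. Qed.

Lemma portP c : c < n * (n * t) ->
  exists u w p, [/\ u < n, w < n, p < t & c = port u w p].
Proof.
move=> hc; have nt0 : 0 < n * t by case: (n * t) hc => //; rewrite muln0.
have t0 : 0 < t by move: nt0; rewrite muln_gt0 => /andP[].
exists (c %/ (n * t)), (c %% (n * t) %/ t), (c %% (n * t) %% t); split.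
- by rewrite ltn_divLR.
- by rewrite ltn_divLR // ltn_pmod.
- by rewrite ltn_pmod.
by rewrite /port -divn_eq -divn_eq.
Qed.

Lemma partner_port u w p : w < n -> p < t ->
  partner (port u w p) =
  if u == w then
    if ok u u then
      if p < L then port u u (p + L) else if p < 2 * L then port u u (p - L)
      else port u u p
    else port u u p
  else if ok u w then port u w p else port w u p.
Proof.
move=> hw hp; rewrite /partner port_div // port_mod // port_modt //.
rewrite divnMDl ?divn_small ?addn0 //; last by case: (t) hp.
case: eqP => // ->; case: ifP => // _.
by case: ltnP => h1; [|case: ltnP => h2]; rewrite /port //; lia.
Qed.

Lemma nextport_div c : c < n * (n * t) -> nextport c %/ (n * t) = c %/ (n * t).
Proof.
move=> hc; have nt0 : 0 < n * t by case: (n * t) hc => //; rewrite muln0.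
by rewrite /nextport divnMDl // (divn_small (ltn_pmod _ nt0)) addn0.
Qed.

Lemma nextport_lt c : c < n * (n * t) -> nextport c < n * (n * t).
Proof.
move=> hc; have nt0 : 0 < n * t by case: (n * t) hc => //; rewrite muln0.
by rewrite -ltn_divLR // nextport_div // ltn_divLR.
Qed.

Lemma nextport_inj c c' : c < n * (n * t) -> c' < n * (n * t) ->
  nextport c = nextport c' -> c = c'.
Proof.
move=> hc hc' e; have nt0 : 0 < n * t by case: (n * t) hc => //; rewrite muln0.
have ed : c %/ (n * t) = c' %/ (n * t) by rewrite -nextport_div // e nextport_div.
rewrite (divn_eq c (n * t)) (divn_eq c' (n * t)) ed; congr addn.
move: e; rewrite /nextport ed => /addnI; have := ltn_pmod c nt0.
have := ltn_pmod c' nt0; move: (c %% _) (c' %% _) => r r'.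
move=> h' h; have small k : k < n * t -> k.+1 %% (n * t) = if k.+1 == n * t then 0 else k.+1.
  move=> hk; case: eqP => [->|/eqP ne]; first exact: modnn.
  by rewrite modn_small // ltn_neqAle ne.
by rewrite !small //; do 2!case: eqP; lia.
Qed.

Hypotheses (t0 : 0 < t) (Lt : 2 * L <= t) (okC : forall u w, ok u w = ok w u).

Lemma partner_lt c : c < n * (n * t) -> partner c < n * (n * t).
Proof.
case/portP => u [w [p [hu hw hp ->]]]; rewrite partner_port //.
by do ![case: ifP => ?]; apply: port_lt => //; lia.
Qed.

Lemma partnerK c : c < n * (n * t) -> partner (partner c) = c.
Proof.
case/portP => u [w [p [hu hw hp ->]]]; rewrite (partner_port _ hw hp).
case: (eqVneq u w) => [euw|uw]; last first.
  case: ifP => huw; first by rewrite partner_port // (negbTE uw) huw.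
  by rewrite partner_port // eq_sym (negbTE uw) okC huw.
rewrite -{w}euw in hw *; case: ifP => h; last by rewrite partner_port // eqxx h.
case: ltnP => h1.
  rewrite partner_port ?eqxx ?h; try lia.
  by rewrite ltnNge leq_addl /= ifT ?addnK //; lia.
case: ltnP => h2; last by rewrite partner_port // eqxx h ltnNge h1 ltnNge h2.
rewrite partner_port ?eqxx ?h; try lia.
by rewrite ifT ?subnK //; lia.
Qed.

Lemma minport_or c : minport c = c \/ minport c = partner c.
Proof. by rewrite /minport /minn; case: ifP; [left | right]. Qed.

Lemma minport_lt c : c < n * (n * t) -> minport c < n * (n * t).
Proof. by move=> h; case: (minport_or c) => -> //; apply: partner_lt. Qed.

Lemma minport_partner c : c < n * (n * t) -> minport (partner c) = minport c.
Proof. by move=> h; rewrite /minport partnerK // minnC. Qed.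

(** Each matched pair is counted at its smaller port. Within a cluster there are [L] pairs; between
    two clusters there are [t], all counted at the cluster of smaller index because
    [port u w p < port w u p] exactly when [u < w]. *)
Lemma matched_sum (s : nat -> bool) :
  \sum_(c < n * (n * t)) [&& minport c == c, partner c != c, s (c %/ (n * t)) &
     s (partner c %/ (n * t))] =
  \sum_(u < n) \sum_(w < n)
    (if u == w then (ok u u && s u) * L
     else if u < w then [&& ~~ ok u w, s u & s w] * t else 0).
Proof.
rewrite (sum_ord_mul n (n * t) (fun c => nat_of_bool [&& minport c == c, partner c != c,
   s (c %/ (n * t)) & s (partner c %/ (n * t))])).
apply: eq_bigr => u _.
rewrite (sum_ord_mul n t (fun r => nat_of_bool [&& minport (u * (n * t) + r) == u * (n * t) + r,
   partner (u * (n * t) + r) != u * (n * t) + r,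
   s ((u * (n * t) + r) %/ (n * t)) & s (partner (u * (n * t) + r) %/ (n * t))])).
apply: eq_bigr => w _.
transitivity (\sum_(p < t) [&& minn (port u w p) (partner (port u w p)) == port u w p,
    partner (port u w p) != port u w p, s u & s (partner (port u w p) %/ (n * t))]).
  by apply: eq_bigr => p _; rewrite -!/(port u w p) /minport (port_div u).
under eq_bigr => p _ do rewrite partner_port //.
have [euw|uw] := eqVneq u w.
  rewrite -{w}euw eqxx; case h: (ok u u) => /=; last first.
    by rewrite big1 ?mul0n // => p _; rewrite eqxx andbF.
  transitivity (\sum_(p < t) (if p < L then (s u : nat) else 0)).
    apply: eq_bigr => p _; case: ltnP => h1.
      have hp : p + L < t by lia.
      rewrite port_div // andbb /port minnE; case: (s u); rewrite ?andbF ?andbT //; lia.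
    case: ltnP => h2; last by rewrite eqxx andbF.
    by rewrite /port minnE; case: eqP => //; lia.
  rewrite -big_mkcond /= -(big_ord_widen t (fun=> nat_of_bool (s u))); last by lia.
  by rewrite sum_nat_const card_ord mulnC.
have uwn : (u == w :> nat) = false by apply/negbTE.
rewrite uwn; case h: (ok u w) => /=.
  by rewrite big1 => [|p _]; [case: ifP | rewrite eqxx andbF].
have lex p : p < t -> (port u w p < port w u p) = (u < w).
  move=> hp; have h1 : w * t + p < n * t by have := ltn_ord w; nia.
  have h2 : u * t + p < n * t by have := ltn_ord u; nia.
  rewrite /port; case: (ltngtP u w) => h3; move: (n * t) h1 h2 => r h1 h2.
  - by apply/idP; nia.
  - by apply/negbTE; rewrite -leqNgt; nia.
  - by rewrite (val_inj h3) eqxx in uw.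
transitivity (\sum_(p < t) (if u < w then (s u && s w : nat) else 0)).
  apply: eq_bigr => p _; rewrite port_div // /minn lex //.
  case: (ltngtP u w) => h3; rewrite ?eqxx /=.
  - by rewrite (gtn_eqF (_ : port u w p < _)) ?lex.
  - by case: eqP => //= e; move: (lex p (ltn_ord p)) (lex p (ltn_ord p)); rewrite e ltnn.
  - by rewrite (val_inj h3) eqxx in uw.
by rewrite sum_nat_const card_ord mulnC; case: ifP => _; rewrite ?mul0n.
Qed.

End Ports.

(** * The hypergraph of the reduction *)

(** The arithmetic form of [incident]: vertex [x] is variable [x %% mu.+2] of spin [x %/ mu.+2], and
    spin [y] is place [y %% q.+1] of the segment of port [y %/ q.+1]. *)
Definition spin_entry (n t L : nat) (ok : nat -> nat -> bool) (q mu y x : nat) : bool :=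
  let z := x %/ mu.+2 in
  if x %% mu.+2 == mu.+1 then
    (z == y) || ((if (z %% q.+1).+1 < q.+1 then z.+1
                  else nextport n t (z %/ q.+1) * q.+1) == y)
  else if (x %% mu.+2 == 0) && (z %% q.+1 == 0) then
    (y %% q.+1 == 0) && (minport n t L ok (y %/ q.+1) == z %/ q.+1)
  else z == y.

Section SpinRows.

Variables (n t L : nat) (ok : nat -> nat -> bool) (q mu : nat).
Hypotheses (t0 : 0 < t) (Lt : 2 * L <= t) (okC : forall u w, ok u w = ok w u) (q2 : 1 < q).

Let CN := n * (n * t).
Let nx : 'I_CN -> 'I_CN := ordf (nextport n t).
Let pi : 'I_CN -> 'I_CN := ordf (partner n t L ok).
Let mn : 'I_CN -> 'I_CN := ordf (minport n t L ok).

Let val_nx c : nx c = nextport n t c :> nat.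
Proof. by rewrite val_ordf // nextport_lt. Qed.

Let val_pi c : pi c = partner n t L ok c :> nat.
Proof. by rewrite val_ordf // partner_lt. Qed.

Let val_mn c : mn c = minport n t L ok c :> nat.
Proof. by rewrite val_ordf // minport_lt. Qed.

Let piK : involutive pi.
Proof. by move=> c; apply: val_inj; rewrite /= !val_pi partnerK. Qed.

Let mn_or c : mn c = c \/ mn c = pi c.
Proof.
by case: (minport_or n t L ok c) => e; [left|right]; apply: val_inj; rewrite /= val_mn ?val_pi e.
Qed.

Let mn_pi c : mn (pi c) = mn c.
Proof. by apply: val_inj; rewrite /= !val_mn val_pi minport_partner. Qed.

Let nxI : injective nx.
Proof.
move=> c c' e; apply: val_inj; apply: (nextport_inj (ltn_ord c) (ltn_ord c')).
by rewrite -!val_nx e.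
Qed.

Let f : 'I_(CN * q.+1) -> spin 'I_CN q := @ordpair CN q.

Let g (x : 'I_(CN * q.+1 * mu.+2)) : svar 'I_CN q mu :=
  (f (ordpair x).1, (ordpair x).2).

Let fI : injective f.
Proof. exact: bij_inj (ordpair_bij _ _). Qed.

Let gB : bijective g.
Proof.
apply: inj_card_bij; last by rewrite !card_prod !card_ord.
move=> x x' e; apply: (bij_inj (ordpair_bij _ _)).
rewrite (surjective_pairing (ordpair x)) (surjective_pairing (ordpair x')).
by rewrite (fI (congr1 fst e)) (congr1 snd e : (ordpair x).2 = _).
Qed.

Notation rows := (@row_family (CN * q.+1) (CN * q.+1 * mu.+2) (spin_entry n t L ok q mu)).

Let succ_f (z : 'I_(CN * q.+1)) y : (next_spin nx (f z) == f y) =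
  ((if (z %% q.+1).+1 < q.+1 then z.+1 else nextport n t (z %/ q.+1) * q.+1) == y :> nat).
Proof.
have eqf (s : spin 'I_CN q) : (s == f y) = (s.1 * q.+1 + s.2 == y :> nat).
  apply/eqP/eqP => [->|e].
    by rewrite ordpair2 /= -divn_eq.
  rewrite (surjective_pairing s); congr (_, _); apply: val_inj => /=.
    by rewrite -e divnMDl // divn_small ?addn0.
  by rewrite inordK ?ltn_pmod // -e modnMDl modn_small.
rewrite eqf /next_spin ordpair2; case: insubP => [k hk ek|hk] /=.
  by rewrite hk ek addnS -divn_eq.
by rewrite (negbTE hk) addn0 val_nx.
Qed.

Let rowsE e x : (x \in rows e) = (g x \in spin_edge nx mn mu (f e)).
Proof.
rewrite !inE /spin_entry /incident /=.
have e1 : ((ordpair x).2 == ord_max) = (x %% mu.+2 == mu.+1 :> nat).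
  by rewrite -val_eqE /= inordK // ltn_pmod.
have e2 : ((ordpair x).2 == ord0) = (x %% mu.+2 == 0 :> nat).
  by rewrite -val_eqE /= inordK // ltn_pmod.
have e3 : ((f (ordpair x).1).2 == ord0) = (x %/ mu.+2 %% q.+1 == 0 :> nat).
  by rewrite -val_eqE /= inordK // ltn_pmod.
have e4 : ((f e).2 == ord0) = (e %% q.+1 == 0 :> nat).
  by rewrite -val_eqE /= inordK // ltn_pmod.
have e5 : (f (ordpair x).1 == f e) = (x %/ mu.+2 == e :> nat).
  by rewrite (inj_eq fI) -val_eqE.
have e6 : (mn (f e).1 == (f (ordpair x).1).1) =
    (minport n t L ok (e %/ q.+1) == x %/ mu.+2 %/ q.+1 :> nat).
  by rewrite -val_eqE /= val_mn.
by rewrite e1 e2 e3 e4 e5 e6 succ_f.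
Qed.

Lemma card_spin_rows e : #|rows e| = mu.+3.
Proof. by apply: (card_transport gB rowsE); apply: card_spin_edge. Qed.

Lemma degree_spin_rows x : #|[set e | x \in rows e]| <= 2.
Proof.
by rewrite (degree_transport (ordpair_bij _ _) rowsE); apply: degree_spin_edge mn_or piK _.
Qed.

Lemma inj_spin_rows : injective rows.
Proof. by apply: (inj_transport (ordpair_bij _ _) gB rowsE); apply: spin_edge_inj. Qed.

Lemma num_free_spin_rows : num_free rows = num_free (@spin_edge 'I_CN nx mn q mu).
Proof. exact: (num_free_transport (ordpair_bij _ _) gB rowsE). Qed.

Lemma num_free_spin_rows_ring (l : nat) (R : comNzRingType) (h : R) (a := 2 ^ mu.+1) :
  q.+1 = l.*2 -> odd l -> ((lucas a l).1%:R = 0 :> R)%R -> (2 * h = 1)%R ->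
  ((num_free rows)%:R = (a ^ (l * CN))%:R *
    (\sum_(S : {set 'I_n})
      2 ^ (\sum_(u < n) \sum_(w < n)
        if u == w then (ok u u && (u \in S)) * L
        else if u < w then [&& ~~ ok u w, u \in S & w \in S] * t else 0))%:R :> R)%R.
Proof.
move=> hq hl hV h2; rewrite num_free_spin_rows.
have nt_gt0 (c : 'I_CN) : 0 < n * t.
  have : 0 < CN by apply: leq_ltn_trans (leq0n c) (ltn_ord c).
  by rewrite /CN muln_gt0 => /andP[].
have cl_lt (c : 'I_CN) : c %/ (n * t) < n.
  by rewrite ltn_divLR // nt_gt0.
pose cl c := Ordinal (cl_lt c).
have rep_lt (u : 'I_n) : port n t u 0 0 < CN.
  by apply: port_lt => //; apply: leq_ltn_trans (leq0n u) (ltn_ord u).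
pose rep u := Ordinal (rep_lt u).
have cl_rep u : cl (rep u) = u.
  by apply: val_inj; rewrite /= port_div // (leq_ltn_trans (leq0n u) (ltn_ord u)).
have cl_nx c : cl (nx c) = cl c.
  by apply: val_inj; rewrite /= val_nx nextport_div.
have nx_conn (s : 'I_CN -> bool) : (forall c, s c = s (nx c)) ->
    forall c, s c = s (rep (cl c)).
  move=> H c; have nt0 := nt_gt0 c.
  suff all_r r (hr : r < n * t) (c' : 'I_CN) : c' = cl c * (n * t) + r :> nat ->
      s c' = s (rep (cl c)).
    by apply: (all_r (c %% (n * t))); rewrite ?ltn_pmod //= -divn_eq.
  elim: r hr c' => [|r IH] hr c' e.
    by congr s; apply: val_inj; rewrite /= /port !addn0 e addn0.
  have hlt : cl c * (n * t) + r < CN by apply: ltn_trans (ltn_ord c'); rewrite e ltn_add2l.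
  rewrite -(IH (ltnW hr) (Ordinal hlt)) // [RHS]H; congr s; apply: val_inj.
  rewrite /= val_nx /nextport e /= divnMDl // modnMDl (divn_small (ltnW hr)).
  by rewrite addn0 (modn_small (ltnW hr)) modn_small.
rewrite (num_free_spin piK mn_or mn_pi cl_rep cl_nx nx_conn hq hl hV h2).
rewrite card_ord; congr (_ * _)%R; rewrite natr_sum.
rewrite (reindex (fun S : {set 'I_n} => [ffun u => u \in S])) /=; last first.
  exists (fun s : {ffun 'I_n -> bool} => [set u | s u]) => [S _|s _].
    by apply/setP => u; rewrite inE ffunE.
  by apply/ffunP => u; rewrite ffunE inE.
apply: eq_bigr => S _; rewrite natrX; congr (_ ^+ _)%R.
pose sS u := if insub u is Some v then v \in S else false.
have sSE (u : 'I_n) : sS u = (u \in S) by rewrite /sS valK.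
transitivity (\sum_(u < n) \sum_(w < n) if u == w then (ok u u && sS u) * L
   else if u < w then [&& ~~ ok u w, sS u & sS w] * t else 0); last first.
  by apply: eq_bigr => u _; apply: eq_bigr => w _; rewrite !sSE.
rewrite -(matched_sum n ok t0 Lt sS).
rewrite -sum1_card big_mkcond; apply: eq_bigr => c _; rewrite inE !ffunE.
rewrite -(sSE (cl c)) -(sSE (cl (pi c))) /= -!val_eqE /= val_mn val_pi.
by [].
Qed.

End SpinRows.

Definition hard_rows (n t q Delta : nat) : nat :=
  n * (n * t) * q.+1 + Delta.

Definition spin_columns (n t q mu : nat) : nat := n * (n * t) * q.+1 * mu.+2.

Definition hard_columns (n t q mu Delta : nat) : nat :=
  spin_columns n t q mu + (Delta * mu.+2).+1.

Definition hard_entry (n t L : nat) (ok : nat -> nat -> bool) (q mu Delta e x : nat) : bool :=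
  if e < n * (n * t) * q.+1 then (x < spin_columns n t q mu) && spin_entry n t L ok q mu e x
  else [&& spin_columns n t q mu <= x &
    (x - spin_columns n t q mu == Delta * mu.+2) ||
    ((x - spin_columns n t q mu) %/ mu.+2 == e - n * (n * t) * q.+1)].

Section HardRows.

Variables (n t L : nat) (ok : nat -> nat -> bool) (q mu Delta : nat).
Hypotheses (t0 : 0 < t) (Lt : 2 * L <= t) (okC : forall u w, ok u w = ok w u) (q2 : 1 < q).
Hypothesis D2 : 2 <= Delta.

Let k1 := n * (n * t) * q.+1.
Let n1 := spin_columns n t q mu.

Notation rows := (@row_family (hard_rows n t q Delta) (hard_columns n t q mu Delta)
  (hard_entry n t L ok q mu Delta)).
Notation srows := (@row_family k1 n1 (spin_entry n t L ok q mu)).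
Notation frows := (@sunflower mu.+2 Delta).

Let splitB a b : bijective (@split a b).
Proof. exact: Bijective (@splitK a b) (@unsplitK a b). Qed.

Let rowsE (e : 'I_(k1 + Delta)) (x : 'I_(n1 + (Delta * mu.+2).+1)) :
  (x \in rows e) = (split x \in sum_family srows frows (split e)).
Proof.
rewrite inE /hard_entry in_sum_family -/k1 -/n1.
case: splitP => j ej; case: splitP => i ei; rewrite ?inE.
- by rewrite ej ei.
- by [].
- by rewrite ei leqNgt ltn_ord.
- by rewrite ej ei leq_addr !addKn.
Qed.

Lemma valid_hard_rows : valid_rows mu.+3 Delta (hard_rows n t q Delta)
  (hard_columns n t q mu Delta) (hard_entry n t L ok q mu Delta).
Proof.
have c1 := card_spin_rows ok mu t0 Lt q2; have c2 := @card_sunflower mu.+2 Delta isT.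
have inj : injective rows.
  apply: (inj_transport (splitB _ _) (splitB _ _) rowsE).
  apply: inj_sum_family => [||e].
  - exact: inj_spin_rows.
  - exact: sunflower_inj.
  - by rewrite -card_gt0 c1.
rewrite valid_rowsE; apply/andP; split; first exact/injectiveP.
have deg := degree_transport (splitB _ _) rowsE.
rewrite in_class_family //; apply/and3P; split.
- apply/forallP => e; apply/eqP; move: e.
  by apply: (card_transport (splitB _ _) rowsE); apply: card_sum_family; [apply: c1 | apply: c2].
- apply/forallP => x; rewrite deg degree_sum_family; case: (split x) => y.
    exact: leq_trans (degree_spin_rows t0 Lt okC y) D2.
  by rewrite degree_sunflower //; case: ifP => // _; apply: ltnW.
apply/orP; right; apply/existsP; exists (rshift n1 ord_max).
by rewrite deg (unsplitK (inr ord_max)) degree_sum_family degree_sunflower //= eqxx.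
Qed.

Lemma num_free_hard_rows : num_free rows = num_free srows * num_free frows.
Proof.
by rewrite (num_free_transport (splitB _ _) (splitB _ _) rowsE) num_free_sum_family.
Qed.

End HardRows.

(** * Parity and growth of the companion Lucas numbers *)

Section LucasBounds.

Variable a : nat.
Hypotheses (a0 : 0 < a) (a2 : ~~ odd a).

(** For even [a] the recurrence reads [V_(n+2) = V_(n+1)] modulo 2, and only [V_0 = 2] is even. *)
Lemma lucas_odd l : odd (lucas a l).2 && ((0 < l) ==> odd (lucas a l).1).
Proof.
elim: l => [|l IH]; first by rewrite /= oddB ?muln_gt0 // oddM.
rewrite lucasS /=; case/andP: IH => IH _.
by rewrite oddD !oddM (negbTE a2) addbF oddB ?muln_gt0 // oddM /= IH.
Qed.

Lemma lucas_ge l : 3 ^ l.+1 <= (lucas a l).2.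
Proof.
have a1 : 1 < a by case: (a) a0 a2 => [|[]].
elim: l => [|l IH]; first by rewrite /=; lia.
rewrite lucasS /= expnS; apply: leq_trans (leq_addr _ _).
by apply: leq_mul => //; lia.
Qed.

Lemma lucas1_gt l : odd l -> odd (lucas a l).1 /\ 2 ^ l < (lucas a l).1.
Proof.
case: l => // l _; have /andP[o _] := lucas_odd l; have ge := lucas_ge l.
by rewrite lucasS; split=> //; apply: leq_trans ge; rewrite ltn_exp2r.
Qed.

End LucasBounds.

Lemma eqmod_Zp (M x y : nat) : 1 < M -> (x%:R = y%:R :> 'Z_M)%R -> x = y %[mod M].
Proof. by move=> M1 /(congr1 val) /=; rewrite !val_Zp_nat. Qed.

(* [Z] is recovered from the number [N] of independent sets by dividing by the
   factor of the sunflower and by the power of two, modulo an odd Lucas number. *)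
Theorem num_free_hard_mod (n t L : nat) (ok : nat -> nat -> bool) (q mu Delta l : nat)
    (a := 2 ^ mu.+1) :
  0 < t -> 2 * L <= t -> (forall u w, ok u w = ok w u) -> 1 < q -> 2 <= Delta ->
  q.+1 = l.*2 -> odd l ->
  num_free (@row_family (hard_rows n t q Delta) (hard_columns n t q mu Delta)
    (hard_entry n t L ok q mu Delta)) %/ num_free (@sunflower mu.+2 Delta) =
  a ^ (l * (n * (n * t))) *
  (\sum_(S : {set 'I_n})
      2 ^ (\sum_(u < n) \sum_(w < n)
        if u == w then (ok u u && (u \in S)) * L
        else if u < w then [&& ~~ ok u w, u \in S & w \in S] * t else 0))
  %[mod (lucas a l).1].
Proof.
move=> t0 Lt okC q2 D2 hq hl.
rewrite num_free_hard_rows mulnK; last exact: num_free_sunflower.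
have [||Mo Ml] := @lucas1_gt a _ _ l hl; rewrite ?expn_gt0 ?oddX //.
set M := (lucas a l).1 in Mo Ml *; have M1 : 1 < M by apply: leq_ltn_trans Ml; rewrite expn_gt0.
apply: eqmod_Zp => //; rewrite natrM.
(* As [M] is odd, [(M + 1) / 2] is the inverse of 2 modulo [M]. *)
apply: (num_free_spin_rows_ring n t0 Lt okC (h := (M.+1./2)%:R%R)) => //.
  by apply: val_inj; rewrite /= val_Zp_nat // modnn.
have -> : (2 * M.+1./2%:R = (M + 1)%:R :> 'Z_M)%R.
  by rewrite -natrM; congr (_%:R)%R; have := odd_double_half M.+1; rewrite /= Mo; lia.
by apply: val_inj; rewrite /= !val_Zp_nat // modnDl Zp_cast.
Qed.

(** * Reading off the number of transversals *)

(* Vertex [u < N * K] stands for the choice of the value [u %% K] at the position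
   [u %/ K]; two distinct values at one position conflict. *)
Definition choice_ok (K : nat) (cmp : nat -> nat -> nat -> nat -> bool) (u w : nat) : bool :=
  [&& cmp (u %/ K) (u %% K) (w %/ K) (w %% K),
      cmp (w %/ K) (w %% K) (u %/ K) (u %% K) &
      (u %/ K == w %/ K) ==> (u %% K == w %% K)].

Section Transversals.

Variables (N K : nat) (cmp : nat -> nat -> nat -> nat -> bool).
Hypothesis K0 : 0 < K.

Notation n := (N * K).
Notation ok := (choice_ok K cmp).

Lemma choice_okC u w : ok u w = ok w u.
Proof.
by rewrite /choice_ok andbCA eq_sym [u %% K == _]eq_sym.
Qed.

Let clashes (S : {set 'I_n}) := \sum_(u < n) \sum_(w < n | u < w) [&& ~~ ok u w, u \in S & w \in S].
Let goods (S : {set 'I_n}) := \sum_(u < n) (ok u u && (u \in S)).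

Let exponentE L t (S : {set 'I_n}) :
  \sum_(u < n) \sum_(w < n)
    (if u == w then (ok u u && (u \in S)) * L
     else if u < w then [&& ~~ ok u w, u \in S & w \in S] * t else 0) =
  goods S * L + clashes S * t.
Proof.
rewrite /goods /clashes !big_distrl -big_split /=; apply: eq_bigr => u _.
rewrite (bigD1 u) //= eqxx; congr addn; rewrite big_distrl /= big_mkcond [RHS]big_mkcond /=.
apply: eq_bigr => w _; case: (eqVneq u w) => [->|uw]; first by rewrite ltnn.
by [].
Qed.

Let clashesP (S : {set 'I_n}) : reflect
  (forall u w : 'I_n, u \in S -> w \in S -> u != w -> ok u w) (clashes S == 0).
Proof.
rewrite /clashes sum_nat_eq0; apply: (iffP forallP) => /= [H u w hu hw uw|H u].
  wlog: u w hu hw uw / u < w => [W|huw].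
    by case: (ltngtP u w) => h; [apply: W|rewrite choice_okC; apply: W; rewrite // eq_sym|
      rewrite (val_inj h) eqxx in uw].
  have := H u; rewrite sum_nat_eq0 => /forall_inP /(_ w huw).
  by rewrite hu hw !andbT eqb0 negbK.
apply/eqP/big1 => w huw; apply/eqP; rewrite eqb0.
apply/negP => /and3P[h hu hw]; case/negP: h; apply: H => //.
by apply: contraTneq huw => ->; rewrite ltnn.
Qed.

Let block (u : 'I_n) : 'I_N := Ordinal (ltac:(by rewrite ltn_divLR) : u %/ K < N).

Let val_block u : val (block u) = u %/ K.
Proof. by []. Qed.

Let block_inj (S : {set 'I_n}) : clashes S == 0 -> {in S &, injective block}.
Proof.
move/clashesP => H u w hu hw e; apply/eqP/negPn/negP => uw.
have /and3P[_ _] := H _ _ hu hw uw.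
have eb : u %/ K = w %/ K by have := congr1 val e.
rewrite eb eqxx /= => /eqP em; case/eqP: uw; apply: val_inj.
by rewrite /= (divn_eq u K) (divn_eq w K) eb em.
Qed.

Let good_set (S : {set 'I_n}) : goods S = #|[set u in S | ok u u]|.
Proof.
rewrite -sum1_card [RHS]big_mkcond; apply: eq_bigr => u _; rewrite inE andbC.
by case: (_ && _).
Qed.

Let goods_le S : clashes S == 0 -> goods S <= N.
Proof.
move=> h; rewrite good_set; set G := [set u in S | _].
have : #|block @: G| <= N by apply: leq_trans (max_card _) _; rewrite card_ord.
rewrite card_in_imset //; move=> u w; rewrite !inE => /andP[hu _] /andP[hw _]; exact: (block_inj h).
Qed.

Definition transversals : {set {ffun 'I_N -> 'I_K}} :=
  [set F : {ffun 'I_N -> 'I_K} | [forall p : 'I_N, [forall p' : 'I_N, cmp p (F p) p' (F p')]]].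

Let of_fun (F : {ffun 'I_N -> 'I_K}) : {set 'I_n} := [set u : 'I_n | u %% K == F (block u)].

Let pt_lt (p : 'I_N) (k : 'I_K) : p * K + k < n.
Proof. by have := ltn_ord p; have := ltn_ord k; nia. Qed.

Let pt p k := Ordinal (pt_lt p k).

Let block_pt p k : block (pt p k) = p.
Proof. by apply: val_inj; rewrite /= divnMDl // divn_small ?addn0. Qed.

Let mod_pt p k : pt p k %% K = k.
Proof. by rewrite /= modnMDl modn_small. Qed.

Let of_fun_inj : injective of_fun.
Proof.
move=> F F' e; apply/ffunP => p; apply: val_inj => /=.
have : pt p (F p) \in of_fun F by rewrite inE block_pt mod_pt.
by rewrite e inE block_pt mod_pt => /eqP.
Qed.

Let goods_of_fun F : F \in transversals -> (clashes (of_fun F) == 0) && (goods (of_fun F) == N).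
Proof.
rewrite inE => /forallP H.
have okF u w : u \in of_fun F -> w \in of_fun F -> ok u w.
  rewrite !inE => /eqP hu /eqP hw; rewrite /choice_ok hu hw.
  have /forallP/(_ (block w)) := H (block u); have /forallP/(_ (block u)) := H (block w).
  rewrite /= => -> -> /=; apply/implyP => /eqP e.
  by have -> : block u = block w by apply: val_inj.
apply/andP; split; first by apply/clashesP => u w hu hw _; apply: okF.
rewrite good_set (_ : [set u in _ | _] = of_fun F); last first.
  by apply/setP => u; rewrite inE; case: (boolP (u \in _)) => //= hu; apply: okF.
have -> : of_fun F = [set pt p (F p) | p : 'I_N].
  apply/setP => u; rewrite inE; apply/eqP/imsetP => [e|[p _ ->]]; last by rewrite block_pt mod_pt.
  by exists (block u) => //; apply: val_inj; rewrite /= -e -divn_eq.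
rewrite card_imset ?card_ord ?eqxx // => p p' e.
by rewrite -(block_pt p (F p)) e block_pt.
Qed.

(** A conflict-free set has at most one member per position. If [N] of its members are compatible
    with themselves, they fill all positions, so no other member is left. *)
Let transversal_of S : clashes S == 0 -> goods S = N -> exists2 F, F \in transversals & S = of_fun F.
Proof.
move=> hc; rewrite good_set; set G := [set u in S | ok u u] => hG.
have GS u : u \in G -> u \in S by rewrite inE => /andP[].
have bG : block @: G = setT.
  apply/eqP; rewrite eqEcard subsetT cardsT card_ord card_in_imset ?hG ?leqnn //.
  by move=> u w /GS hu /GS hw; apply: (block_inj hc).
have ex p : exists u, (u \in G) && (block u == p).
  have : p \in block @: G by rewrite bG inE.
  by case/imsetP => u hu ->; exists u; rewrite hu eqxx.
pose s p := xchoose (ex p); have sP p : (s p \in G) /\ block (s p) = p.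
  by have /andP[h /eqP] := xchooseP (ex p).
have smod p : s p %% K < K by rewrite ltn_pmod.
pose F : {ffun 'I_N -> 'I_K} := [ffun p => Ordinal (smod p)].
have inS u : u \in S -> u = s (block u).
  by move=> hu; apply: (block_inj hc) => //; [apply: GS; apply: (sP _).1 | rewrite (sP _).2].
have S_F : S = of_fun F.
  apply/setP => u; rewrite inE ffunE /=; apply/idP/eqP => [/inS {1}->//|e].
  suff -> : u = s (block u) by apply: GS; apply: (sP _).1.
  apply: val_inj; rewrite /= (divn_eq u K) e [RHS](divn_eq _ K); congr (_ * K + _).
  by have := congr1 val (sP (block u)).2.
exists F => //; rewrite inE; apply/forallP => p; apply/forallP => p'; rewrite !ffunE /=.
have [hp bp] := sP p; have [hp' bp'] := sP p'.
have : ok (s p) (s p').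
  case: (eqVneq (s p) (s p')) => [e|ne]; last by move/clashesP: hc; apply => //; apply: GS.
  by move: hp'; rewrite inE -e => /andP[].
case/and3P => h _ _; move: h; by rewrite -!val_block bp bp'.
Qed.

Let card_extract : #|[set S | (clashes S == 0) && (goods S == N)]| = #|transversals|.
Proof.
rewrite -(card_imset _ of_fun_inj); apply: eq_card => S; rewrite inE.
apply/andP/imsetP => [[h /eqP h']|[F hF ->]]; last exact/andP/goods_of_fun.
by have [F hF ->] := transversal_of h h'; exists F.
Qed.

(** Conflicting sets contribute multiples of [2 ^ t]. There are [2 ^ n] sets, so the conflict-free
    ones with fewer than [N] good members sum to at most [2 ^ n * 2 ^ (L * N.-1)], below
    [2 ^ (L * N)] since [L > n]. The number of transversals is at most [2 ^ n], so the part without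
    conflicts stays below [2 ^ (L + L * N) = 2 ^ t]. *)
Lemma extract_transversals (L := n.+1) (t := n.+1 + n.+1 * N) :
  (\sum_(S : {set 'I_n})
      2 ^ (\sum_(u < n) \sum_(w < n)
        if u == w then (ok u u && (u \in S)) * L
        else if u < w then [&& ~~ ok u w, u \in S & w \in S] * t else 0))
   %% 2 ^ t %/ 2 ^ (L * N) = #|transversals|.
Proof.
under eq_bigr do rewrite exponentE.
rewrite (bigID (fun S => clashes S == 0)) /= -card_extract.
set A := #|_|; pose B := \sum_(S | (clashes S == 0) && (goods S != N)) 2 ^ (goods S * L).
have -> : \sum_(S | clashes S == 0) 2 ^ (goods S * L + clashes S * t) = A * 2 ^ (L * N) + B.
  rewrite (bigID (fun S => goods S == N)) /=; congr addn.
    rewrite (eq_bigr (fun=> 2 ^ (L * N))).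
      by rewrite sum_nat_const; congr (_ * _); apply: eq_card => S; rewrite inE.
    by move=> S /andP[/eqP -> /eqP ->]; rewrite mul0n addn0 mulnC.
  by apply: eq_bigr => S /andP[/eqP -> _]; rewrite mul0n addn0.
have -> : \sum_(S | clashes S != 0) 2 ^ (goods S * L + clashes S * t) =
    (\sum_(S | clashes S != 0) 2 ^ (goods S * L + (clashes S).-1 * t)) * 2 ^ t.
  rewrite big_distrl /=; apply: eq_bigr => S h; rewrite -expnD -addnA -mulSnr prednK //.
  by rewrite lt0n.
have hB : B < 2 ^ (L * N).
  case: (posnP N) => [N0|N0].
    rewrite /B big_pred0 ?expn_gt0 // => S; apply/negbTE; rewrite negb_and negbK -implybE.
    by apply/implyP => /goods_le; lia.
  apply: (@leq_ltn_trans (\sum_(S : {set 'I_n}) 2 ^ (L * N.-1))).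
    rewrite /B big_mkcond; apply: leq_sum => S _; case: ifP => // /andP[h h'].
    rewrite leq_exp2l // mulnC leq_mul2l; apply/orP; right.
    by rewrite -ltnS prednK // ltn_neqAle h' goods_le.
  rewrite sum_nat_const -cardsT -powersetT card_powerset cardsT card_ord.
  rewrite -expnD ltn_exp2l //.
  have -> : L * N = L + L * N.-1 by rewrite -mulnS prednK.
  by rewrite ltn_add2r.
have hA : A <= 2 ^ n.
  by apply: leq_trans (max_card _) _; rewrite -cardsT -powersetT card_powerset cardsT card_ord.
rewrite addnC modnMDl modn_small; last first.
  rewrite /t expnD -/L; apply: (@leq_trans ((A + 1) * 2 ^ (L * N))).
    by rewrite mulnDl mul1n ltn_add2l.
  by rewrite leq_mul2r; apply/orP; right; rewrite expnS mul2n -addnn leq_add // expn_gt0.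
by rewrite divnMDl ?expn_gt0 // divn_small ?addn0.
Qed.

End Transversals.

(** * Tilings by the space-time diagrams of a cellular automaton *)

(* A row has the cells [0, ..., 2 * T]; the update of a cell reads, besides its two
   neighbours (cut off at the ends of the row), the central cell [T]. *)
Section Automaton.

Variables (A : finType) (a0 : A) (upd : nat -> A -> A -> A -> A -> A).
Variables (ini : nat -> pred A) (fin : pred A) (ku ki : nat -> nat) (T : nat).

Notation W := (T + T).
Notation w := (W.+1).
Notation tile := (A * A * A * A)%type.
Notation K := #|{: tile}|.
Notation N := (T.+1 * w).

Fixpoint evolve (r : nat -> A) (t z : nat) : A :=
  if t is t'.+1 then
    upd (ku z) (evolve r t' T) (evolve r t' z.-1) (evolve r t' z) (evolve r t' (minn z.+1 W))
  else r z.

Definition nth_tile (k : nat) : tile := nth (a0, a0, a0, a0) (enum {: tile}) k.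
Definition center (x : tile) := x.1.1.1.
Definition left (x : tile) := x.1.1.2.
Definition mid (x : tile) := x.1.2.
Definition right (x : tile) := x.2.

(* A tile of the cell [z] of row [t] records the cells that the update of [z] reads:
   the central one, the left and right neighbours, and [z] itself in the middle. *)
Definition tiles_ok (p k p' k' : nat) : bool :=
  let t := p %/ w in let z := p %% w in let t' := p' %/ w in let z' := p' %% w in
  let x := nth_tile k in let y := nth_tile k' in
  [&& (t == t') && (z' == T) ==> (center x == mid y),
      (t == t') && (z' == z.-1) ==> (left x == mid y),
      (t == t') && (z' == minn z.+1 W) ==> (right x == mid y),
      (t' == t.+1) && (z' == z) ==> (upd (ku z) (center x) (left x) (mid x) (right x) == mid y),
      (t == 0) ==> ini (ki z) (mid x) &
      (t == T) && (z == T) ==> fin (mid x)].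

Definition cells_of (r : {ffun 'I_w -> A}) (z : nat) : A := r (inord z).

Lemma nth_tile_rank (x : tile) : nth_tile (enum_rank x) = x.
Proof. exact: nth_enum_rank. Qed.

Let pos_lt t z : t <= T -> z < w -> t * w + z < N.
Proof. by nia. Qed.

Let pos_div t z : z < w -> (t * w + z) %/ w = t.
Proof. by move=> h; rewrite divnMDl // (divn_small h) addn0. Qed.

Let pos_mod t z : z < w -> (t * w + z) %% w = z.
Proof. by move=> h; rewrite modnMDl (modn_small h). Qed.

Let T_lt : T < w. Proof. by lia. Qed.
Let pred_lt z : z < w -> z.-1 < w. Proof. by lia. Qed.
Let next_lt z : minn z.+1 W < w. Proof. by lia. Qed.

Let diagram (r : {ffun 'I_w -> A}) : {ffun 'I_N -> 'I_K} :=
  [ffun p : 'I_N => let e := evolve (cells_of r) (p %/ w) in let z := p %% w in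
    enum_rank (e T, e z.-1, e z, e (minn z.+1 W))].

Let diagram_inj : injective diagram.
Proof.
move=> r r' e; apply/ffunP => z.
have h : z < N by have := ltn_ord z; nia.
have /ffunP/(_ (Ordinal h)) := e; rewrite !ffunE => /enum_rank_inj[_ _ + _] /=.
by rewrite (divn_small (ltn_ord z)) (modn_small (ltn_ord z)) /= /cells_of inord_val.
Qed.

Let diagram_ok r : (diagram r \in transversals N K tiles_ok) =
  [forall z : 'I_w, ini (ki z) (r z)] && fin (evolve (cells_of r) T T).
Proof.
rewrite inE; apply/forallP/andP => [H|[/forallP hi hf] p].
  split.
    apply/forallP => z; have h : z < N by have := ltn_ord z; nia.
    have /forallP/(_ (Ordinal h)) := H (Ordinal h).
    rewrite /tiles_ok !ffunE nth_tile_rank (divn_small (ltn_ord z)) (modn_small (ltn_ord z)).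
    by case/and5P => _ _ _ _ /andP[/= + _]; rewrite /mid /= /cells_of inord_val.
  have h : T * w + T < N by apply: pos_lt.
  have /forallP/(_ (Ordinal h)) := H (Ordinal h).
  rewrite /tiles_ok !ffunE nth_tile_rank (pos_div _ T_lt) (pos_mod _ T_lt).
  by case/and5P => _ _ _ _ /andP[_]; rewrite eqxx.
apply/forallP => p'; rewrite /tiles_ok !ffunE !nth_tile_rank /center /left /mid /right /=.
have zw : p %% w < w by rewrite ltn_pmod.
apply/and5P; split; [by apply/implyP => /andP[/eqP -> /eqP ->]
  | by apply/implyP => /andP[/eqP -> /eqP ->] | by apply/implyP => /andP[/eqP -> /eqP ->]
  | by apply/implyP => /andP[/eqP -> /eqP ->] |].
apply/andP; split; last by apply/implyP => /andP[/eqP -> /eqP ->].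
apply/implyP => /eqP -> /=; rewrite /cells_of -[X in ki X](inordK zw); exact: hi.
Qed.

(** Agreement within a row makes each tile a faithful copy of its neighbourhood; agreement with the
    next row then reproduces the evolution, by induction on time. *)
Let of_transversal F : F \in transversals N K tiles_ok -> exists r, F = diagram r.
Proof.
rewrite inE => /forallP H.
have h0 (z : 'I_w) : z < N by have := ltn_ord z; nia.
pose x p := nth_tile (F p).
pose r : {ffun 'I_w -> A} := [ffun z => mid (x (Ordinal (h0 z)))].
have midE t z (ht : t <= T) (hz : z < w) : mid (x (Ordinal (pos_lt ht hz))) = evolve (cells_of r) t z /\
    center (x (Ordinal (pos_lt ht hz))) = mid (x (Ordinal (pos_lt ht T_lt))) /\
    left (x (Ordinal (pos_lt ht hz))) = mid (x (Ordinal (pos_lt ht (pred_lt hz)))) /\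
    right (x (Ordinal (pos_lt ht hz))) = mid (x (Ordinal (pos_lt ht (next_lt z)))).
  have row_ok t' z' (ht' : t' <= T) (hz' : z' < w) :
    center (x (Ordinal (pos_lt ht' hz'))) = mid (x (Ordinal (pos_lt ht' T_lt))) /\
    left (x (Ordinal (pos_lt ht' hz'))) = mid (x (Ordinal (pos_lt ht' (pred_lt hz')))) /\
    right (x (Ordinal (pos_lt ht' hz'))) = mid (x (Ordinal (pos_lt ht' (next_lt z')))).
    have /forallP G := H (Ordinal (pos_lt ht' hz')); split; [|split].
    - have := G (Ordinal (pos_lt ht' T_lt)).
      by rewrite /tiles_ok /= !pos_div // !pos_mod // !eqxx => /and5P[/eqP].
    - have := G (Ordinal (pos_lt ht' (pred_lt hz'))).
      by rewrite /tiles_ok /= !pos_div ?pred_lt // !pos_mod ?pred_lt // !eqxx => /and5P[_ /eqP].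
    - have := G (Ordinal (pos_lt ht' (next_lt z'))).
      by rewrite /tiles_ok /= !pos_div // !pos_mod // !eqxx => /and5P[_ _ /eqP].
  split; last exact: row_ok.
  elim: t => [|t IH] in z ht hz *.
    rewrite /= /cells_of ffunE; congr (mid (x _)); apply: val_inj => /=.
    by rewrite mul0n add0n inordK.
  have ht' : t <= T by lia.
  have /forallP/(_ (Ordinal (pos_lt ht hz))) := H (Ordinal (pos_lt ht' hz)).
  rewrite /tiles_ok /= !pos_div // !pos_mod // !eqxx => /and5P[_ _ _ /eqP <- _].
  have [e0 [el er]] := row_ok _ _ ht' hz; rewrite -!/(x _) e0 el er.
  by rewrite (IH _ ht' T_lt) (IH _ ht' (pred_lt hz)) (IH _ ht' hz) (IH _ ht' (next_lt z)).
exists r; apply/ffunP => p; rewrite ffunE; apply: (canRL (@enum_valK _)).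
have hz : p %% w < w by rewrite ltn_pmod.
have ht : p %/ w <= T by rewrite -ltnS ltn_divLR // ltn_ord.
have -> : enum_val (F p) = x p by rewrite /x /nth_tile (enum_val_nth (a0, a0, a0, a0)).
have -> : p = Ordinal (pos_lt ht hz) by apply: val_inj; rewrite /= -divn_eq.
rewrite /= pos_div // pos_mod //.
have [e1 [e2 [e3 e4]]] := midE _ _ ht hz; move: e1 e2 e3 e4.
rewrite (midE _ _ ht T_lt).1 (midE _ _ ht (pred_lt hz)).1 (midE _ _ ht (next_lt _)).1.
by rewrite /center /left /mid /right; case: (x _) => [[[? ?] ?] ?] /= -> -> -> ->.
Qed.

(** The automaton is deterministic, so a tiling is determined by its first row and counting tilings
    is counting admissible first rows. *)
Lemma card_tilings : #|transversals N K tiles_ok| =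
  #|[set r : {ffun 'I_w -> A} | [forall z : 'I_w, ini (ki z) (r z)] & fin (evolve (cells_of r) T T)]|.
Proof.
rewrite -[RHS](card_imset _ diagram_inj); apply: eq_card => F; apply/idP/imsetP => [hF|[r + ->]].
  by have [r e] := of_transversal hF; exists r => //; rewrite inE -diagram_ok -e.
by rewrite inE -diagram_ok.
Qed.

End Automaton.

(** * Counting accepting computations by tilings *)

(** The certificate is a suffix of the verifier's input, so the initial row shows known bits
    followed by unknown ones. *)
Lemma pair_word_cat (x y : word) : pair_word x y = pair_word x [::] ++ y.
Proof. by rewrite /pair_word -catA. Qed.

(* The tapes are viewed from the head, which scans the cell [c]; the moves of the
   head become shifts of the tapes. *)
Definition cell (c : nat) (t : tape) (z : nat) : symbol :=
  if z < c then nth None (behind t) (c - z.+1) else nth None (ahead t) (z - c).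

(** The kinds 1, 2 and 3 are the cells left of, at and right of the head: where the written symbol
    lands when the head moves right, stays or moves left. *)
Definition update_kind (c z : nat) : nat :=
  if z.+1 == c then 1 else if z == c then 2 else if z == c.+1 then 3 else 0.

Lemma cell_move c d s t z : 0 < z ->
  cell c (move_tape d (write_tape s t)) z =
  match d with
  | MoveLeft => if update_kind c z == 3 then s else cell c t z.-1
  | Stay => if update_kind c z == 2 then s else cell c t z
  | MoveRight => if update_kind c z == 1 then s else cell c t z.+1
  end.
Proof.
move=> z0; rewrite /update_kind /cell; case: t => b a; case: d => /=.
- case: (ltngtP z c) => h.
  + have -> : z == c.+1 = false by lia.
    have -> : z.-1 < c by lia.
    have -> : c - z.-1.+1 = (c - z.+1).+1 by lia.
    by rewrite nth_behead; case: (z.+1 == c).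
  + have -> : z.+1 == c = false by lia.
    case: (z =P c.+1) => [->|ne]; first by rewrite subSnn.
    have -> : z.-1 < c = false by lia.
    have -> : z - c = (z - c.+2).+2 by lia.
    have -> : z.-1 - c = (z - c.+2).+1 by lia.
    by rewrite /= nth_behead.
  + rewrite h subnn ltn_predL; have -> : c.+1 == c = false by lia.
    have -> : 0 < c by lia.
    have -> : c - c.-1.+1 = 0 by lia.
    by case: (b).
- case: (ltngtP z c) => h.
  + have -> : z == c.+1 = false by lia.
    by case: (z.+1 == c).
  + have -> : z.+1 == c = false by lia.
    have -> : z - c = (z - c.+1).+1 by lia.
    by rewrite /= nth_behead; case: (z == c.+1).
  + rewrite h subnn; have -> : c.+1 == c = false by lia.
    by [].
- case: (z.+1 =P c) => [<-|ne]; first by rewrite ltnSn subnn.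
  case: (ltnP z c) => h.
  + have -> : z.+1 < c by lia.
    have -> : c - z.+1 = (c - z.+2).+1 by lia.
    by case: (z == c) => //; case: (z == c.+1).
  + have -> : z.+1 < c = false by lia.
    have -> : z.+1 - c = (z - c).+1 by lia.
    by rewrite nth_behead; case: (z == c) => //; case: (z == c.+1).
Qed.

(** * An oracle-free machine as a cellular automaton centred at its heads *)

Section Machine.

Variable M : machine.
Hypothesis M_free : oracle_free M.

Definition snapshot := (state M * {ffun 'I_(work_tapes M).+2 -> symbol})%type.

Definition snapshot0 : snapshot := (start M, [ffun=> None]).

Definition update (j : nat) (a0 al am ar : snapshot) : snapshot :=
  match Defs.next a0.1 a0.2 with
  | Act q f => (q, [ffun i => match (f i).2 with
      | MoveLeft => if j == 3 then (f i).1 else al.2 i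
      | Stay => if j == 2 then (f i).1 else am.2 i
      | MoveRight => if j == 1 then (f i).1 else ar.2 i
      end])
  | _ => am
  end.

(* The kind of a cell of the initial row: [0] is blank, [1] and [2] carry a known
   bit, and [3] an unknown one. *)
Definition initial (j : nat) : pred snapshot := fun a =>
  [&& a.1 == start M, [forall i, (i != ord0) ==> (a.2 i == None)] &
      match j with
      | 0 => a.2 ord0 == None
      | 1 => a.2 ord0 == Some false
      | 2 => a.2 ord0 == Some true
      | _ => a.2 ord0 != None
      end].

Definition initial_kind (v : word) (P c z : nat) : nat :=
  if z < c then 0 else if z - c < size v then (nth false v (z - c)).+1
  else if z - c < size v + P then 3 else 0.

Definition accepting : pred snapshot := fun a => a.2 ord0 == Some true.

Definition view (T : nat) (c : config M) (z : nat) : snapshot :=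
  (cstate c, [ffun i => cell T (tapes c i) z]).

Lemma view_step O T c z : 0 < z -> z < T + T ->
  view T (step O c) z =
  update (update_kind T z) (view T c T) (view T c z.-1) (view T c z) (view T c (minn z.+1 (T + T))).
Proof.
move=> z0 zT; rewrite /update /step /next_action (minn_idPl zT).
have -> : (view T c T).2 = [ffun i => read_tape (tapes c i)].
  by apply/ffunP => i; rewrite !ffunE /cell ltnn subnn nth0.
rewrite /=; case E: (Defs.next _ _) => [|q f|q] //; last by case: (M_free E).
rewrite /view /=; congr pair; apply/ffunP => i; rewrite !ffunE cell_move //.
Qed.

(** The ends of the row are updated wrongly, but the error travels one cell per step, so the centre
    is still correct at time [T]. *)
Lemma evolve_view O T r c t z :
  (forall z, z <= T + T -> r z = view T c z) -> t <= z -> z <= T + T - t ->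
  evolve update (update_kind T) T r t z = view T (iter t (step O) c) z.
Proof.
move=> hr; elim: t => [|t IH] in z * => tz zt; first by apply: hr; lia.
rewrite /= (@view_step O) ?IH //; try lia.
Qed.

Variables (V : pred word) (v : word) (P T p : nat).
Hypothesis vT : size v + P <= T.
Hypothesis pT : p <= T.
Hypothesis decides : forall y : P.-tuple bool,
  computes_within M (fun=> [::]) (v ++ y) [:: V (v ++ y)] p.

Notation w := (T + T).+1.

Let first_row (y : P.-tuple bool) : {ffun 'I_w -> snapshot} :=
  [ffun z : 'I_w => view T (init M (v ++ y)) z].

Let cell_init (y : word) z :
  cell T (tape_of_word y) z = if z < T then None else nth None (map Some y) (z - T).
Proof. by rewrite /cell /=; case: ifP => //; rewrite nth_nil. Qed.

Let iter_halted O c n : halted c -> iter n (step O) c = c :> config M.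
Proof.
move=> h; elim: n => //= n ->; move: h; rewrite /halted /step.
by case: (next_action c).
Qed.

(** By time [T] the machine has halted with a one-bit output, so the scanned cell of tape 0 holds
    the verdict. *)
Let accepting_first_row y :
  accepting (evolve update (update_kind T) T (cells_of (first_row y)) T T) = V (v ++ y).
Proof.
rewrite (@evolve_view (fun=> [::]) _ _ (init M (v ++ y))) //; last by lia.
  rewrite -(subnK pT) iterD; have [h hw] := decides y; rewrite iter_halted //.
  rewrite /accepting /view /= ffunE /cell ltnn subnn.
  move: hw; rewrite /word_of_tape; case: (ahead _) => [|[b|] s] //=.
  by case=> ->; case: V.
by move=> z hz; rewrite /cells_of ffunE inordK.
Qed.

Let first_row_initial y : [forall z : 'I_w, initial (initial_kind v P T z) (first_row y z)].
Proof.
apply/forallP => z; rewrite ffunE /initial /= eqxx ffunE /=.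
apply/andP; split.
  apply/forallP => i; apply/implyP => i0; rewrite ffunE /= ffunE (negbTE i0) cell_init.
  by rewrite nth_nil if_same.
rewrite ffunE /= cell_init /initial_kind; case: ifP => // _.
case: ifP => h1.
  rewrite (nth_map false) ?size_cat ?(leq_trans h1) ?leq_addr // nth_cat h1.
  by case: nth.
case: ifP => h2; last by rewrite nth_default // size_map size_cat size_tuple leqNgt h2.
by rewrite (nth_map false) // size_cat size_tuple.
Qed.

Let idx_lt i : i < P -> T + size v + i < w.
Proof. by lia. Qed.

Let first_row_inj : injective first_row.
Proof.
move=> y y' e; apply: eq_from_tnth => i.
have /ffunP/(_ (Ordinal (idx_lt (ltn_ord i)))) := e; rewrite !ffunE => -[/ffunP/(_ ord0)].
rewrite !ffunE /= !cell_init.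
have -> : T + size v + i < T = false by lia.
have -> : T + size v + i - T = size v + i by lia.
rewrite !(nth_map false) ?size_cat ?size_tuple ?ltn_add2l // => -[].
rewrite !nth_cat; have -> : size v + i < size v = false by lia.
by rewrite addKn !(tnth_nth false).
Qed.

Let first_rowP (r : {ffun 'I_w -> snapshot}) :
  [forall z : 'I_w, initial (initial_kind v P T z) (r z)] -> exists y, r = first_row y.
Proof.
move=> /forallP H; pose b (i : 'I_P) := odflt false ((r (Ordinal (idx_lt (ltn_ord i)))).2 ord0).
exists [tuple b i | i < P]; apply/ffunP => z; rewrite ffunE.
have /and3P[/eqP e1 /forallP e2 e3] := H z.
rewrite [r z]surjective_pairing e1; congr pair; apply/ffunP => i; rewrite !ffunE.
case: (eqVneq i ord0) => [->{i}|i0]; last first.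
  by have /implyP/(_ i0)/eqP -> := e2 i; rewrite cell_init nth_nil if_same.
rewrite cell_init; move: e3; rewrite /initial_kind; case: ltnP => hz; first by move/eqP.
case: ifP => h1.
  rewrite (nth_map false) ?size_cat ?(leq_trans h1) ?leq_addr // nth_cat h1.
  by case: nth => /eqP.
case: ifP => h2 => [|/eqP ->]; last by rewrite nth_default // size_map size_cat size_tuple leqNgt h2.
rewrite (nth_map false) ?size_cat ?size_tuple // nth_cat h1.
have h3 : z - T - size v < P by lia.
rewrite (_ : nth _ _ _ = b (Ordinal h3)); last first.
  by rewrite -(tnth_nth false _ (Ordinal h3)) tnth_mktuple.
rewrite /b; have -> : Ordinal (idx_lt (ltn_ord (Ordinal h3))) = z.
  by apply: val_inj => /=; lia.
by case: ((r z).2 ord0).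
Qed.

(** The admissible first rows are the initial configurations on [v ++ y], one for each [y], since
    only the certificate cells are free. *)
Lemma card_accepting_tilings :
  #|transversals (T.+1 * w) #|{: snapshot * snapshot * snapshot * snapshot}|
     (tiles_ok snapshot0 update initial accepting (update_kind T) (initial_kind v P T) T)| =
  #|[set y : P.-tuple bool | V (v ++ y)]|.
Proof.
rewrite card_tilings -[RHS](card_imset _ first_row_inj); apply: eq_card => r.
rewrite inE; apply/andP/imsetP => [[/first_rowP[y ->]]|[y + ->]].
  by rewrite accepting_first_row => h; exists y; rewrite // inE.
by rewrite inE -accepting_first_row => ?; split.
Qed.

End Machine.

(** * The reduction in polynomial time *)

(** Division by [2 ^ k] modulo an odd [M] by repeated halving, adding [M] first to an odd number; no
    modular inverse has to be computed. *)
Fixpoint halve_mod (M k y : nat) : nat :=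
  if k is k'.+1 then halve_mod M k' (if odd y then (y + M)./2 else y./2) else y.

Lemma halve_mod_lt M k y : y < M -> halve_mod M k y < M.
Proof. by elim: k y => //= k IH y hy; apply: IH; case: ifP; lia. Qed.

Lemma halve_modK M k z : odd M -> z < M -> halve_mod M k (2 ^ k * z %% M) = z.
Proof.
move=> oM hz; have M0 : 0 < M by lia.
elim: k => [|k IH] /=; first by rewrite mul1n modn_small.
set y := _ %% M; have hy : y < M by rewrite ltn_pmod.
rewrite -[RHS]IH; congr halve_mod.
set y' := if _ then _ else _; have hy' : y' < M by rewrite /y'; case: ifP; lia.
rewrite -[LHS](modn_small hy'); apply/eqP.
(* Since 2 is cancellable modulo [M], it is enough to compare doubles. *)
have c2 : coprime M 2 by rewrite coprimen2.
have h : 2 * y' = 2 * (2 ^ k * z) %[mod M].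
  rewrite mulnA -expnS -[RHS]modn_mod -/y /y' mul2n; case: ifP => oy.
    have -> : ((y + M)./2).*2 = y + M by lia.
    by rewrite modnDr.
  by have -> : (y./2).*2 = y by lia.
case/orP: (leq_total y' (2 ^ k * z)) => le; move/eqP: h.
  by rewrite eq_sym eqn_mod_dvd ?leq_mul2l // -mulnBr Gauss_dvdr // -eqn_mod_dvd // eq_sym.
by rewrite eqn_mod_dvd ?leq_mul2l // -mulnBr Gauss_dvdr // -eqn_mod_dvd.
Qed.

Section Reduction.

Variable O : oracle.

Notation fp := (fp O).

Lemma fp_bounded (A B : code) K (f : nat -> B) (n : A -> nat) :
  (forall a, n a < K) -> fp n -> fp (fun a => f (n a)).
Proof.
move=> hK Hn; apply: fp_ext (fp_table K (f 0) f Hn) => a.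
by rewrite hK.
Qed.

Lemma fp_table3 (A B : code) J K (f : nat -> nat -> nat -> B) (j k k' : A -> nat) :
  (forall a, j a < J) -> (forall a, k a < K) -> (forall a, k' a < K) ->
  fp j -> fp k -> fp k' -> fp (fun a => f (j a) (k a) (k' a)).
Proof.
move=> hj hk hk' Hj Hk Hk'; pose i a := (j a * K + k a) * K + k' a.
apply: (fp_ext (f := fun a => f (i a %/ K %/ K) (i a %/ K %% K) (i a %% K))).
  move=> a; have K0 : 0 < K by apply: leq_ltn_trans (hk a).
  rewrite /i divnMDl // modnMDl (divn_small (hk' a)) (modn_small (hk' a)) addn0.
  by rewrite divnMDl // modnMDl (divn_small (hk a)) (modn_small (hk a)) addn0.
apply: (@fp_bounded _ _ (J * K * K) (fun i => f (i %/ K %/ K) (i %/ K %% K) (i %% K))) => [a|].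
  by have := hj a; have := hk a; have := hk' a; rewrite /i; nia.
by rewrite /i; fp_auto.
Qed.

Lemma fp_halve_mod (A : code) (M k y : A -> nat) : (forall a, y a < M a) ->
  fp (fun a => Bnat (M a)) -> fp k -> fp (fun a => Bnat (y a)) ->
  fp (fun a => Bnat (halve_mod (M a) (k a) (y a))).
Proof.
move=> hy HM Hk Hy.
pose F (a : A) (x : bnat) := if odd (bval x) then Bnat (bval x + M a)./2 else Bnat (bval x)./2.
have FE a i z : iter i (F a) (Bnat z) = Bnat (halve_mod (M a) i z).
  by elim: i z => // i IH z; rewrite iterSr /F /=; case: (odd z); rewrite IH.
apply: (fp_ext (f := fun a => iter (k a) (F a) (Bnat (y a)))) => [a|]; first exact: FE.
apply: (fp_iter (F := F) (T := fun a => sz (Bnat (M a)))) => //.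
- have HM' : fp (fun p : A * bnat => Bnat (M p.1)).
    by apply: (fp_comp HM (f := fst)); fp_auto.
  by rewrite /F; fp_auto.
- exact: fp_sz HM.
move=> a i _; rewrite FE !sz_bnat; apply: size_binary_mono.
exact: ltnW (halve_mod_lt _ (hy a)).
Qed.

Lemma fp_lucas (A : code) c (l : A -> nat) : fp l -> fp (fun a => Bnat (lucas c (l a)).1).
Proof.
move=> Hl; pose F (x : bnat * bnat) := (x.2, Bnat ((2 * c - 1) * bval x.2 + c * bval x.1)).
have FE i : iter i F (Bnat 2, Bnat (2 * c - 1)) = (Bnat (lucas c i).1, Bnat (lucas c i).2).
  by elim: i => // i IH; rewrite iterS IH lucasS.
have H : fp (fun a => iter (l a) F (Bnat 2, Bnat (2 * c - 1))).
  pose s := size (binary (3 * c + 2)).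
  apply: (fp_iter (F := fun _ => F) (T := fun a => s * (l a).+1 + s * (l a).+1)) => //.
  - by fp_auto.
  - by rewrite /F; fp_auto.
  - by apply: (@fp_pb O); fp_auto.
  move=> a i hi.
  (* A geometric bound, so the iterates have linearly many digits. *)
  have le : ((lucas c i).1 <= (3 * c + 2) ^ i.+1) && ((lucas c i).2 <= (3 * c + 2) ^ i.+1).
    elim: i {hi} => [|i /andP[h1 h2]]; first by rewrite expn1 /=; lia.
    rewrite lucasS /= expnS; move: (lucas c i) (_ ^ i.+1) h1 h2 => [x y] w /= h1 h2.
    have h3 : (2 * c - 1) * y <= 2 * c * w by rewrite leq_mul // leq_subr.
    have h4 : c * x <= c * w by rewrite leq_mul.
    by apply/andP; split; nia.
  have lt : (3 * c + 2) ^ i.+1 < 2 ^ (s * (l a).+1).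
    apply: (@leq_trans (2 ^ (s * i.+1))).
      by rewrite expnM ltn_exp2r // ltn_size_binary.
    by rewrite leq_exp2l // leq_mul2l ltnS hi orbT.
  case/andP: le => h1 h2; rewrite FE sz_pair !sz_bnat leq_add // size_binary_le.
    exact: leq_ltn_trans h1 lt.
  exact: leq_ltn_trans h2 lt.
apply: (fp_ext (f := fun a => (iter (l a) F (Bnat 2, Bnat (2 * c - 1))).1)) => [a|].
  by rewrite FE.
by fp_auto.
Qed.

Lemma fp_hard_entry (A : code) (n t L q e x : A -> nat) (ok : A * (nat * nat) -> bool) mu Delta :
  fp n -> fp t -> fp L -> fp q -> fp e -> fp x -> fp ok ->
  fp (fun a => hard_entry (n a) (t a) (L a) (fun u w => ok (a, (u, w))) (q a) mu Delta (e a) (x a)).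
Proof.
move=> Hn Ht HL Hq He Hx Hok.
rewrite /hard_entry /spin_entry /spin_columns /minport /partner /nextport /port /minn.
by fp_auto.
Qed.

End Reduction.

Lemma size_count_independent m Delta w :
  size (binary (count_independent m Delta w)) <= size w + 1.
Proof.
rewrite size_binary_le count_independentE; case: ifP => _; last by rewrite expn_gt0.
rewrite addn1 /num_free; apply: (@leq_ltn_trans (2 ^ num_vertices w)).
  by apply: leq_trans (max_card _) _; rewrite -cardsT -powersetT card_powerset cardsT card_ord.
by rewrite ltn_exp2l // ltnS index_size.
Qed.

Lemma fp_count_query m Delta (A : code) (w : A -> word)
    (O := Oracle (fun q => binary (count_independent m Delta q)) true) :
  fp O w -> fp O (fun a => Bnat (count_independent m Delta (w a))).
Proof.
move=> Hw; apply/fp_bnat1; apply: fp_of1.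
apply: (@fp1_query O _ _ 1) => //; last exact: fp_to1.
exact: size_count_independent.
Qed.

Section Encoding.

Variables (mu Delta K : nat).

(* [2 ^ gadget_unit N] exceeds the number of vertex sets and [2 ^ gadget_ports N] all
   the terms without a conflict, so that the digits do not overlap; [gadget_chain N]
   is odd and makes the Lucas number larger than the whole sum. *)
Definition gadget_unit (N : nat) : nat := (N * K).+1.
Definition gadget_ports (N : nat) : nat := gadget_unit N + gadget_unit N * N.
Definition gadget_chain (N : nat) : nat :=
  (N * K + N * K * (N * K) * (gadget_unit N + gadget_ports N)).*2.+1.

Definition query_word (N : nat) (ok : nat -> nat -> bool) : word :=
  let n := N * K in let t := gadget_ports N in let q := (gadget_chain N + gadget_chain N).-1 in
  word_of_rows (hard_rows n t q Delta) (hard_columns n t q mu Delta)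
    (hard_entry n t (gadget_unit N) ok q mu Delta).

(** Undoes the construction from outside in: the sunflower factor, the power
    [a ^ (l * (n * (n * t)))] modulo [V_l] by halvings, and finally the window of digits of [Z]. *)
Definition decode_count (N c : nat) : nat :=
  let n := N * K in let t := gadget_ports N in let l := gadget_chain N in
  let V := (lucas (2 ^ mu.+1) l).1 in
  halve_mod V (mu.+1 * (l * (n * (n * t)))) (c %/ num_free (@sunflower mu.+2 Delta) %% V)
    %% 2 ^ t %/ 2 ^ (gadget_unit N * N).

Lemma decode_countK (N : nat) (cmp : nat -> nat -> nat -> nat -> bool) :
  0 < N -> 0 < K -> 2 <= Delta ->
  decode_count N (count_independent mu.+3 Delta (query_word N (choice_ok K cmp))) =
  #|transversals N K cmp|.
Proof.
move=> N0 K0 D2; rewrite /decode_count /query_word -(extract_transversals N cmp K0).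
have n0 : 0 < N * K by rewrite muln_gt0 N0.
set L := gadget_unit N; set t := gadget_ports N; set l := gadget_chain N; set n := N * K.
have L0 : 0 < L by [].
have Lt : 2 * L <= t by rewrite /t /gadget_ports -/L; nia.
have t0 : 0 < t by lia.
have l2 : 2 < l by rewrite /l /gadget_chain -/n -/L -/t; nia.
have hq : (l + l).-1.+1 = l.*2 by rewrite prednK ?addnn //; lia.
have ol : odd l by rewrite /l /gadget_chain /= odd_double.
have okC := choice_okC K cmp.
have q2 : 1 < (l + l).-1 by lia.
rewrite (@count_independent_rows mu.+3 Delta); last exact: valid_hard_rows; last first.
  by rewrite /hard_columns addnS.
rewrite (@num_free_hard_mod n t L _ _ mu Delta l t0 Lt okC q2 D2 hq ol) -expnM.
have [oV Vl] : odd (lucas (2 ^ mu.+1) l).1 /\ 2 ^ l < (lucas (2 ^ mu.+1) l).1.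
  by apply: lucas1_gt; rewrite ?expn_gt0 // oddX.
rewrite halve_modK //; set Z := \sum_(S : {set 'I_n}) _.
(* [Z] has [2 ^ n] terms of exponent at most [n * n * (L + t)], and [l] is chosen to exceed the
   total exponent. Thus [Z] is below the modulus and is known exactly, not just as a residue. *)
apply: leq_ltn_trans Vl; apply: (@leq_trans (\sum_(S : {set 'I_n}) 2 ^ (n * n * (L + t)))).
  apply: leq_sum => S _; rewrite leq_exp2l //.
  apply: (@leq_trans (\sum_(u < n) \sum_(w < n) (L + t))); last by rewrite !sum_nat_const !card_ord mulnA.
  apply: leq_sum => u _; apply: leq_sum => w _; case: ifP => _.
    by apply: leq_trans (leq_addr _ _); case: (_ && _); rewrite ?mul1n.
  by case: ifP => // _; apply: leq_trans (leq_addl _ _); case: (~~ _ && _); rewrite ?mul1n.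
rewrite sum_nat_const -cardsT -powersetT card_powerset cardsT card_ord -expnD leq_exp2l //.
by rewrite /l /gadget_chain -/n -/L -/t -addnn; apply: leq_trans (leqnSn _); apply: leq_addr.
Qed.

Variable O : oracle.

Lemma fp_gadget (A : code) (N : A -> nat) : fp O N ->
  [/\ fp O (fun a => gadget_unit (N a)), fp O (fun a => gadget_ports (N a)) &
      fp O (fun a => gadget_chain (N a))].
Proof.
move=> HN; rewrite /gadget_chain /gadget_ports /gadget_unit; split; try by fp_auto.
by apply: fp_ext => [a|]; first (rewrite -addnn; reflexivity); fp_auto.
Qed.

Lemma fp_query_word (A : code) (N : A -> nat) (ok : A * (nat * nat) -> bool) :
  fp O N -> fp O ok -> fp O (fun a => query_word (N a) (fun u w => ok (a, (u, w)))).
Proof.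
move=> HN Hok; have [HL Ht Hl] := fp_gadget HN.
have Hc : fp O (fun a => hard_columns (N a * K) (gadget_ports (N a))
    (gadget_chain (N a) + gadget_chain (N a)).-1 mu Delta).
  by rewrite /hard_columns /spin_columns; fp_auto.
rewrite /query_word /word_of_rows; fp_auto; first by rewrite /hard_rows; fp_auto.
have HN' : fp O (fun p : A * nat => N p.1) by fp_auto.
have [HL' Ht' Hl'] := fp_gadget HN'.
have Hok' : fp O (fun z : (A * nat) * (nat * nat) => ok (z.1.1, z.2)) by fp_auto.
apply: (fp_hard_entry mu Delta _ _ _ _ _ _ Hok'); fp_auto.
all: by apply: (fp_comp Hc (f := fst)); fp_auto.
Qed.

Lemma fp_decode_count (A : code) (N c : A -> nat) :
  fp O N -> fp O (fun a => Bnat (c a)) -> fp O (fun a => Bnat (decode_count (N a) (c a))).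
Proof.
move=> HN Hc; have [HL Ht Hl] := fp_gadget HN.
have V0 a : 0 < (lucas (2 ^ mu.+1) (gadget_chain (N a))).1.
  by have [|||_] := @lucas1_gt (2 ^ mu.+1) _ _ (gadget_chain (N a));
    rewrite ?expn_gt0 ?oddX // /gadget_chain /= ?odd_double //; apply: leq_trans.
have HV := fp_lucas (2 ^ mu.+1) Hl.
rewrite /decode_count; fp_auto; last by move=> a; rewrite expn_gt0.
  apply: fp_halve_mod => //; first by move=> a; rewrite ltn_pmod.
    by fp_auto.
  by fp_auto => // a; apply: num_free_sunflower.
by move=> a; rewrite expn_gt0.
Qed.

End Encoding.

Section Tiles.

Variable O : oracle.

Notation fp := (fp O).

(** Positions are compared arithmetically. All that involves the alphabet depends on a kind below 4
    and two tile indices below [K], hence on a fixed finite table. *)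
Lemma fp_tiles_ok (C : finType) (c0 : C) upd ini fin (A : code)
    (T p k p' k' : A -> nat) (ku ki : A -> nat -> nat) (K := #|{: C * C * C * C}|) :
  (forall a, ku a (p a %% (T a + T a).+1) < 4) ->
  (forall a, ki a (p a %% (T a + T a).+1) < 4) ->
  (forall a, k a < K) -> (forall a, k' a < K) ->
  fp T -> fp p -> fp k -> fp p' -> fp k' ->
  fp (fun a => ku a (p a %% (T a + T a).+1)) -> fp (fun a => ki a (p a %% (T a + T a).+1)) ->
  fp (fun a => tiles_ok c0 upd ini fin (ku a) (ki a) (T a) (p a) (k a) (p' a) (k' a)).
Proof.
move=> ku4 ki4 hk hk' HT Hp Hk Hp' Hk' Hku Hki; pose j0 (a : A) := 0.
have Hj0 : fp j0 by apply: fp_const.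
have j01 a : j0 a < 1 by [].
pose x a := nth_tile c0 (k a); pose y a := nth_tile c0 (k' a).
have H1 : fp (fun a => center (x a) == mid (y a)).
  exact: (fp_table3 (fun _ i i' => center (nth_tile c0 i) == mid (nth_tile c0 i')) j01 hk hk').
have H2 : fp (fun a => left (x a) == mid (y a)).
  exact: (fp_table3 (fun _ i i' => left (nth_tile c0 i) == mid (nth_tile c0 i')) j01 hk hk').
have H3 : fp (fun a => right (x a) == mid (y a)).
  exact: (fp_table3 (fun _ i i' => right (nth_tile c0 i) == mid (nth_tile c0 i')) j01 hk hk').
have H4 : fp (fun a => upd (ku a (p a %% (T a + T a).+1))
    (center (x a)) (left (x a)) (mid (x a)) (right (x a)) == mid (y a)).
  exact: (fp_table3 (fun j i i' => upd j (center (nth_tile c0 i)) (left (nth_tile c0 i))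
    (mid (nth_tile c0 i)) (right (nth_tile c0 i)) == mid (nth_tile c0 i')) ku4 hk hk').
have H5 : fp (fun a => ini (ki a (p a %% (T a + T a).+1)) (mid (x a))).
  exact: (fp_table3 (fun j i _ => ini j (mid (nth_tile c0 i))) ki4 hk hk').
have H6 : fp (fun a => fin (mid (x a))).
  exact: (fp_table3 (fun _ i _ => fin (mid (nth_tile c0 i))) j01 hk hk').
by rewrite /tiles_ok /minn -/x -/y; fp_auto.
Qed.

Lemma fp_pair_word0 : fp (fun x : word => pair_word x [::]).
Proof.
pose F (w : word) b := b :: true :: w.
apply: (fp_ext (f := fun x => rev (false :: foldl F [::] x))) => [x|].
  rewrite rev_cons /pair_word cats1; congr rcons.
  by elim/last_ind: x => // x b IH; rewrite foldl_rcons map_rcons flatten_rcons -IH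
    !rev_cons -!cats1 -!catA.
have H : fp (fun x => foldl F [::] x).
  apply: (fp_fold_grow (F := fun _ => F) (T := fun=> 2)) => //.
  - by fp_auto.
  - by fp_auto.
  - by rewrite /F; fp_auto.
  - exact: pb_const.
  by move=> a x b; rewrite /F !sz_word /= addn2.
by fp_auto.
Qed.

End Tiles.

Lemma update_kind_lt c z : update_kind c z < 4.
Proof. by rewrite /update_kind; do 3!case: ifP => // _. Qed.

Lemma initial_kind_lt v P c z : initial_kind v P c z < 4.
Proof. by rewrite /initial_kind; do 3?case: ifP => // _; case: nth. Qed.

Lemma count_independent_hard m Delta : 3 <= m -> 2 <= Delta ->
  forall g, sharpP g -> turing_reducible g (count_independent m Delta).
Proof.
case: m => [|[|[|mu]]] // _ D2 g [V [pr [[M [pt [M_free hM]]] hg]]].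
pose P (x : word) := pr.[size x]%R; pose v x := pair_word x [::].
(* [s x] is the length of the verifier's input. [T x] must dominate both this length, so that the
   input fits right of the centre, and the running time. *)
pose s x := size (v x) + P x; pose T x := pt.[s x]%R + s x.
pose C := snapshot M; pose K := #|{: C * C * C * C}|.
pose N x := (T x).+1 * (T x + T x).+1.
pose cmp x := tiles_ok (snapshot0 M) (@update M) (@initial M) (@accepting M)
  (update_kind (T x)) (initial_kind (v x) (P x) (T x)) (T x).
pose ok (a : word * (nat * nat)) := choice_ok K (cmp a.1) a.2.1 a.2.2.
pose w x := query_word mu Delta K (N x) (fun u u' => ok (x, (u, u'))).
have K0 : 0 < K by apply/card_gt0P; exists (snapshot0 M, snapshot0 M, snapshot0 M, snapshot0 M).
have gE x : g x = decode_count mu Delta K (N x) (count_independent mu.+3 Delta (w x)).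
  rewrite /w /ok /= -[fun u u' => _]/(choice_ok K (cmp x)) decode_countK //.
  rewrite hg /cmp /C (@card_accepting_tilings M M_free V (v x) (P x) (T x) pt.[s x]%R) //.
  - by apply: eq_card => y; rewrite !inE pair_word_cat.
  - by rewrite /T -/(s x) leq_addl.
  - by rewrite /T leq_addr.
  by move=> y; have := hM (v x ++ y); rewrite size_cat size_tuple.
apply: fp_turing_reducible; set O := Oracle _ _.
have HP : fp O P by apply: fp_horner; fp_auto.
have Hv : fp O v := fp_pair_word0 O.
have Hs : fp O s by rewrite /s; fp_auto.
have HT : fp O T.
  by rewrite /T; apply: fp_add => //; apply: fp_horner.
have HN : fp O N by rewrite /N; fp_auto.
have Hok : fp O ok.
  rewrite /ok /choice_ok; set A := code_prod _ _.
  (* [choice_ok] uses tile indices only modulo [K], which keeps them within the range of the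
     tables. *)
  have ltK (n : A -> nat) a : n a %% K < K by rewrite ltn_pmod.
  have Hcmp (p k p' k' : A -> nat) : fp O p -> fp O k -> fp O p' -> fp O k' ->
    fp O (fun a => cmp a.1 (p a) (k a %% K) (p' a) (k' a %% K)).
    move=> Hp Hk Hp' Hk'; apply: fp_tiles_ok => //.
    + by move=> a; apply: update_kind_lt.
    + by move=> a; apply: initial_kind_lt.
    + by fp_auto.
    + by fp_auto.
    + by fp_auto.
    + by rewrite /update_kind; fp_auto.
    + by rewrite /initial_kind; fp_auto.
  have H1 := Hcmp (fun a => a.2.1 %/ K) (fun a => a.2.1) (fun a => a.2.2 %/ K) (fun a => a.2.2).
  have H2 := Hcmp (fun a => a.2.2 %/ K) (fun a => a.2.2) (fun a => a.2.1 %/ K) (fun a => a.2.1).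
  by fp_auto; [apply: H1 | apply: H2]; fp_auto.
apply: (fp_ext (f := fun x => Bnat (decode_count mu Delta K (N x)
    (count_independent mu.+3 Delta (w x))))) => [x|]; first by rewrite -gE.
by apply: fp_decode_count => //; apply: fp_count_query; apply: fp_query_word.
Qed.

Theorem theorem4p1 (m Delta : nat) (hm : 3 <= m) :
  (2 <= Delta -> sharpP_complete (count_independent m Delta)) /\
  (Delta <= 1 -> poly_time_computable (count_independent m Delta)).
Proof.
split=> hD; last by apply: fp_poly_time_computable; apply: fp_count_low.
split; first exact: sharpP_count_independent.
exact: count_independent_hard.
Qed.
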